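(* Let $1\le p<\infty$, $\varepsilon\in[0,\varepsilon_0]$, and let $D_\varepsilon$ be connected. Then there exists a constant $C$ independent of $\varepsilon$ such that $$\|u-\bar u_{D_\varepsilon}\|_{L^p(D_\varepsilon;\omega^\varepsilon)}\le C\,\|\nabla u\|_{L^p(D_\varepsilon;\omega^\varepsilon)}\quad\text{for all }u\in W^{1,p}(D_\varepsilon;\omega^\varepsilon),$$ where $\bar u_{D_\varepsilon}=\int_{D_\varepsilon}u\,\omega^\varepsilon dx\big/\int_{D_\varepsilon}\omega^\varepsilon dx$ is the weighted mean value.
   Context: $D\subset\mathbb{R}^n$ is a bounded domain (open, connected) with boundary of class $C^{1,1}$. $d_D(x)=\mathrm{dist}(x,D)-\mathrm{dist}(x,\mathbb{R}^n\setminus D)$; $D_t=\{x: d_D(x)<t\}$; $\Gamma_\varepsilon=D_\varepsilon\setminus\overline{D_{-\varepsilon}}$. The number $\varepsilon_0>0$ is fixed and sufficiently small depending only on $D$ (so that $d_D$ is $C^{1,1}$ and nearest-point projection onto $\partial D$ is single-valued on $\Gamma_{2\varepsilon_0}$). $S:\mathbb{R}\to\mathbb{R}$ is a fixed function satisfying: (S1) $S$ is Lipschitz, $S(t)=t/|t|$ for $|t|\ge1$, $S'(t)>0$ for $|t|<1$, and $S(-t)=-S(t)$; (S2) there are $\zeta_1,\zeta_2,\alpha>0$ with $\zeta_1t^\alpha\le(1+S(t-1))/2\le\zeta_2t^\alpha$ for all $t\in(0,2)$. For $\varepsilon>0$ put $\omega^\varepsilon(x)=\frac12\bigl(1+S(-d_D(x)/\varepsilon)\bigr)$,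 so $D_\varepsilon=\{\omega^\varepsilon>0\}$; for $\varepsilon=0$, $\omega^0=\chi_D$ and $D_0=D$. $L^p(D_\varepsilon;\omega^\varepsilon)$ has norm $\|v\|^p_{L^p(D_\varepsilon;\omega^\varepsilon)}=\int_{D_\varepsilon}|v|^p\omega^\varepsilon dx$; $W^{1,p}(D_\varepsilon;\omega^\varepsilon)$ is the space of $v$ with $v$ and its weak first partial derivatives in $L^p(D_\varepsilon;\omega^\varepsilon)$. *)

(* Defs.v *)
From HB Require Import structures.
From mathcomp Require Import all_boot all_order all_algebra.
From mathcomp Require Import all_classical all_reals all_analysis.

Set Implicit Arguments.
Unset Strict Implicit.
Unset Printing Implicit Defensive.

Import Order.TTheory GRing.Theory Num.Theory.
Import numFieldNormedType.Exports.

Local Open Scope classical_set_scope.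
Local Open Scope ring_scope.

(* The Borel sigma-algebra of R^n, generated by the coordinate functions, as
   the library does for n.-tuple. *)
Definition rV_display : measure_display.
Proof. exact: default_measure_display. Qed.

Section measurable_rV.
Context {R : realType} (n : nat).

Let coors (i : 'I_n) (x : 'rV[R]_n) : measurableTypeR R := x ord0 i.

Let rV_set0 : g_sigma_preimage coors set0.
Proof. exact: sigma_algebra0. Qed.

Let rV_setC A : g_sigma_preimage coors A -> g_sigma_preimage coors (~` A).
Proof. exact: sigma_algebraC. Qed.

Let rV_bigcup (F : (set 'rV[R]_n)^nat) :
  (forall i, g_sigma_preimage coors (F i)) ->
  g_sigma_preimage coors (\bigcup_i (F i)).
Proof. exact: sigma_algebra_bigcup. Qed.

HB.instance Definition _ := @isMeasurable.Build rV_display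
  'rV[R]_n (g_sigma_preimage coors) rV_set0 rV_setC rV_bigcup.

End measurable_rV.

Lemma measurable_coor (R : realType) n (i : 'I_n) :
  measurable_fun [set: 'rV[R]_n] (fun x => x ord0 i : measurableTypeR R).
Proof.
move=> _ Y mY; rewrite setTI; apply: sub_sigma_algebra => /=.
rewrite -bigcup_seq/=; exists i => /=; first by rewrite mem_index_enum.
by exists Y => //; rewrite setTI.
Qed.

Lemma measurable_fun_rVP (R : realType) d (T : measurableType d) n
    (f : T -> 'rV[R]_n) :
  (forall i, measurable_fun [set: T] (fun x => f x ord0 i : measurableTypeR R)) ->
  measurable_fun [set: T] f.
Proof.
move=> mf _ Y mY; rewrite setTI.
pose coors (i : 'I_n) (x : 'rV[R]_n) : measurableTypeR R := x ord0 i.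
have /(_ (f @^-1` Y)) : g_sigma_preimage (fun i => coors i \o f) `<=` measurable.
  apply: smallest_sub; first exact: sigma_algebra_measurable.
  rewrite -bigcup_seq; apply: bigcup_sub => i _ _ [B mB <-].
  exact: mf.
by apply; rewrite g_sigma_preimage_comp; exists Y => //; rewrite setTI.
Qed.

Definition rV_cons (R : realType) n (x : measurableTypeR R * 'rV[R]_n) :
  'rV[R]_n.+1 := row_mx (x.1)%:M x.2.

Lemma measurable_rV_cons (R : realType) n : measurable_fun setT (@rV_cons R n).
Proof.
apply: measurable_fun_rVP => i; rewrite /rV_cons.
have -> : i = unsplit (@fintype.split 1 n i) by rewrite splitK.
case: (@fintype.split 1 n i) => j /=.
  rewrite [X in measurable_fun _ X](_ : _ = fst) ?measurable_fst//.
  by apply/funext => x; apply: etrans (row_mxEl _ _ _ _) _;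
    by rewrite mxE (ord1 j) mulr1n.
rewrite [X in measurable_fun _ X](_ : _ = (fun y : 'rV[R]_n => y ord0 j) \o snd).
  by apply: measurableT_comp => //; exact: measurable_coor.
by apply/funext => x; exact: row_mxEr.
Qed.

Section lebesgue_rV_succ.
Context (R : realType) (n : nat) (m : {measure set 'rV[R]_n -> \bar R}).
Local Open Scope ereal_scope.

Definition lebesgue_rV_succ : set 'rV[R]_n.+1 -> \bar R :=
  pushforward (lebesgue_measure \x^ m) (@rV_cons R n).

Let succ0 : lebesgue_rV_succ set0 = 0.
Proof. by rewrite /lebesgue_rV_succ /pushforward preimage_set0 measure0. Qed.

Let succ_ge0 A : 0 <= lebesgue_rV_succ A.
Proof. by rewrite /lebesgue_rV_succ /pushforward; exact: measure_ge0. Qed.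

Let succ_sigma_additive : semi_sigma_additive lebesgue_rV_succ.
Proof.
move=> F mF tF mUF; rewrite /lebesgue_rV_succ /pushforward preimage_bigcup.
have mpre A : measurable A -> measurable (@rV_cons R n @^-1` A).
  by move=> mA; rewrite -[X in measurable X]setTI; exact: measurable_rV_cons.
apply: measure_semi_sigma_additive.
- by move=> k; exact: mpre.
- apply/trivIsetP => /= i j _ _ ij; rewrite -preimage_setI.
  by move/trivIsetP : tF => /(_ _ _ _ _ ij) ->//; rewrite preimage_set0.
- by rewrite -preimage_bigcup; exact: mpre.
Qed.

HB.instance Definition _ := isMeasure.Build _ _ _
  lebesgue_rV_succ succ0 succ_ge0 succ_sigma_additive.

End lebesgue_rV_succ.

(* n-dimensional Lebesgue measure, as an iterated product measure. *)
Fixpoint lebesgue_rV (R : realType) n : {measure set 'rV[R]_n -> \bar R} :=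
  match n with
  | 0 => @dirac _ 'rV[R]_0 0 R
  | m.+1 => lebesgue_rV_succ (lebesgue_rV R m)
  end.

Lemma measurable_box (R : realType) n (A : 'I_n -> set R) :
  (forall i, measurable (A i : set (measurableTypeR R))) ->
  measurable [set x : 'rV[R]_n | forall i, A i (x ord0 i)].
Proof.
move=> mA.
rewrite (_ : mkset _ = \big[setI/setT]_(i < n) ((fun x : 'rV[R]_n => x ord0 i) @^-1` A i)).
  apply: big_ind => //; first exact: measurableI.
  move=> i _; rewrite -[X in measurable X]setTI.
  by apply: (@measurable_coor R n i) => //; exact: mA.
by rewrite -bigcap_seq; apply/seteqP; split => [x Ax i _|x Ax i];
  [exact: Ax|apply: Ax; rewrite /= mem_index_enum].
Qed.

Lemma lebesgue_rV_box (R : realType) n (A : 'I_n -> set R) :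
  (forall i, measurable (A i : set (measurableTypeR R))) ->
  lebesgue_rV R n [set x | forall i, A i (x ord0 i)] =
  (\prod_(i < n) lebesgue_measure (A i))%E.
Proof.
elim: n A => [|n IH] A mA.
  rewrite big_ord0 /= diracE mem_set//.
  by move=> -[].
rewrite big_ord_recl /= /lebesgue_rV_succ /pushforward.
rewrite (_ : _ @^-1` _ = A ord0 `*` [set x : 'rV[R]_n | forall i, A (lift ord0 i) (x ord0 i)]).
  rewrite product_measure2E//; first by rewrite (IH (fun i => A (lift ord0 i))).
  exact: (@measurable_box R n (fun i => A (lift ord0 i))).
have E0 (x : R * 'rV[R]_n) : rV_cons x ord0 ord0 = x.1.
  rewrite (_ : ord0 = lshift n (ord0 : 'I_1)); last exact/val_inj.
  by apply: etrans (row_mxEl _ _ _ _) _; rewrite mxE mulr1n.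
have ES (x : R * 'rV[R]_n) i : rV_cons x ord0 (lift ord0 i) = x.2 ord0 i.
  rewrite (_ : lift ord0 i = rshift 1 i); last exact/val_inj.
  exact: row_mxEr.
apply/seteqP; split => [x /= Ax|x /= [A0 AS] i].
  split; first by rewrite -E0.
  by move=> i; rewrite -ES.
by case: (unliftP ord0 i) => [j ->|->]; rewrite ?ES ?E0.
Qed.

Section geometry.
Context {R : realType} {n : nat}.
Implicit Types (x y : 'rV[R]_n) (A D : set 'rV[R]_n).

(* The norm `|x| of the library on 'rV_n is the sup norm. *)
Definition enorm x : R := Num.sqrt (\sum_(i < n) x ord0 i ^+ 2).

Definition edist x A : R := inf [set enorm (x - y) | y in A].

Definition sdist D x : R := edist x D - edist x (~` D).

(* For an open nonempty D <> R^n, offset D 0 = D. *)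
Definition offset D (t : R) : set 'rV[R]_n := [set x | sdist D x < t].

Definition tube D (e : R) : set 'rV[R]_n :=
  offset D e `\` closure (offset D (- e)).

Definition bdry A : set 'rV[R]_n := closure A `\` A°.

Definition unique_projection_on A G :=
  forall x, G x -> exists! y, A y /\ forall z, A z -> enorm (x - y) <= enorm (x - z).

Definition partial (i : 'I_n) (f : 'rV[R]_n -> R) : 'rV[R]_n -> R :=
  fun x => 'D_(delta_mx ord0 i) f x.

Definition grad (f : 'rV[R]_n -> R) x : 'rV[R]_n := \row_i partial i f x.

(* C^{1,1} with a single Lipschitz constant for the gradient on A; the choice of
   the sup norm or the Euclidean norm only affects that constant. *)
Definition C11_on A (f : 'rV[R]_n -> R) :=
  (forall x, A x -> differentiable f x) /\ [lipschitz grad f x | x in A].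

End geometry.

(* Near each boundary point D is, in suitable orthonormal coordinates, the
   strict epigraph of a C^{1,1} function of the first n coordinates. *)
Definition C11_boundary (R : realType) (n : nat) (D : set 'rV[R]_n.+1) :=
  forall z, bdry D z ->
  exists r : R, exists Q : 'M[R]_n.+1, exists phi : 'rV[R]_n -> R,
  [/\ 0 < r, Q *m Q^T = 1%:M, C11_on setT phi &
      forall x, enorm (x - z) < r ->
        (D x <-> phi (col' ord_max (x *m Q)) < (x *m Q) ord0 ord_max)].

Definition S1 (R : realType) (S : R -> R) :=
  [/\ lipschitz S,
      forall t, 1 <= `|t| -> S t = t / `|t|,
      forall t, `|t| < 1 -> derivable S t 1 /\ 0 < 'D_1 S t &
      forall t, S (- t) = - S t].

Definition S2 (R : realType) (S : R -> R) :=
  exists z1 z2 a : R, [/\ 0 < z1, 0 < z2, 0 < a &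
    forall t, 0 < t < 2 ->
      z1 * t `^ a <= (1 + S (t - 1)) / 2 <= z2 * t `^ a].

Section sobolev.
Context {R : realType} {n : nat}.
Implicit Types (O : set 'rV[R]_n) (w u f : 'rV[R]_n -> R).
Implicit Types (g : 'rV[R]_n -> 'rV[R]_n).

Local Notation mu := (lebesgue_rV R n).

Definition omega D (S : R -> R) (e : R) (x : 'rV[R]_n) : R :=
  if e == 0 then \1_D x else (1 + S (- sdist D x / e)) / 2.

Fixpoint Ck (k : nat) f : Prop :=
  match k with
  | 0 => continuous f
  | m.+1 => [/\ continuous f, forall i x, derivable f x (delta_mx ord0 i) &
                forall i, Ck m (partial i f)]
  end.

Definition test_function O f :=
  [/\ forall k, Ck k f, compact (closure [set x | f x != 0]) &
      closure [set x | f x != 0] `<=` O].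

(* Elements of L^p are represented by Borel functions on O; their values
   outside O are irrelevant. *)
Definition loc_integrable O f :=
  measurable_fun O f /\
  forall K, K `<=` O -> compact K -> mu.-integrable K (EFin \o f).

Definition weak_partial O i u v :=
  [/\ loc_integrable O u, loc_integrable O v &
      forall f, test_function O f ->
        \int[mu]_(x in O) (u x * partial i f x) =
        - \int[mu]_(x in O) (v x * f x)].

Definition wLnorm (p : R) O w f : \bar R :=
  ((\int[mu]_(x in O) (`|f x| `^ p * w x)%:E) `^ p^-1)%E.

Definition wLp (p : R) O w f :=
  measurable_fun O f /\ (wLnorm p O w f < +oo)%E.

(* u belongs to W^{1,p}(O; w) and g is its weak gradient *)
Definition wW1p (p : R) O w u g :=
  wLp p O w u /\
  forall i, weak_partial O i u (fun x => g x ord0 i) /\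
            wLp p O w (fun x => g x ord0 i).

Definition wmean O w u : R :=
  (\int[mu]_(x in O) (u x * w x)) / \int[mu]_(x in O) w x.

End sobolev.

(* Main.v *)
Require Import Defs.
From HB Require Import structures.
From mathcomp Require Import all_boot all_order all_algebra finmap.
From mathcomp Require Import all_classical all_reals all_analysis.
From mathcomp Require Import measurable_realfun.
From mathcomp Require Import ring lra.

Import Order.TTheory GRing.Theory Num.Theory.
Import numFieldNormedType.Exports.

Set Implicit Arguments.
Unset Strict Implicit.
Unset Printing Implicit Defensive.

Local Open Scope classical_set_scope.
Local Open Scope ring_scope.

(** The function u is compared with its own translates along the coordinate
axes.  Of the weights w = omega D S e only this is used: for every e >= 0 they
take values in [0,1], are at least 1/2 on D, and do not decrease when the signed
distance d = sdist D does, within their domain.  Hence the constants do not see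
e.

Fix a class of data (O, w, u, g, c), with g the weak gradient of u on O, and
call a set A controlled when the integral of |u - c|^p w over A and O is at most
K times the integral of |g|^p w over O, with one K for the whole class.  On
almost every line parallel to an axis u is an indefinite integral of g
([weak_segment_ae]), so by Hoelder and Tonelli control passes from B to A
whenever A + t e_i is contained in B, the segments from x to x + t e_i stay in
O, and w(x) <= 2 w holds along them ([controlled_translate]).  Control also
passes to subsets and to finite unions.  The set {d <= e0}, which contains all
the domains, is reached from a small cube in D as follows.

- On a cube B inside D the constant c is the value of u at a well chosen point
  of B.  It exists because the double integral of |u(z) - u(x)|^p over B x B is
  bounded by the energy: z - x is split into coordinate steps, each of which
  stays in the cube ([base_cube]).

- On D the weight lies between 1/2 and 1, so control spreads from a cube to
  overlapping cubes; connectedness carries it to a neighbourhood of each point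
  of D, and compactness to {d <= - e0} ([controlled_compact]).

- In the collar |d| <= e0 the gradient of d cannot vanish, as d changes at a
  definite speed in some direction.  Near each point of the collar there is
  therefore a signed coordinate direction in which d decreases at a definite
  rate ([descent_direction]).  Finitely many such neighbourhoods cover the
  collar, and a single translation takes each piece of {d <= t + delta} into
  {d <= t}; the weight only grows on the way.  Finitely many steps lead from
  {d <= - e0} to {d <= e0} ([controlled_collar]).

Finally the weighted mean is, up to the factor 2^p (1 + 2^p), at least as good
as any other constant ([mean_minimizes]). *)

(** * Lebesgue measure on row vectors *)

Section rV_norm.
Context {R : realType} {n : nat}.
Implicit Types x y : 'rV[R]_n.

Lemma coord_le_norm x i : `|x ord0 i| <= `|x|.
Proof.
rewrite [leRHS]/Num.norm/= mx_normrE.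
exact: (@le_bigmax _ _ _ _ (fun ij : 'I_1 * 'I_n => `|x ij.1 ij.2|) (ord0, i)).
Qed.

Lemma norm_rV_lt x e : 0 < e -> (`|x| < e) <-> forall i, `|x ord0 i| < e.
Proof.
move=> e0; split=> [xe i|xe]; first exact: le_lt_trans (coord_le_norm x i) xe.
rewrite [ltLHS]/Num.norm/= mx_normrE; apply/bigmax_ltP; split => // -[i j] _ /=.
by rewrite (ord1 i).
Qed.

Lemma norm_rV_le x e : 0 <= e -> (`|x| <= e) <-> forall i, `|x ord0 i| <= e.
Proof.
move=> e0; split=> [xe i|xe]; first exact: le_trans (coord_le_norm x i) xe.
rewrite [leLHS]/Num.norm/= mx_normrE; apply/bigmax_leP; split => // -[i j] _ /=.
by rewrite (ord1 i).
Qed.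

Lemma ball_rVE x r y : ball x r y <-> `|x - y| < r.
Proof. by rewrite -ball_normE. Qed.

End rV_norm.

Section boxes.
Context {R : realType} {n : nat}.
Implicit Types a b : 'I_n -> R.

Definition obox a b := [set x : 'rV[R]_n | forall i, x ord0 i \in `]a i, b i[ ].

Lemma measurable_obox a b : measurable (obox a b).
Proof.
by apply: (@measurable_box R n (fun i => `]a i, b i[%classic)) => i;
  exact: measurable_itv.
Qed.

Lemma lebesgue_obox a b : lebesgue_rV R n (obox a b) =
  (\prod_(i < n) lebesgue_measure (`]a i, b i[%classic : set (measurableTypeR R)))%E.
Proof.
exact: (@lebesgue_rV_box R n (fun i => `]a i, b i[%classic)).
Qed.

Lemma lebesgue_obox_lty a b : (lebesgue_rV R n (obox a b) < +oo)%E.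
Proof.
rewrite lebesgue_obox.
suff : (\prod_(i < n) lebesgue_measure (`]a i, b i[%classic : set (measurableTypeR R)))%E
    \is a fin_num by rewrite ltey_eq => ->.
elim/big_ind : _ => [//|x y|i _]; first exact: fin_numM.
by rewrite lebesgue_measure_itv /=; case: ifP.
Qed.

Lemma obox_setI a b a' b' : obox a b `&` obox a' b' =
  obox (fun i => Num.max (a i) (a' i)) (fun i => Num.min (b i) (b' i)).
Proof.
apply/seteqP; split => x /=.
  move=> [xa xb] i; have := xa i; have := xb i.
  by rewrite !in_itv/= gt_max lt_min => /andP[? ?] /andP[? ?]; apply/andP; split; apply/andP.
by move=> xab; split => i; have := xab i;
  rewrite !in_itv/= gt_max lt_min => /andP[/andP[? ?] /andP[? ?]]; apply/andP.
Qed.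

Definition ncube (k : nat) := obox (fun=> - k%:R) (fun=> k%:R).

Lemma bigcup_ncube : \bigcup_k ncube k = setT.
Proof.
rewrite -subTset => x _; exists (Num.bound `|x|) => //= i.
rewrite in_itv/= -ltr_norml (le_lt_trans (coord_le_norm x i))//.
by rewrite archi_boundP.
Qed.

Lemma rV_measurableE : @measurable _ 'rV[R]_n =
  <<s [set A | exists a b, A = obox a b] >>.
Proof.
apply/seteqP; split; last first.
  apply: smallest_sub; first exact: sigma_algebra_measurable.
  by move=> _ [a [b ->]]; exact: measurable_obox.
apply: smallest_sub; first exact: smallest_sigma_algebra.
rewrite -bigcup_seq; apply: bigcup_sub => i _ A.
set G := [set A | exists a b, A = obox a b].
rewrite /preimage_set_system/= => -[B mB <-]; rewrite setTI.
have {}mB : (@RGenOpens.G R).-sigma.-measurable B by rewrite -RGenOpens.measurableE.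
set f : 'rV[R]_n -> R := fun x => x ord0 i.
pose F := [set B | <<s G >> (f @^-1` B)].
suff : <<s @RGenOpens.G R >> `<=` F by apply.
apply: smallest_sub.
  split => /=.
  - by rewrite /F /= preimage_set0; apply: sigma_algebra0.
  - by move=> C FC; exact: (sigma_algebraCD FC).
  - move=> C FC; rewrite /F /= preimage_bigcup.
    exact: (sigma_algebra_bigcup FC).
move=> _ [x [y ->]]; rewrite /F/=.
rewrite (_ : _ @^-1` _ = \bigcup_k
   obox (fun j => if j == i then x else - k%:R) (fun j => if j == i then y else k%:R)).
  apply: sigma_algebra_bigcup => k.
  by apply: sub_sigma_algebra; do 2 eexists; reflexivity.
apply/seteqP; split => z /=.
  move=> zxy; have : [set: 'rV[R]_n] z by [].
  rewrite -bigcup_ncube => -[k _ zk]; exists k => //= j.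
  by case: eqP => [->//|_]; exact: zk.
by move=> [k _ /(_ i)]; rewrite eqxx.
Qed.

(** Open boxes form a pi-system which generates the Borel sets and exhausts the
    space, so this is the uniqueness theorem for measures. *)
Lemma obox_measure_unique (m1 m2 : {measure set 'rV[R]_n -> \bar R}) :
  (forall a b, m1 (obox a b) = m2 (obox a b)) ->
  (forall a b, (m1 (obox a b) < +oo)%E) ->
  forall A, measurable A -> m1 A = m2 A.
Proof.
move=> m12 m1oo; apply: (measure_unique [set A | exists a b, A = obox a b] ncube).
- exact: rV_measurableE.
- move=> _ _ [a [b ->]] [a' [b' ->]]; rewrite obox_setI.
  by do 2 eexists; reflexivity.
- by move=> k; do 2 eexists; reflexivity.
- exact: bigcup_ncube.
- by move=> _ [a [b ->]].
- by move=> k; exact: m1oo.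
Qed.

Lemma lebesgue_rV_sigma_finite : sigma_finite [set: 'rV[R]_n] (lebesgue_rV R n).
Proof.
exists ncube; first by rewrite bigcup_ncube.
by move=> k; split; [exact: measurable_obox|exact: lebesgue_obox_lty].
Qed.

(** The same measure under another name, which carries the sigma-finite
    structure that Tonelli's theorem asks for. *)
Definition slebesgue : set 'rV[R]_n -> \bar R := lebesgue_rV R n.
HB.instance Definition _ := Measure.on slebesgue.
HB.instance Definition _ := Measure_isSigmaFinite.Build _ _ _ slebesgue
  lebesgue_rV_sigma_finite.

End boxes.

Section translation.
Context {R : realType} {n : nat}.
Local Notation mu := (lebesgue_rV R n).

Lemma measurable_fun_add d (T : measurableType d) (f g : T -> 'rV[R]_n) :
  measurable_fun setT f -> measurable_fun setT g ->
  measurable_fun setT (fun x => f x + g x).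
Proof.
move=> mf mg; apply: measurable_fun_rVP => i.
rewrite [X in measurable_fun _ X](_ : _ = (fun x => f x ord0 i + g x ord0 i)); last first.
  by apply/funext => x; rewrite mxE.
by apply: measurable_funD; [exact: (measurableT_comp (measurable_coor i) mf)|
  exact: (measurableT_comp (measurable_coor i) mg)].
Qed.

Lemma measurable_fun_scale d (T : measurableType d) (f : T -> measurableTypeR R) (v : 'rV[R]_n) :
  measurable_fun setT f -> measurable_fun setT (fun x => f x *: v).
Proof.
move=> mf; apply: measurable_fun_rVP => i.
rewrite [X in measurable_fun _ X](_ : _ = (fun x => f x * v ord0 i)); last first.
  by apply/funext => x; rewrite mxE.
by apply: measurable_funM => //.
Qed.

Lemma measurable_shift (v : 'rV[R]_n) : measurable_fun setT (fun x : 'rV[R]_n => x + v).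
Proof. by apply: measurable_fun_add. Qed.

(** The measure and its image under the shift agree on boxes. *)
Lemma lebesgue_rV_shift (v : 'rV[R]_n) (A : set 'rV[R]_n) : measurable A ->
  mu ((fun x => x + v) @^-1` A) = mu A.
Proof.
move=> mA; symmetry.
pose m2 : {measure set 'rV[R]_n -> \bar R} :=
  measure_function_pushforward__canonical__measure_function_Measure mu (measurable_shift v).
have -> : mu ((fun x => x + v) @^-1` A) = m2 A by [].
apply: (@obox_measure_unique _ _ (lebesgue_rV R n) m2) => // a b; last exact: lebesgue_obox_lty.
rewrite /m2 /= /pushforward/= (_ : _ @^-1` _ = obox (fun i => a i - v ord0 i) (fun i => b i - v ord0 i)).
  rewrite !lebesgue_obox; apply: eq_bigr => i _.
  rewrite !lebesgue_measure_itv/= !lte_fin ltrD2r; case: ifP => // _.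
  by rewrite -!EFinB; congr (_%:E); lra.
by apply/seteqP; split => x /= H i; have := H i;
  rewrite !in_itv/= mxE ltrBlDr ltrBrDr.
Qed.

Lemma ge0_integral_shift (v : 'rV[R]_n) (f : 'rV[R]_n -> \bar R) :
  measurable_fun setT f -> (forall x, (0 <= f x)%E) ->
  (\int[mu]_x f (x + v)%R = \int[mu]_x f x)%E.
Proof.
move=> mf f0.
have := @ge0_integral_pushforward _ _ _ _ R _ (measurable_shift v) mu setT f
  measurableT mf (fun y _ => f0 y).
rewrite preimage_setT => <-.
apply: (@eq_measure_integral _ _ _ setT (lebesgue_rV R n)
  (measure_function_pushforward__canonical__measure_function_Measure mu
    (measurable_shift v))) => A mA _.
exact: (lebesgue_rV_shift v mA).
Qed.

End translation.

Section opens.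
Context {R : realType} {n : nat}.

(** Cubes with rational centres, with their closures, form a countable base of
    the topology; this turns statements near each point into countably many
    statements. *)
Definition rcube (c : 'rV[rat]_n) (k : nat) : set 'rV[R]_n :=
  obox (fun i => ratr (c ord0 i) - k.+1%:R^-1) (fun i => ratr (c ord0 i) + k.+1%:R^-1).

Definition rcube_closed (c : 'rV[rat]_n) (k : nat) : set 'rV[R]_n :=
  [set x | forall i, x ord0 i \in `[ratr (c ord0 i) - k.+1%:R^-1, ratr (c ord0 i) + k.+1%:R^-1] ].

Lemma rcube_in_nbhs (x : 'rV[R]_n) (O : set 'rV[R]_n) : nbhs x O ->
  exists c k, rcube c k x /\ rcube_closed c k `<=` O.
Proof.
move=> /nbhs_ballP[e /= e0 eO].
pose k := Num.bound (e^-1 * 3).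
have k0 : 0 < k.+1%:R^-1 :> R by rewrite invr_gt0.
have ke : k.+1%:R^-1 * 3 < e.
  rewrite mulrC ltr_pdivrMr// -ltr_pdivrMl//.
  apply: (@lt_trans _ _ k%:R); last by rewrite ltr_nat.
  by rewrite archi_boundP// mulr_ge0// invr_ge0 ltW.
have [r rE] : exists r : R, r = k.+1%:R^-1 by exists (k.+1%:R^-1).
rewrite -rE in k0 ke.
have /choice[q qP] (i : 'I_n) : exists q : rat, ratr q \in `]x ord0 i - r, x ord0 i + r[.
  by apply: rat_in_itvoo; lra.
exists (\row_i q i), k; rewrite /rcube /rcube_closed -rE; split => [i|y /= xy].
  by have := qP i; rewrite !in_itv/= mxE; lra.
apply: eO; apply/ball_rVE/norm_rV_lt => // i.
rewrite mxE [(- y) _ _]mxE.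
by have := qP i; have := xy i; rewrite !in_itv/= mxE ltr_norml; lra.
Qed.

Lemma rcube_sub c k : rcube c k `<=` rcube_closed c k.
Proof. by move=> x xc i; exact: subset_itv_oo_cc (xc i). Qed.

Lemma open_rcubeE (O : set 'rV[R]_n) : open O ->
  O = \bigcup_(ck in [set ck : 'rV[rat]_n * nat | rcube_closed ck.1 ck.2 `<=` O]) rcube ck.1 ck.2.
Proof.
move=> oO; apply/seteqP; split => [x Ox|x [[c k]] /= cO cx]; last first.
  exact/cO/rcube_sub.
have [c [k [cx cO]]] := rcube_in_nbhs (open_nbhs_nbhs (conj oO Ox)).
by exists (c, k).
Qed.

Lemma open_rV_measurable (O : set 'rV[R]_n) : open O -> measurable O.
Proof.
move=> oO; rewrite (open_rcubeE oO) bigcup_mkcond.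
apply: countable_bigcupT_measurable => [|ck]; first exact: countableP.
by case: ifP => // _; exact: measurable_obox.
Qed.

Lemma continuous_rV_measurable (f : 'rV[R]_n -> R) : continuous f ->
  measurable_fun setT (f : _ -> measurableTypeR R).
Proof.
move=> cf; apply: (measurability _ (RGenOpens.measurableE R)).
move=> _ [_ [a [b ->] <-]]; rewrite setTI.
by apply: open_rV_measurable; apply: open_comp => //; exact: interval_open.
Qed.

End opens.

(** * Smooth bumps on the line *)

Section smooth1.
Context {R : realType}.
Implicit Types (f g : R -> R) (x y : R).

(** The derivative is a witness rather than a term, so that the closure
    properties below are inductions on formulas for it. *)
Fixpoint Ck1 (k : nat) f : Prop :=
  match k with
  | 0 => continuous f
  | m.+1 => exists f', (forall x, is_derive x 1 f (f' x)) /\ Ck1 m f'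
  end.

Definition smooth1 f := forall k, Ck1 k f.

Lemma is_derive_continuous f (f' : R -> R) :
  (forall x, is_derive x 1 f (f' x)) -> continuous f.
Proof.
move=> df x; apply: differentiable_continuous; apply/derivable1_diffP.
by have [] := df x.
Qed.

Lemma Ck1_S k f : Ck1 k.+1 f -> Ck1 k f.
Proof.
elim: k f => [|k IH] f [f' [df cf']]; first exact: is_derive_continuous df.
by exists f'; split => //; exact: IH.
Qed.

Lemma smooth1_continuous f : smooth1 f -> continuous f.
Proof. by move=> /(_ 0%N). Qed.

(** The derivatives given at the different orders coincide, because derivatives
    are unique. *)
Lemma smooth1_derive f : smooth1 f ->
  exists f', (forall x, is_derive x 1 f (f' x)) /\ smooth1 f'.
Proof.
move=> sf; have [f' [df _]] := sf 1%N; exists f'; split => // k.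
have [g [dg cg]] := sf k.+1.
suff -> : f' = g by [].
by apply/funext => x; rewrite -(@derive_val _ _ _ _ _ _ _ (df x)) (@derive_val _ _ _ _ _ _ _ (dg x)).
Qed.

Lemma Ck1_add k f g : Ck1 k f -> Ck1 k g -> Ck1 k (fun x => f x + g x).
Proof.
elim: k f g => [|k IH] f g /=; first by move=> cf cg x; exact: cvgD (cf x) (cg x).
move=> [f' [df cf]] [g' [dg cg]]; exists (fun x => f' x + g' x); split; last exact: IH.
by move=> x; exact: is_deriveD.
Qed.

Lemma Ck1_mul k f g : Ck1 k f -> Ck1 k g -> Ck1 k (fun x => f x * g x).
Proof.
elim: k f g => [|k IH] f g; first by move=> cf cg x; exact: cvgM (cf x) (cg x).
move=> cf cg; have cf0 := Ck1_S cf; have cg0 := Ck1_S cg.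
case: cf => [f' [df cf]]; case: cg => [g' [dg cg]].
exists (fun x => f x * g' x + g x * f' x); split; last by apply: Ck1_add; exact: IH.
by move=> x; exact: is_deriveM.
Qed.

Lemma Ck1_cst k c : Ck1 k (fun=> c).
Proof.
elim: k c => [|k IH] c /=; first by move=> x; exact: cvg_cst.
by exists (fun=> 0); split => [x|]; [exact: is_derive_cst|exact: IH].
Qed.

Lemma is_derive_affine c d x : is_derive x 1 (fun x => c * x + d) c.
Proof.
have : is_derive x 1 (c \*: (@id R) + cst d) (c *: 1 + 0).
  by apply: is_deriveD.
by move/is_derive_eq; apply; rewrite addr0 [LHS]mulr1.
Qed.

Lemma Ck1_affine k f c d : Ck1 k f -> Ck1 k (fun x => f (c * x + d)).
Proof.
elim: k f => [|k IH] f /=.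
  move=> cf x; apply: (@continuous_comp _ _ _ (fun x => c * x + d) f); last exact: cf.
  exact: (is_derive_continuous (is_derive_affine c d)).
move=> [f' [df cf]]; exists (fun x => f' (c * x + d) * c); split.
  by move=> x; apply: is_derive1_comp; exact: is_derive_affine.
by apply: Ck1_mul; [exact: IH|exact: Ck1_cst].
Qed.

End smooth1.

Section flat.
Context {R : realType}.

(** The functions t^-m exp(-1/t), extended by 0 to the negative axis: the case
    m = 0 is the standard smooth function that is flat at the origin, and larger m
    occur in its derivatives. *)
Definition flat (m : nat) (x : R) : R :=
  if 0 < x then x ^- m * expR (- x^-1) else 0.

Lemma flat_ge0 m x : 0 <= flat m x.
Proof.
rewrite /flat; case: ifPn => // x0.
by rewrite mulr_ge0 ?expR_ge0// invr_ge0 exprn_ge0// ltW.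
Qed.

(** Since exp(1/x) exceeds the term of order m+1 of its series, the exponential
    beats the pole with one power of x to spare.  This gives both continuity and
    differentiability at 0. *)
Lemma flat_le m x : flat m x <= m.+1`!%:R * `|x|.
Proof.
rewrite /flat; case: ifPn => x0; last by rewrite mulr_ge0.
rewrite gtr0_norm// expRN ler_pdivrMr ?expR_gt0//.
have y0 : 0 <= x^-1 by rewrite invr_ge0 ltW.
have := expR_ge1Dxn m y0.
have f0 : 0 < m.+1`!%:R :> R by rewrite ltr0n fact_gt0.
move=> h; have {}h : x^-1 ^+ m.+1 / m.+1`!%:R <= expR x^-1 by apply: le_trans h; rewrite lerDr.
move: h; rewrite ler_pdivrMr// => h.
apply: le_trans (_ : x * x^-1 ^+ m.+1 <= _).
  by rewrite exprS mulrA divff ?gt_eqF// mul1r exprVn.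
rewrite [leRHS](_ : _ = x * (expR x^-1 * m.+1`!%:R)); last by ring.
by rewrite ler_pM2l.
Qed.

Lemma flat0 m : flat m 0 = 0.
Proof. by rewrite /flat ltxx. Qed.

Lemma flat_cvg0 m : flat m x @[x --> 0] --> 0.
Proof.
apply: (@squeeze_cvgr _ _ _ _ (fun=> 0) (fun x => m.+1`!%:R * `|x|)).
- by apply: nearW => x; rewrite flat_ge0 flat_le.
- exact: cvg_cst.
- rewrite -[X in _ --> X](mulr0 m.+1`!%:R) -[X in _ * X](@normr0 _ R^o).
  by apply: cvgM; [exact: cvg_cst|exact: cvg_norm].
Qed.

Lemma is_derive_flat m (x : R) : is_derive x 1 (flat m) (- m%:R * flat m.+1 x + flat m.+2 x).
Proof.
have [x0|x0|->] := ltgtP x 0.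
- have fx k : flat k x = 0 by rewrite /flat ltNge (ltW x0).
  rewrite !fx mulr0 addr0.
  apply: (@near_eq_is_derive _ _ _ (cst (0 : R))).
  near=> y; rewrite /flat ifF//; apply/negbTE; rewrite -leNgt ltW//.
  by near: y; exact: lt_nbhsl.
- have xn0 : x != 0 by rewrite gt_eqF.
  apply: (@near_eq_is_derive _ _ _ (fun y : R => (y ^- m * expR (- y^-1) : R)%R)).
    near=> y; rewrite /flat ifT//; near: y; exact: lt_nbhsr.
  have dinv : is_derive x 1 (fun y : R => y^-1) (- x ^- 2 *: 1).
    by apply: is_deriveV.
  have dpow : is_derive x 1 (fun y : R => y ^- m) (- (x ^+ m) ^- 2 *: ((m%:R * x ^+ m.-1) *: 1)).
    apply: (@is_deriveV _ (fun y => y ^+ m)); first by rewrite expf_neq0.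
    rewrite (_ : (fun y : R => y ^+ m) = id ^+ m); last by rewrite exprfctE.
    exact: is_deriveX.
  have dexp : is_derive x 1 (fun y : R => expR (- y^-1)) (expR (- x^-1) * - (- x ^- 2 *: 1)).
    exact: (@is_derive1_comp _ expR (fun y => - y^-1) _ _ _ (is_derive_expR _) (is_deriveN dinv)).
  apply: (is_derive_eq (is_deriveM dpow dexp)).
  rewrite /flat x0 /GRing.scale/= !mulr1.
  case: m {dpow} => [|m]; first by rewrite !expr0 !invr1 expr1; field.
  by rewrite !exprS [m.+1.-1]/=; field; rewrite expf_neq0.
- rewrite !flat0 mulr0 addr0.
  have H : h^-1 *: ((flat m \o shift 0) (h *: 1) - flat m 0) @[h --> 0^'] --> 0.
    have -> : (fun h => h^-1 *: ((flat m \o shift 0) (h *: 1) - flat m 0)) = flat m.+1.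
      apply/funext => h; rewrite /= flat0 subr0 addr0 /GRing.scale/= mulr1 /flat.
      case: ifPn => h0; last by rewrite mulr0.
      by rewrite exprS; field; rewrite ?expf_neq0 ?gt_eqF.
    apply: cvg_trans (@flat_cvg0 m.+1).
    by apply: cvg_app; exact: nbhs_dnbhs.
  apply: DeriveDef; first by apply/cvg_ex; exists 0.
  exact/cvg_lim.
Unshelve. all: by end_near. Qed.

Lemma smooth1_flat m : smooth1 (flat m).
Proof.
move=> k; elim: k m => [|k IH] m.
  exact: is_derive_continuous (is_derive_flat m).
exists (fun x => - m%:R * flat m.+1 x + flat m.+2 x); split.
  exact: is_derive_flat.
by apply: Ck1_add => //; apply: Ck1_mul => //; exact: Ck1_cst.
Qed.

End flat.

Section smooth_bump.
Context {R : realType}.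
Implicit Types (a b : R) (k : nat).

(** As k grows these bumps increase to the indicator of the interval ]a, b[. *)
Definition smooth_bump a b k (x : R) : R :=
  flat 0 (k.+1%:R * (x - a)) * flat 0 (k.+1%:R * (b - x)).

Lemma smooth1_bump a b k : smooth1 (smooth_bump a b k).
Proof.
move=> m; apply: Ck1_mul.
  rewrite (_ : (fun x : R => _) = (fun x => flat 0 (k.+1%:R * x + - (k.+1%:R * a)))); last first.
    by apply/funext => x; rewrite mulrBr.
  exact/Ck1_affine/smooth1_flat.
rewrite (_ : (fun x : R => _) = (fun x => flat 0 (- k.+1%:R * x + (k.+1%:R * b)))); last first.
  by apply/funext => x; congr flat; ring.
exact/Ck1_affine/smooth1_flat.
Qed.

Lemma flat0_le1 (x : R) : flat 0 x <= 1.
Proof.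
rewrite /flat; case: ifPn => // x0; rewrite expr0 invr1 mul1r expRN invf_le1 ?expR_gt0//.
by rewrite (le_trans _ (expR_ge1Dx _))// lerDl invr_ge0 ltW.
Qed.

Lemma bump_ge0 a b k x : 0 <= smooth_bump a b k x.
Proof. by rewrite mulr_ge0 ?flat_ge0. Qed.

Lemma bump_le1 a b k x : smooth_bump a b k x <= 1.
Proof. by rewrite mulr_ile1 ?flat_ge0 ?flat0_le1. Qed.

Lemma bump_out a b k x : x \notin `]a, b[ -> smooth_bump a b k x = 0.
Proof.
rewrite in_itv/= negb_and -!leNgt /smooth_bump /flat => /orP[xa|bx].
  rewrite ifF ?mul0r//; apply/negbTE; rewrite -leNgt.
  by rewrite mulr_ge0_le0// subr_le0.
rewrite [X in _ * X]ifF ?mulr0//; apply/negbTE; rewrite -leNgt.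
by rewrite mulr_ge0_le0// subr_le0.
Qed.

Lemma flat0_cvg1 (y : R) : 0 < y -> flat 0 (k.+1%:R * y) @[k --> \oo] --> (1 : R).
Proof.
move=> y0.
have -> : (fun k : nat => flat 0 (k.+1%:R * y)) = (fun k => expR (- (k.+1%:R^-1 * y^-1))).
  by apply/funext => k; rewrite /flat ifT ?mulr_gt0// expr0 invr1 mul1r invfM.
have H : - (k.+1%:R^-1 * y^-1) @[k --> \oo] --> (0 : R).
  rewrite -oppr0; apply: cvgN; rewrite -[X in _ --> X](mul0r y^-1).
  by apply: cvgM; [exact: (@cvg_harmonic R)|exact: cvg_cst].
rewrite -[X in _ --> X](@expR0 R).
exact: (continuous_cvg _ (@continuous_expR R 0) H).
Qed.

Lemma bump_cvg a b x : smooth_bump a b k x @[k --> \oo] --> ((x \in `]a, b[)%:R : R).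
Proof.
have [xab|xab] := boolP (x \in `]a, b[); last first.
  by under eq_fun do rewrite bump_out//; exact: cvg_cst.
rewrite /= -[1%:R]mulr1; move: xab; rewrite in_itv/= => /andP[ax xb].
by apply: cvgM; apply: flat0_cvg1; rewrite subr_gt0.
Qed.

(** Averages of a bump over [t, t + h] are differences of a primitive, which makes
    their derivatives explicit. *)
Lemma bump_primitive a b k : exists F : R -> R, forall x : R, is_derive x 1 F (smooth_bump a b k x).
Proof.
set f := smooth_bump a b k.
have cf : continuous f := smooth1_continuous (@smooth1_bump a b k).
have itf u : lebesgue_measure.-integrable `]-oo, u] (EFin \o f).
  have mf : measurable_fun setT f by exact: continuous_measurable_fun.
  suff : lebesgue_measure.-integrable setT (EFin \o f).
    by apply: integrableS => //.
  have -> : EFin \o f = (EFin \o f) \_ (`[a, b]).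
    apply/funext => x; rewrite patchE; case: ifPn => //= xab.
    rewrite /f bump_out//; apply: contra xab; rewrite inE/=.
    by apply: subset_itv_oo_cc.
  apply/integrable_restrict => //; rewrite setTI.
  by apply: continuous_compact_integrable; [exact: segment_compact|exact: continuous_subspaceT].
exists (fun y => (\int[lebesgue_measure]_(t in [set` Interval (-oo)%O (BRight y)]) (f t))%R) => x.
have x1 : x < x + 1 by rewrite ltrDl.
have [d1 d2] := @continuous_FTC1 R f (-oo)%O x (x + 1) x1 (itf _) (ltNyr x) (cf x).
by apply: DeriveDef => //; rewrite -d2 derive1E.
Qed.

End smooth_bump.

(** * Tensor products as test functions *)

Section tensor.
Context {R : realType} {n : nat}.
Implicit Types (b : 'I_n -> R -> R) (x : 'rV[R]_n) (i : 'I_n).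

Definition tensor b x : R := \prod_(j < n) b j (x ord0 j).

Lemma tensor_continuous b : (forall j, continuous (b j)) -> continuous (tensor b).
Proof.
move=> cb x; rewrite /tensor.
have cbj j : {for x, continuous (fun y : 'rV[R]_n => b j (y ord0 j))}.
  apply: (@continuous_comp _ _ _ (fun y : 'rV[R]_n => y ord0 j) (b j)).
    exact: coord_continuous.
  exact: cb.
elim: (index_enum _) => [|j s IH].
  rewrite (_ : (fun y : 'rV[R]_n => _) = cst 1); first exact: cst_continuous.
  by apply/funext => y; rewrite big_nil.
rewrite (_ : (fun y : 'rV[R]_n => _) =
  (fun y => b j (y ord0 j) * \prod_(j <- s) b j (y ord0 j))); last first.
  by apply/funext => y; rewrite big_cons.
exact: (continuousM (cbj j) IH).
Qed.

Lemma tensorD1 b i x : tensor b x = b i (x ord0 i) * \prod_(j < n | j != i) b j (x ord0 j).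
Proof. by rewrite /tensor (bigD1 i). Qed.

(** Along the i-th axis all factors but one are constant. *)
Lemma is_derive_tensor b i x (b' : R -> R) : is_derive (x ord0 i) 1 (b i) (b' (x ord0 i)) ->
  is_derive x (delta_mx ord0 i) (tensor b) (tensor (fun j => if j == i then b' else b j) x).
Proof.
move=> dbi.
set P := \prod_(j < n | j != i) b j (x ord0 j).
have shiftE (h : R) : tensor b (h *: delta_mx ord0 i + x) = b i (h + x ord0 i) * P.
  rewrite (tensorD1 _ i); congr (b i _ * _); first by rewrite !mxE !eqxx mulr1.
  apply: eq_bigr => j ji; congr (b j _).
  by rewrite !mxE eqxx (negbTE ji) mulr0 add0r.
have dP : is_derive (x ord0 i) 1 (fun t => b i t * P) (b' (x ord0 i) * P).
  by apply: (is_derive_eq (is_deriveM dbi (is_derive_cst P _ _)));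
    rewrite scaler0 add0r /GRing.scale/= mulrC.
have E : (fun h => h^-1 *: ((tensor b \o shift x) (h *: delta_mx ord0 i) - tensor b x)) =
  (fun h => h^-1 *: (((fun t => b i t * P) \o shift (x ord0 i)) (h *: 1) - b i (x ord0 i) * P)).
  apply/funext => h /=; rewrite shiftE /GRing.scale/= mulr1; congr (_ * (_ - _)).
  by rewrite (tensorD1 _ i).
rewrite (tensorD1 _ i) eqxx.
rewrite (_ : \prod_(j < n | j != i) _ = P); last first.
  by apply: eq_bigr => j /negbTE ->.
case: dP => dP1 dP2; apply: DeriveDef.
  by move: dP1; rewrite /derivable E.
by move: dP2; rewrite /derive E.
Qed.

Lemma Ck_tensor k b : (forall j, smooth1 (b j)) -> Ck k (tensor b).
Proof.
elim: k b => [|k IH] b sb.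
  by apply: tensor_continuous => j; exact: smooth1_continuous.
split=> [|i x|i].
- by apply: tensor_continuous => j; exact: smooth1_continuous.
- have [b' [db _]] := smooth1_derive (sb i).
  by have [] := @is_derive_tensor b i x b' (db (x ord0 i)).
- have [b' [db sb']] := smooth1_derive (sb i).
  rewrite (_ : partial i (tensor b) = tensor (fun j => if j == i then b' else b j)).
    by apply: IH => j; case: ifP.
  apply/funext => x; rewrite /partial.
  by have [_ ->] := @is_derive_tensor b i x b' (db (x ord0 i)).
Qed.

Lemma partial_tensor b i (b' : R -> R) : (forall t : R, is_derive t 1 (b i) (b' t)) ->
  partial i (tensor b) = tensor (fun j => if j == i then b' else b j).
Proof.
move=> db; apply/funext => x; rewrite /partial.
by have [_ ->] := @is_derive_tensor b i x b' (db (x ord0 i)).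
Qed.

Definition cbox (a b : 'I_n -> R) := [set x : 'rV[R]_n | forall i, x ord0 i \in `[a i, b i] ].

Lemma cbox_compact (lo hi : 'I_n -> R) : compact (cbox lo hi).
Proof.
apply: (@rV_compact _ _ (fun i => `[lo i, hi i]%classic)) => i.
exact: segment_compact.
Qed.

Lemma cbox_closed (lo hi : 'I_n -> R) : closed (cbox lo hi).
Proof. by apply: compact_closed; [exact: norm_hausdorff|exact: cbox_compact]. Qed.

Lemma test_function_tensor (O : set 'rV[R]_n) b lo hi : (forall j, smooth1 (b j)) ->
  (forall j t, t \notin `[lo j, hi j] -> b j t = 0) ->
  cbox lo hi `<=` O -> test_function O (tensor b).
Proof.
move=> sb b0 loO.
have sub : closure [set x | tensor b x != 0] `<=` cbox lo hi.
  rewrite ((closure_id _).1 (@cbox_closed lo hi)).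
  apply: closure_subset => x /= bx i; apply: contraNT bx => xi.
  by rewrite (tensorD1 _ i) b0// mul0r.
split.
- by move=> k; exact: Ck_tensor.
- by apply: (subclosed_compact _ (@cbox_compact lo hi) sub); exact: closed_closure.
- exact: subset_trans sub loO.
Qed.

End tensor.

(** * Integrals over boxes determine a density *)

Section density_measure.
Context d (T : measurableType d) (R : realType) (m : {measure set T -> \bar R}).
Local Open Scope ereal_scope.

Definition density_measure (f : T -> \bar R) of measurable_fun setT f &
  (forall x, 0 <= f x) := fun A : set T => \int[m]_(x in A) f x.

Context (f : T -> \bar R) (mf : measurable_fun setT f) (f0 : forall x, 0 <= f x).

Let density0 : density_measure mf f0 set0 = 0.
Proof. exact: integral_set0. Qed.

Let density_ge0 A : 0 <= density_measure mf f0 A.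
Proof. by apply: integral_ge0. Qed.

Let density_additive : semi_sigma_additive (density_measure mf f0).
Proof. exact: semi_sigma_additive_nng_induced. Qed.

HB.instance Definition _ := isMeasure.Build _ _ _ (density_measure mf f0)
  density0 density_ge0 density_additive.

End density_measure.

Section density.
Context {R : realType} {n : nat}.
Local Notation mu := (lebesgue_rV R n).
Local Open Scope ereal_scope.

(** After restriction to the box the two densities define measures that agree on
    all boxes, hence on all Borel sets. *)
Lemma box_density_ae_eq (lo hi : 'I_n -> R) (F1 F2 : 'rV[R]_n -> \bar R) :
  measurable_fun setT F1 -> measurable_fun setT F2 ->
  (forall x, 0 <= F1 x) -> (forall x, 0 <= F2 x) ->
  \int[mu]_(x in obox lo hi) F1 x < +oo ->
  (forall a b, (forall j, (lo j <= a j)%R) -> (forall j, (b j <= hi j)%R) ->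
    \int[mu]_(x in obox a b) F1 x = \int[mu]_(x in obox a b) F2 x) ->
  ae_eq mu (obox lo hi) F1 F2.
Proof.
move=> mF1 mF2 F10 F20 F1oo F12; set Q := obox lo hi.
have mQ : measurable Q := measurable_obox lo hi.
have mG (F : 'rV[R]_n -> \bar R) : measurable_fun setT F -> measurable_fun setT (F \_ Q).
  move=> mF; have [+ _] := @measurable_restrictT _ _ _ _ Q F mQ.
  by apply; exact: measurable_funTS.
have G0 (F : 'rV[R]_n -> \bar R) : (forall x, 0 <= F x) -> forall x, 0 <= (F \_ Q) x.
  by move=> F0 x; rewrite patchE; case: ifP.
have m12 A : measurable A ->
    density_measure mu (mG _ mF1) (G0 _ F10) A = density_measure mu (mG _ mF2) (G0 _ F20) A.
  apply: obox_measure_unique => a b; rewrite /= /density_measure.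
    rewrite -!integral_mkcondr; rewrite obox_setI; apply: F12 => j.
      by rewrite le_max lexx orbT.
    by rewrite ge_min lexx orbT.
  rewrite -integral_mkcondr; apply: le_lt_trans F1oo.
  apply: ge0_subset_integral => //; first by apply: measurableI => //; exact: measurable_obox.
  exact: measurable_funTS.
apply: integral_ae_eq => //.
- apply/integrableP; split; first exact: measurable_funTS.
  by under eq_integral do rewrite gee0_abs//.
- exact: measurable_funTS.
- move=> E EQ mE; have := m12 E mE.
  by rewrite /density_measure -!integral_mkcondr setIidl.
Qed.

Lemma tonelli_rV d2 (T2 : measurableType d2) (m2 : {sigma_finite_measure set T2 -> \bar R})
    (f : 'rV[R]_n * T2 -> \bar R) :
  measurable_fun setT f -> (forall x, 0 <= f x) ->
  \int[mu]_x \int[m2]_y f (x, y) = \int[m2]_y \int[mu]_x f (x, y).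
Proof.
exact: (@fubini_tonelli _ _ 'rV[R]_n _ R
  (@slebesgue R n : {sigma_finite_measure set 'rV[R]_n -> \bar R}) m2 f).
Qed.

Lemma measurable_int_rV d1 (T1 : measurableType d1) (f : T1 * 'rV[R]_n -> \bar R) :
  measurable_fun setT f -> (forall x, 0 <= f x) ->
  measurable_fun setT (fun x => \int[mu]_y f (x, y)).
Proof.
exact: (@measurable_fun_fubini_tonelli_F _ _ _ 'rV[R]_n R
  (@slebesgue R n : {sigma_finite_measure set 'rV[R]_n -> \bar R}) f).
Qed.

End density.

Section segment.
Context {R : realType} {n : nat} (i : 'I_n) (h : R).
Local Notation mu := (lebesgue_rV R n).
Local Notation leb := (@lebesgue_measure R).
Local Open Scope ereal_scope.
Local Notation e_ := (delta_mx ord0 i : 'rV[R]_n).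

Definition seg (s : measurableTypeR R) : R := \1_(`[0%R, h]%classic) s.

Lemma measurable_seg : measurable_fun setT seg.
Proof. by apply: measurable_indic. Qed.

Lemma seg_ge0 s : (0 <= seg s)%R.
Proof. by rewrite /seg. Qed.

Lemma integral_seg : (0 <= h)%R -> \int[leb]_s (seg s)%:E = h%:E.
Proof.
rewrite le_eqVlt => h0; transitivity (leb `[0%R, h]%classic).
  by rewrite integral_indic// setIT.
rewrite lebesgue_measure_itv/= lte_fin; case: ifPn => [_|]; first by rewrite -EFinB subr0.
by case/orP: h0 => [/eqP <-|->].
Qed.

Lemma measurable_line (c : R) :
  measurable_fun setT (fun xs : 'rV[R]_n * measurableTypeR R => xs.1 + (c * xs.2) *: e_)%R.
Proof.
apply: measurable_fun_add => //; apply: measurable_fun_scale.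
by apply: measurable_funM => //.
Qed.

Lemma measurable_line_fun (c : R) (V : 'rV[R]_n -> R) : measurable_fun setT V ->
  measurable_fun setT (fun xs : 'rV[R]_n * measurableTypeR R =>
    (V (xs.1 + (c * xs.2) *: e_)%R * seg xs.2)%:E).
Proof.
move=> mV; apply/measurable_EFinP; apply: measurable_funM.
  exact: (measurableT_comp mV (measurable_line c)).
exact: (measurableT_comp measurable_seg measurable_snd).
Qed.

(** Integration along segments is moved from V to phi: exchange the two
    integrals and translate by s e_i inside. *)
Lemma shift_tonelli (V phi : 'rV[R]_n -> R) :
  measurable_fun setT V -> measurable_fun setT phi ->
  (forall x, 0 <= V x)%R -> (forall x, 0 <= phi x)%R ->
  \int[mu]_x ((\int[leb]_s (V (x + (-1 * s) *: e_)%R * seg s)%:E) * (phi x)%:E) =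
  \int[mu]_x ((V x)%:E * \int[leb]_s (phi (x + (1 * s) *: e_)%R * seg s)%:E).
Proof.
move=> mV mphi V0 phi0.
transitivity (\int[mu]_x \int[leb]_s (V (x + (-1 * s) *: e_)%R * seg s * phi x)%:E).
  apply: eq_integral => x _; rewrite -ge0_integralZr//=.
  - exact: (measurableT_comp (measurable_line_fun (-1) mV) (measurable_pair1 x)).
  - by move=> s _; rewrite lee_fin mulr_ge0 ?seg_ge0.
  - by rewrite lee_fin.
transitivity (\int[mu]_x \int[leb]_s (V x * (phi (x + (1 * s) *: e_)%R * seg s))%:E); last first.
  apply: eq_integral => x _; rewrite -ge0_integralZl_EFin//=.
  - by move=> s _; rewrite lee_fin mulr_ge0 ?seg_ge0.
  - exact: (measurableT_comp (measurable_line_fun 1 mphi) (measurable_pair1 x)).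
rewrite (@tonelli_rV R n _ _ leb (fun xs => (V (xs.1 + (-1 * xs.2) *: e_)%R * seg xs.2 * phi xs.1)%:E))/=; last 2 first.
- have := measurable_line_fun (-1) mV; move/measurable_EFinP => m1.
  apply/measurable_EFinP; apply: measurable_funM => //.
  exact: (measurableT_comp mphi measurable_fst).
- by move=> xs; rewrite lee_fin !mulr_ge0 ?seg_ge0.
rewrite (@tonelli_rV R n _ _ leb (fun xs => (V xs.1 * (phi (xs.1 + (1 * xs.2) *: e_)%R * seg xs.2))%:E))/=; last 2 first.
- have := measurable_line_fun 1 mphi; move/measurable_EFinP => m1.
  apply/measurable_EFinP; apply: measurable_funM => //.
  exact: (measurableT_comp mV measurable_fst).
- by move=> xs; rewrite lee_fin !mulr_ge0 ?seg_ge0.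
apply: eq_integral => s _.
rewrite -(@ge0_integral_shift R n (s *: e_) (fun x => (V (x + (-1 * s) *: e_)%R * seg s * phi x)%:E)).
- apply: eq_integral => x _; congr (_%:E).
  rewrite mulN1r mul1r scaleNr addrK; ring.
- apply/measurable_EFinP; apply: measurable_funM => //.
  apply: measurable_funM => //.
  exact: (measurableT_comp mV (measurable_shift _)).
- by move=> x; rewrite lee_fin !mulr_ge0 ?seg_ge0.
Qed.

End segment.

(** * Weak partial derivatives and differences along segments *)

Section bump_segment.
Context {R : realType} (h : R) (h0 : 0 < h).
Local Notation leb := (@lebesgue_measure R).

(** The average of a bump over [t, t + h] is again smooth and compactly supported,
    and its derivative is a difference of two values of the bump.  Used as one factor
    of a test function, it turns the weak derivative into finite differences. *)
Lemma bump_segment (a b : R) k : exists bh : R -> R,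
  [/\ smooth1 bh,
      forall t : R, is_derive t 1 bh (smooth_bump a b k (1 * t + h) - smooth_bump a b k t),
      forall t, ((bh t)%:E = \int[leb]_s (smooth_bump a b k (t + s)%R * seg h s)%:E)%E &
      forall t, t \notin `[a - h, b] -> bh t = 0].
Proof.
have [F dF] := bump_primitive a b k; set f := smooth_bump a b k in dF *.
have sf : smooth1 f by exact: smooth1_bump.
have cf : continuous f := smooth1_continuous sf.
(* The factor 1 puts the shift in the form c * t + d of the affine lemmas. *)
pose bh t := F (1 * t + h) - F t.
have dbh (t : R) : is_derive t 1 bh (f (1 * t + h) - f t).
  apply: is_deriveB => //.
  rewrite -[f (1 * t + h)]mulr1.
  apply: (@is_derive1_comp _ F (fun t => 1 * t + h)).
  exact: is_derive_affine.
have intE t : ((bh t)%:E = \int[leb]_s (f (t + s)%R * seg h s)%:E)%E.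
  transitivity (\int[leb]_(s in `[0%R, h]) (f (t + s)%R)%:E)%E; last first.
    rewrite [LHS]integral_mkcond; apply: eq_integral => s _.
    by rewrite patchE /seg indicE; case: ifP; rewrite ?mulr1 ?mulr0.
  have dG s : is_derive s (1 : R) (fun s => F (t + s)) (f (t + s)).
    rewrite -[f (t + s)]mulr1.
    apply: (@is_derive1_comp _ F (fun s => t + s)).
    by apply: (is_derive_eq (is_deriveD (is_derive_cst t s 1) (is_derive_id s 1))); rewrite add0r.
  rewrite (@continuous_FTC2 _ (fun s => f (t + s)) (fun s => F (t + s)) 0 h)//.
  - by rewrite addr0 /bh mul1r EFinB.
  - apply: continuous_subspaceT => s.
    apply: (@continuous_comp _ _ _ (fun s => t + s) f); last exact: cf.
    by apply: cvgD; [exact: cvg_cst|exact: cvg_id].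
  - have cG : continuous (fun s => F (t + s)) := is_derive_continuous dG.
    split.
    + by move=> x _; have [] := dG x.
    + exact/cvg_at_right_filter/cG.
    + exact/cvg_at_left_filter/cG.
  - by move=> x _; rewrite derive1E; have [_ ->] := dG x.
exists bh; split => //.
- case=> [|m]; first exact: is_derive_continuous dbh.
  exists (fun t => f (1 * t + h) - f t); split => //.
  apply: Ck1_add; first exact/Ck1_affine/sf.
  rewrite (_ : (fun x => - f x) = (fun x => -1 * f x)); last first.
    by apply/funext => x; rewrite mulN1r.
  by apply: Ck1_mul; [exact: Ck1_cst|exact: sf].
- move=> t tab; apply: EFin_inj; rewrite intE -[RHS](integral0 leb setT).
  apply: eq_integral => s _; rewrite /seg indicE; case: (boolP (s \in _)) => sI; last by rewrite mulr0.
  rewrite /f bump_out ?mul0r//; apply: contra tab.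
  by move: sI; rewrite inE/= !in_itv/= => /andP[? ?] /andP[? ?]; apply/andP; split; lra.
Qed.

End bump_segment.

Section weak_box.
Context {R : realType} {n : nat} (i : 'I_n) (h : R) (h0 : 0 < h).
Context (O : set 'rV[R]_n) (u v : 'rV[R]_n -> R) (wp : weak_partial O i u v).
Context (lo hi : 'I_n -> R).
Let lo' j := if j == i then lo j - h else lo j.
Let K := cbox lo' hi.
Context (KO : K `<=` O).
Local Notation mu := (lebesgue_rV R n).
Local Notation leb := (@lebesgue_measure R).
Local Notation e_ := (delta_mx ord0 i : 'rV[R]_n).

Let mK : measurable K.
Proof.
by apply: (@measurable_box R n (fun i => `[lo' i, hi i]%classic)) => j; exact: measurable_itv.
Qed.

Let pos (f : 'rV[R]_n -> R) x := Num.max ((f \_ K) x) 0.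
Let neg (f : 'rV[R]_n -> R) x := Num.max (- (f \_ K) x) 0.

Let pos_neg f x : (f \_ K) x = pos f x - neg f x.
Proof.
rewrite /pos /neg /Num.max oppr_lt0; case: ltgtP => [_|_|->].
- by rewrite sub0r opprK.
- by rewrite subr0.
- by rewrite oppr0 subr0.
Qed.

Let pos_ge0 f x : 0 <= pos f x. Proof. by rewrite /pos le_max lexx orbT. Qed.
Let neg_ge0 f x : 0 <= neg f x. Proof. by rewrite /neg le_max lexx orbT. Qed.

(** u and v are only integrable on compact sets and have no sign.  They are cut
    off to K and split into positive and negative parts, so that Tonelli's theorem
    applies without integrability conditions. *)
Definition nn_integrable (U : 'rV[R]_n -> R) :=
  [/\ forall x, 0 <= U x, measurable_fun setT U & mu.-integrable setT (EFin \o U)].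

Let restrict_int f : loc_integrable O f -> mu.-integrable setT (EFin \o (f \_ K)).
Proof.
move=> [mf lf]; rewrite -restrict_EFin; apply/(integrable_mkcond _ mK).
by apply: lf => //; exact: cbox_compact.
Qed.

Let pos_good f : loc_integrable O f -> nn_integrable (pos f).
Proof.
move=> lf; have fi := restrict_int lf.
have /measurable_EFinP mfK := measurable_int _ fi.
have mp : measurable_fun setT (pos f) by exact: measurable_maxr.
split => //; apply: le_integrable fi => //; first exact/measurable_EFinP.
move=> x _ /=; rewrite lee_fin (ger0_norm (pos_ge0 f x)) /pos.
by rewrite ge_max ler_norm normr_ge0.
Qed.

Let neg_good f : loc_integrable O f -> nn_integrable (neg f).
Proof.
move=> lf; have fi := restrict_int lf.
have /measurable_EFinP mfK := measurable_int _ fi.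
have mp : measurable_fun setT (neg f).
  by apply: measurable_maxr => //; exact: measurableT_comp.
split => //; apply: le_integrable fi => //; first exact/measurable_EFinP.
move=> x _ /=; rewrite lee_fin (ger0_norm (neg_ge0 f x)) /neg.
by rewrite ge_max -[X in _ <= X]normrN ler_norm !normr_ge0.
Qed.

Lemma nn_integrableM U (phi : 'rV[R]_n -> R) c : nn_integrable U -> measurable_fun setT phi ->
  (forall x, 0 <= phi x <= c) -> nn_integrable (fun x => U x * phi x).
Proof.
move=> [U0 mU iU] mphi phi01; have m : measurable_fun setT (fun x => U x * phi x).
  exact: measurable_funM.
split => //; first by move=> x; rewrite mulr_ge0//; case/andP: (phi01 x).
have : mu.-integrable setT (fun x => (c%:E * (EFin \o U) x)%E) by exact: integrableZl.
apply: le_integrable => //; first exact/measurable_EFinP.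
move=> x _ /=; have /andP[p0 p1] := phi01 x.
have c0 : 0 <= c := le_trans p0 p1.
by rewrite lee_fin !ger0_norm ?mulr_ge0// mulrC ler_wpM2r.
Qed.

Lemma nn_integrableD U1 U2 : nn_integrable U1 -> nn_integrable U2 -> nn_integrable (fun x => U1 x + U2 x).
Proof.
move=> [U10 mU1 iU1] [U20 mU2 iU2]; split.
- by move=> x; rewrite addr_ge0.
- exact: measurable_funD.
- by have := integrableD measurableT iU1 iU2; apply: eq_integrable.
Qed.

Lemma nn_integrable_fin U : nn_integrable U -> ((\int[mu]_x U x)%R%:E = \int[mu]_x (U x)%:E)%E.
Proof. by move=> [_ _ iU]; rewrite /Rintegral fineK//; exact: integrable_fin_num. Qed.

Lemma measurable_tensor (b : 'I_n -> R -> R) : (forall j, continuous (b j)) ->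
  measurable_fun setT (tensor b).
Proof. by move=> cb; apply: continuous_rV_measurable; exact: tensor_continuous. Qed.

Definition box_bump (a b : 'I_n -> R) k : 'rV[R]_n -> R := tensor (fun j => smooth_bump (a j) (b j) k).

Lemma box_bump_measurable a b k : measurable_fun setT (box_bump a b k).
Proof.
by apply: measurable_tensor => j; exact/smooth1_continuous/smooth1_bump.
Qed.

Lemma box_bump_ge0 a b k (x : 'rV[R]_n) : 0 <= box_bump a b k x.
Proof. by apply: prodr_ge0 => j _; exact: bump_ge0. Qed.

Lemma box_bump_le1 a b k (x : 'rV[R]_n) : box_bump a b k x <= 1.
Proof. by apply: prodr_ile1 => j _; rewrite bump_ge0 bump_le1. Qed.

Lemma box_bump_out a b k (x : 'rV[R]_n) : (exists j, x ord0 j \notin `]a j, b j[) -> box_bump a b k x = 0.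
Proof.
by move=> [j xj]; rewrite /box_bump (tensorD1 _ j) bump_out// mul0r.
Qed.

Definition seg_int (f : 'rV[R]_n -> R) (c : R) x : \bar R :=
  (\int[leb]_s (f (x + (c * s) *: e_)%R * seg h s)%:E)%E.

(** The definition of the weak derivative, tested with the average over [0, h] of
    the bump along the i-th axis, with the negative terms moved to the other side. *)
Lemma weak_box_bump (a b : 'I_n -> R) k :
  (forall j, lo j <= a j) -> (forall j, b j <= hi j) ->
  (\int[mu]_x ((pos u x * box_bump a b k (x + h *: e_) + neg u x * box_bump a b k x)%:E)
   + \int[mu]_x ((pos v x)%:E * seg_int (box_bump a b k) 1 x) =
   \int[mu]_x ((neg u x * box_bump a b k (x + h *: e_) + pos u x * box_bump a b k x)%:E)
   + \int[mu]_x ((neg v x)%:E * seg_int (box_bump a b k) 1 x))%E.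
Proof.
move=> loa bhi.
have [bh [sbh dbh bhE bh0]] := bump_segment h0 (a i) (b i) k.
pose B j := if j == i then bh else smooth_bump (a j) (b j) k.
pose Phi := tensor B.
have sB j : smooth1 (B j) by rewrite /B; case: ifP => // _; exact: smooth1_bump.
have mPhi : measurable_fun setT Phi.
  by apply: measurable_tensor => j; exact: smooth1_continuous.
have PhiE x : seg_int (box_bump a b k) 1 x = (Phi x)%:E.
  rewrite /seg_int /Phi (tensorD1 _ i) /B eqxx EFinM bhE -ge0_integralZr//=; last 3 first.
  - apply/measurable_EFinP; apply: measurable_funM; last exact: measurable_seg.
    apply: (@measurableT_comp _ _ _ _ _ _ (smooth_bump (a i) (b i) k)).
      by apply: continuous_measurable_fun; exact/smooth1_continuous/smooth1_bump.
    by apply: measurable_funD => //.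
  - by move=> s _; rewrite lee_fin mulr_ge0 ?seg_ge0 ?bump_ge0.
  - by rewrite lee_fin; apply: prodr_ge0 => j /negbTE ->; exact: bump_ge0.
  apply: eq_integral => s _; rewrite -EFinM /box_bump (tensorD1 _ i); congr (_%:E).
  rewrite !mxE !eqxx mulr1 mul1r mulrAC; congr (_ * _ * _).
  apply: eq_bigr => j ji; rewrite (negbTE ji).
  by rewrite !mxE eqxx (negbTE ji) mulr0 addr0.
have segE x : box_bump a b k (x + h *: e_) = smooth_bump (a i) (b i) k (1 * x ord0 i + h) *
    \prod_(j < n | j != i) smooth_bump (a j) (b j) k (x ord0 j).
  rewrite /box_bump (tensorD1 _ i) !mxE !eqxx mulr1 mul1r; congr (_ * _).
  by apply: eq_bigr => j ji; rewrite !mxE eqxx (negbTE ji) mulr0 addr0.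
have dPhi : partial i Phi = fun x => box_bump a b k (x + h *: e_) - box_bump a b k x.
  have dB (t : R) : is_derive t 1 (B i)
      (smooth_bump (a i) (b i) k (1 * t + h) - smooth_bump (a i) (b i) k t).
    by rewrite /B eqxx; exact: dbh.
  rewrite (partial_tensor dB).
  apply/funext => x; rewrite segE /box_bump !(tensorD1 _ i) eqxx mulrBl; congr (_ * _ - _ * _);
  by apply: eq_bigr => j /negbTE ji; rewrite /B ji.
have PhiK x : ~ K x -> Phi x = 0.
  move=> /existsNP[j /negP xj]; rewrite /Phi (tensorD1 _ j) /B.
  move: xj; rewrite /lo'; case: eqP => [->|_] xj.
    rewrite bh0 ?mul0r//; apply: contra xj; rewrite !in_itv/=.
    by have := loa i; have := bhi i; lra.
  rewrite bump_out ?mul0r//; apply: contra xj; rewrite !in_itv/=.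
  by have := loa j; have := bhi j; lra.
have dPhiK x : ~ K x -> partial i Phi x = 0.
  move=> /existsNP[j /negP xj]; have := h0; have := loa j; have := bhi j => bj aj h0'.
  have bump_x (y : 'rV[R]_n) : (y ord0 j \in `]a j, b j[ -> x ord0 j \in `[lo' j, hi j]) ->
      box_bump a b k y = 0.
    by move=> xy; apply: box_bump_out; exists j; apply: contra xj; exact: xy.
  rewrite dPhi !bump_x ?subrr//; rewrite !in_itv/= /lo'.
    by case: eqP => _; lra.
  by rewrite !mxE eqxx/=; case: eqP => _; rewrite ?mulr1 ?mulr0; lra.
have [lu lv /(_ Phi)] := wp.
have tPhi : test_function O Phi.
  apply: (@test_function_tensor _ _ _ _ lo' hi) => // j t tj; rewrite /B.
  move: tj; rewrite /lo'; case: eqP => [->|_] tj.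
    rewrite bh0//; apply: contra tj; rewrite !in_itv/=.
    by have := loa i; have := bhi i; lra.
  rewrite bump_out//; apply: contra tj; rewrite !in_itv/=.
  by have := loa j; have := bhi j; lra.
move=> /(_ tPhi).
have toK (f g : 'rV[R]_n -> R) : (forall x, ~ K x -> g x = 0) ->
    (\int[mu]_(x in O) (f x * g x) = \int[mu]_x ((f \_ K) x * g x))%R.
  move=> g0; rewrite Rintegral_mkcond; apply: eq_Rintegral => x _; rewrite !patchE.
  have [xK|xK] := pselect (K x); first by rewrite !mem_set//; exact: KO.
  by rewrite g0// !mulr0; case: ifP.
rewrite (toK u (partial i Phi) dPhiK) (toK v Phi PhiK).
have phiS : measurable_fun setT (fun x : 'rV[R]_n => box_bump a b k (x + h *: e_)).
  exact: (measurableT_comp (@box_bump_measurable a b k) (measurable_shift _)).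
have phi01 x : 0 <= box_bump a b k x <= 1 by rewrite box_bump_ge0 box_bump_le1.
have Phi01 x : 0 <= Phi x <= h.
  rewrite -!lee_fin -PhiE; apply/andP; split.
    by apply: integral_ge0 => s _; rewrite lee_fin mulr_ge0 ?box_bump_ge0 ?seg_ge0.
  apply: (@le_trans _ _ (\int[leb]_s (seg h s)%:E)%E).
    apply: ge0_le_integral => //.
    - by move=> s _; rewrite lee_fin mulr_ge0 ?box_bump_ge0 ?seg_ge0.
    - exact: (measurableT_comp (measurable_line_fun i h 1 (@box_bump_measurable a b k)) (measurable_pair1 x)).
    - by apply/measurable_EFinP; exact: measurable_seg.
    - by move=> s _; rewrite lee_fin ler_piMl ?seg_ge0 ?box_bump_le1.
  by rewrite (integral_seg (ltW h0)).
have [gpu gnu gpv gnv] := And4 (pos_good lu) (neg_good lu) (pos_good lv) (neg_good lv).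
have g1 := nn_integrableD (nn_integrableM gpu phiS (fun x => phi01 _))
  (nn_integrableM gnu (@box_bump_measurable a b k) phi01).
have g2 := nn_integrableD (nn_integrableM gnu phiS (fun x => phi01 _))
  (nn_integrableM gpu (@box_bump_measurable a b k) phi01).
have g3 := nn_integrableM gpv mPhi Phi01.
have g4 := nn_integrableM gnv mPhi Phi01.
under eq_Rintegral.
  move=> x _; rewrite dPhi pos_neg (_ : _ * _ = (pos u x * box_bump a b k (x + h *: e_) + neg u x * box_bump a b k x)
   - (neg u x * box_bump a b k (x + h *: e_) + pos u x * box_bump a b k x)); last by ring.
  over.
rewrite RintegralB//; [|by case: g1|by case: g2].
under [in X in _ = X -> _]eq_Rintegral do rewrite pos_neg mulrBl.
rewrite RintegralB//; [|by case: g3|by case: g4].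
under [X in (_ + X = _)%E]eq_integral do rewrite PhiE -EFinM.
under [X in (_ = _ + X)%E]eq_integral do rewrite PhiE -EFinM.
rewrite -(nn_integrable_fin g1) -(nn_integrable_fin g2) -(nn_integrable_fin g3) -(nn_integrable_fin g4).
rewrite -!EFinD => H; congr (_%:E); lra.
Qed.

(** With U1, U2 and V the parts of u and v, the identity
    u(x) = u(x - h e_i) + int_0^h v(x - s e_i) ds is the equality of two such
    expressions.  Every term is nonnegative, so no cancellation has to be justified
    before the equality is established. *)
Definition ftc_side (U1 U2 V : 'rV[R]_n -> R) x : \bar R :=
  ((U1 (x - h *: e_)%R + U2 x)%:E + seg_int V (-1) x)%E.

Implicit Types (U V : 'rV[R]_n -> R).

Lemma seg_int_ge0 V c x : (forall x, 0 <= V x) -> (0 <= seg_int V c x)%E.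
Proof.
by move=> V0; apply: integral_ge0 => s _; rewrite lee_fin mulr_ge0 ?seg_ge0.
Qed.

Lemma measurable_seg_int V c : measurable_fun setT V -> (forall x, 0 <= V x) ->
  measurable_fun setT (seg_int V c).
Proof.
move=> mV V0.
apply: (@measurable_fun_fubini_tonelli_F _ _ 'rV[R]_n _ R leb
  (fun xs => (V (xs.1 + (c * xs.2) *: e_)%R * seg h xs.2)%:E)).
  exact: measurable_line_fun.
by move=> xs; rewrite lee_fin mulr_ge0 ?seg_ge0.
Qed.

Lemma measurable_ftc_side U1 U2 V : nn_integrable U1 -> nn_integrable U2 -> nn_integrable V ->
  measurable_fun setT (ftc_side U1 U2 V).
Proof.
move=> [U10 mU1 _] [U20 mU2 _] [V0 mV _]; apply: emeasurable_funD; last exact: measurable_seg_int.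
apply/measurable_EFinP; apply: measurable_funD => //.
exact: (measurableT_comp mU1 (measurable_shift _)).
Qed.

Lemma ftc_side_ge0 U1 U2 V x : nn_integrable U1 -> nn_integrable U2 -> nn_integrable V ->
  (0 <= ftc_side U1 U2 V x)%E.
Proof.
by move=> [U10 _ _] [U20 _ _] [V0 _ _]; rewrite adde_ge0 ?seg_int_ge0// lee_fin addr_ge0.
Qed.

(** The change of variables that moves the translations onto the test function. *)
Lemma ftc_side_mul U1 U2 V (f : 'rV[R]_n -> R) : nn_integrable U1 -> nn_integrable U2 -> nn_integrable V ->
  measurable_fun setT f -> (forall x, 0 <= f x) ->
  (\int[mu]_x (ftc_side U1 U2 V x * (f x)%:E) =
  \int[mu]_x ((U1 x * f (x + h *: e_)%R + U2 x * f x)%:E)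
   + \int[mu]_x ((V x)%:E * seg_int f 1 x))%E.
Proof.
move=> [U10 mU1 _] [U20 mU2 _] [V0 mV _] mf f0.
have mUs : measurable_fun setT (fun x : 'rV[R]_n => U1 (x - h *: e_)).
  exact: (measurableT_comp mU1 (measurable_shift _)).
have mfs : measurable_fun setT (fun x : 'rV[R]_n => f (x + h *: e_)).
  exact: (measurableT_comp mf (measurable_shift _)).
have mU1fs : measurable_fun setT (fun x => (U1 x * f (x + h *: e_)%R)%:E).
  by apply/measurable_EFinP; exact: measurable_funM.
have mU2f : measurable_fun setT (fun x => (U2 x * f x)%:E).
  by apply/measurable_EFinP; exact: measurable_funM.
rewrite -(shift_tonelli i h mV mf V0 f0).
under eq_integral.
  move=> x _; rewrite /ftc_side ge0_muleDl ?seg_int_ge0 ?lee_fin ?addr_ge0// -EFinM mulrDl EFinD.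
  over.
under [in RHS]eq_integral do rewrite EFinD.
rewrite ge0_integralD//=.
- congr (_ + _)%E; rewrite ge0_integralD//=.
  + rewrite [in RHS]ge0_integralD//=.
    * congr (_ + _)%E.
      rewrite -(@ge0_integral_shift R n (- (h *: e_)) (fun x => (U1 x * f (x + h *: e_)%R)%:E))//.
        by apply: eq_integral => x _; rewrite subrK.
      by move=> x; rewrite lee_fin mulr_ge0.
    * by move=> x _; rewrite lee_fin mulr_ge0.
    * by move=> x _; rewrite lee_fin mulr_ge0.
  + by move=> x _; rewrite lee_fin mulr_ge0.
  + by apply/measurable_EFinP; exact: measurable_funM.
  + by move=> x _; rewrite lee_fin mulr_ge0.
- by move=> x _; rewrite -EFinD lee_fin addr_ge0 ?mulr_ge0.
- apply: emeasurable_funD => //.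
  by apply/measurable_EFinP; exact: measurable_funM.
- by move=> x _; rewrite mule_ge0 ?seg_int_ge0 ?lee_fin.
- apply: emeasurable_funM; first exact: measurable_seg_int.
  exact/measurable_EFinP.
Qed.

Lemma ftc_side_integrable U1 U2 V : nn_integrable U1 -> nn_integrable U2 -> nn_integrable V ->
  mu.-integrable setT (ftc_side U1 U2 V).
Proof.
move=> gU1 gU2 gV; apply/integrableP; split; first exact: measurable_ftc_side.
under eq_integral do rewrite gee0_abs ?ftc_side_ge0// -[ftc_side _ _ _ _]mule1.
rewrite (@ftc_side_mul _ _ _ (cst 1)) //.
under eq_integral do rewrite /= !mulr1.
have gD := nn_integrableD gU1 gU2.
have segh x : seg_int (cst 1) 1 x = h%:E.
  by rewrite /seg_int; under eq_integral do rewrite /= mul1r; rewrite integral_seg// ltW.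
under [X in (_ + X)%E]eq_integral do rewrite segh -EFinM.
have gVh : nn_integrable (fun x => V x * cst h x).
  by apply: (@nn_integrableM V (cst h) h) => // x; rewrite /= lexx ltW.
by rewrite -(nn_integrable_fin gD) -(nn_integrable_fin gVh) -EFinD ltry.
Qed.

(** Dominated convergence, as the bumps tend to the indicator of the box. *)
Lemma ftc_side_box U1 U2 V (a b : 'I_n -> R) : nn_integrable U1 -> nn_integrable U2 -> nn_integrable V ->
  (\int[mu]_x (ftc_side U1 U2 V x * (box_bump a b k x)%:E) @[k --> \oo] -->
  \int[mu]_(x in obox a b) ftc_side U1 U2 V x)%E.
Proof.
move=> gU1 gU2 gV; have iF := ftc_side_integrable gU1 gU2 gV.
have mF := measurable_ftc_side gU1 gU2 gV.
have F0 x := ftc_side_ge0 x gU1 gU2 gV.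
rewrite integral_mkcond.
have cphi x : box_bump a b k x @[k --> \oo] --> (\1_(obox a b) x : R).
  have -> : (\1_(obox a b) x : R) = \prod_(j < n) (x ord0 j \in `]a j, b j[)%:R.
    rewrite indicE; have [xab|/existsNP[j /negP xj]] := pselect (obox a b x).
      by rewrite mem_set//; apply/esym/big1 => j _; rewrite xab.
    rewrite memNset; last by move=> /(_ j); rewrite (negbTE xj).
    by rewrite (bigD1 j)//= (negbTE xj) mul0r.
  rewrite /box_bump /tensor; elim: (index_enum _) => [|j s IH].
    rewrite big_nil (_ : (fun k => _) = (fun=> 1)); first exact: cvg_cst.
    by apply/funext => k; rewrite big_nil.
  rewrite big_cons (_ : (fun k => _) = (fun k => smooth_bump (a j) (b j) k (x ord0 j) *
     \prod_(j <- s) smooth_bump (a j) (b j) k (x ord0 j))); last first.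
    by apply/funext => k; rewrite big_cons.
  by apply: cvgM; [exact: bump_cvg|exact: IH].
have mR : measurable_fun setT (ftc_side U1 U2 V \_ (obox a b)).
  have [+ _] := @measurable_restrictT _ _ _ _ (obox a b) (ftc_side U1 U2 V) (measurable_obox a b).
  by apply; exact: measurable_funTS.
have mk k : measurable_fun setT (fun x => ftc_side U1 U2 V x * (box_bump a b k x)%:E)%E.
  by apply: emeasurable_funM => //; apply/measurable_EFinP; exact: box_bump_measurable.
have [] // := @dominated_convergence _ _ R mu setT measurableT
  (fun k x => ftc_side U1 U2 V x * (box_bump a b k x)%:E)%E (ftc_side U1 U2 V \_ (obox a b))
  (ftc_side U1 U2 V) mk mR _ iF _.
- have := integrable_ae measurableT iF; apply: filterS => x /(_ I) Fx _.
  have -> : (ftc_side U1 U2 V \_ (obox a b)) x = (ftc_side U1 U2 V x * (\1_(obox a b) x)%:E)%E.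
    by rewrite patchE indicE; case: ifP; rewrite ?mule1 ?mule0.
  rewrite -(fineK Fx); under eq_fun do rewrite -EFinM; rewrite -EFinM.
  by apply: cvg_EFin; [exact: nearW|apply: cvgM; [exact: cvg_cst|exact: cphi]].
- apply: aeW => x k _; rewrite gee0_abs ?mule_ge0 ?F0 ?lee_fin ?box_bump_ge0//.
  by rewrite -[leRHS]mule1 lee_pmul ?F0 ?lee_fin ?box_bump_ge0 ?box_bump_le1.
Qed.

(** By [weak_box_bump] the two sides of the fundamental theorem of calculus have
    the same integral against every bump in the box, hence over every smaller box,
    and so agree almost everywhere. *)
Lemma weak_box_ae : {ae mu, forall x, obox lo hi x ->
  (`|u (x - h *: e_) - u x|%:E <= \int[leb]_s (`|v (x + (-1 * s) *: e_)| * seg h s)%:E)%E}.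
Proof.
have [lu lv _] := wp.
have [gpu gnu gpv gnv] := And4 (pos_good lu) (neg_good lu) (pos_good lv) (neg_good lv).
have iF1 := ftc_side_integrable gpu gnu gpv.
have F10 x := ftc_side_ge0 x gpu gnu gpv.
have H : ae_eq mu (obox lo hi) (ftc_side (pos u) (neg u) (pos v)) (ftc_side (neg u) (pos u) (neg v)).
  apply: box_density_ae_eq.
  - exact: measurable_ftc_side.
  - exact: measurable_ftc_side.
  - by move=> x; exact: ftc_side_ge0.
  - by move=> x; exact: ftc_side_ge0.
  - have /integrableP[_] : mu.-integrable (obox lo hi) (ftc_side (pos u) (neg u) (pos v)).
      by apply: integrableS iF1 => //; exact: measurable_obox.
    by under eq_integral => x _ do rewrite (gee0_abs (F10 x)).
  - move=> a b loa bhi.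
    have c1 := @ftc_side_box _ _ _ a b gpu gnu gpv.
    have c2 := @ftc_side_box _ _ _ a b gnu gpu gnv.
    have E : (fun k => \int[mu]_x (ftc_side (pos u) (neg u) (pos v) x * (box_bump a b k x)%:E))%E =
             (fun k => \int[mu]_x (ftc_side (neg u) (pos u) (neg v) x * (box_bump a b k x)%:E))%E.
      apply/funext => k.
      have mp := @box_bump_measurable a b k; have p0 := @box_bump_ge0 a b k.
      by rewrite ftc_side_mul// ftc_side_mul//; exact: weak_box_bump.
    rewrite E in c1; exact: cvg_unique c1 c2.
apply: filterS H => x Hx Qx.
have KE s : 0 <= s <= h -> K (x + (-1 * s) *: e_).
  move=> /andP[s0 sh] j; have := Qx j; rewrite !mxE eqxx/= !in_itv/= /lo'.
  by case: eqP => _; rewrite ?mulr1 ?mulr0; lra.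
have uE s : 0 <= s <= h -> u (x + (-1 * s) *: e_) = pos u (x + (-1 * s) *: e_) - neg u (x + (-1 * s) *: e_).
  by move=> sh; rewrite -pos_neg patchE mem_set//; exact: KE.
have vE s : 0 <= s <= h -> v (x + (-1 * s) *: e_) = pos v (x + (-1 * s) *: e_) - neg v (x + (-1 * s) *: e_).
  by move=> sh; rewrite -pos_neg patchE mem_set//; exact: KE.
have xh : x - h *: e_ = x + (-1 * h) *: e_ by rewrite mulN1r scaleNr.
have x00 : x = x + (-1 * 0) *: e_ by rewrite mulr0 scale0r addr0.
have h1 := ltW h0.
have uh : u (x - h *: e_) = pos u (x - h *: e_) - neg u (x - h *: e_).
  by rewrite xh uE// h1 lexx.
have ux : u x = pos u x - neg u x by rewrite x00 uE// h1 lexx.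
have segE : (\int[leb]_s (`|v (x + (-1 * s) *: e_)| * seg h s)%:E =
   seg_int (pos v) (-1) x + seg_int (neg v) (-1) x)%E.
  have mseg V : nn_integrable V -> measurable_fun setT (fun s : measurableTypeR R => (V (x + (-1 * s) *: e_)%R * seg h s)%:E).
    move=> [V0 mV _].
    exact: (measurableT_comp (measurable_line_fun i h (-1) mV) (measurable_pair1 x)).
  rewrite /seg_int -ge0_integralD//=.
  - apply: eq_integral => s _; rewrite -EFinD -mulrDl /seg indicE; case: (boolP (s \in _)) => sI; last by rewrite !mulr0.
    rewrite !mulr1; congr (_%:E); rewrite vE ?/pos ?/neg; last by move: sI; rewrite inE/= in_itv.
    rewrite /Num.max oppr_lt0; case: ltgtP => [f0|f0|f0].
    + by rewrite sub0r opprK add0r ltr0_norm.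
    + by rewrite subr0 addr0 gtr0_norm.
    + by rewrite f0 oppr0 subr0 addr0 normr0.
  - by move=> s _; rewrite lee_fin mulr_ge0 ?seg_ge0.
  - exact: mseg.
  - by move=> s _; rewrite lee_fin mulr_ge0 ?seg_ge0.
  - exact: mseg.
rewrite segE.
have : (0 <= seg_int (pos v) (-1) x)%E by apply: seg_int_ge0.
have : (0 <= seg_int (neg v) (-1) x)%E by apply: seg_int_ge0.
have := Hx Qx; rewrite /ftc_side.
case: (seg_int (pos v) (-1) x) => [r1| |]; case: (seg_int (neg v) (-1) x) => [r2| |]//=;
  rewrite ?leey//.
rewrite -!EFinD => -[] E; rewrite !lee_fin => r20 r10.
rewrite uh ux ler_norml; apply/andP; split; lra.
Qed.

End weak_box.

Section powR_mean.
Context d (T : measurableType d) (R : realType) (m : {measure set T -> \bar R}).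
Variables (p : R) (p1 : 1 <= p).
Local Open Scope ereal_scope.

(** If a > A then a = a^p a^(1-p) <= a^p A^(1-p), as 1 - p <= 0. *)
Lemma le_add_powR (a A : R) : (0 <= a)%R -> (0 < A)%R ->
  (a <= A + a `^ p * A `^ (1 - p))%R.
Proof.
move=> a0 A0; have [aA|Aa] := leP a A.
  by rewrite (le_trans aA)// lerDl mulr_ge0 ?powR_ge0.
have p0 : (0 < p)%R by apply: lt_le_trans p1.
rewrite -(mulr_powRB1 a0 p0) -[(1 - p)%R]opprB powRN -mulrA.
apply: (@le_trans _ _ (a * (a `^ (p - 1) / A `^ (p - 1)))%R); last by rewrite lerDr ltW.
rewrite ler_peMr// ler_pdivlMr ?powR_gt0// mul1r.
by apply: ge0_ler_powR; rewrite ?subr_ge0 ?nnegrE//; exact: ltW.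
Qed.

(** Hoelder's inequality for finite measures, for all p >= 1 at once: integrate a <= A + a^p A^(1-p) and choose A with A^p equal to the
    integral of f^p w.  The constant (W + 1)^p is not sharp. *)
Lemma powR_mean (f w : T -> R) (W r : R) :
  measurable_fun setT f -> measurable_fun setT w ->
  (forall x, 0 <= f x)%R -> (forall x, 0 <= w x)%R ->
  \int[m]_x (w x)%:E = W%:E -> (0 <= r)%R ->
  r%:E <= \int[m]_x (f x * w x)%:E ->
  (r `^ p)%:E <= ((W + 1) `^ p)%:E * \int[m]_x (f x `^ p * w x)%:E.
Proof.
move=> mf mw f0 w0 wW r0 rf.
have W0 : (0 <= W)%R.
  by rewrite -lee_fin -wW; apply: integral_ge0 => x _; rewrite lee_fin.
have W1 : (0 < W + 1)%R by rewrite ltr_wpDl.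
have p0 : (0 < p)%R by apply: lt_le_trans p1.
have mfp : measurable_fun setT (fun x => (f x `^ p * w x)%R).
  by apply: measurable_funM => //; exact: (measurableT_comp (measurable_powR p) mf).
have : 0 <= \int[m]_x (f x `^ p * w x)%:E.
  by apply: integral_ge0 => x _; rewrite lee_fin mulr_ge0 ?powR_ge0.
case E : (\int[m]_x (f x `^ p * w x)%:E) => [a| |]// a0; last first.
  by rewrite gt0_muley ?leey// lte_fin powR_gt0.
rewrite lee_fin in a0.
have key (A : R) : (0 < A -> a <= A `^ p -> r <= A * (W + 1))%R.
  move=> A0 aA; rewrite -lee_fin (le_trans rf)//.
  apply: (@le_trans _ _ (\int[m]_x ((A * w x)%:E + (A `^ (1 - p) * (f x `^ p * w x))%:E))).
    apply: ge0_le_integral => //.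
    - by move=> x _; rewrite lee_fin mulr_ge0.
    - by apply/measurable_EFinP; exact: measurable_funM.
    - apply: emeasurable_funD; apply/measurable_EFinP; exact: measurable_funM.
    - move=> x _; rewrite -EFinD lee_fin mulrA -mulrDl ler_wpM2r//.
      by rewrite [X in (_ + X)%R]mulrC le_add_powR.
  rewrite ge0_integralD//=; last 4 first.
  - by move=> x _; rewrite lee_fin mulr_ge0// ltW.
  - by apply/measurable_EFinP; exact: measurable_funM.
  - by move=> x _; rewrite lee_fin !mulr_ge0 ?powR_ge0.
  - by apply/measurable_EFinP; exact: measurable_funM.
  under eq_integral do rewrite EFinM.
  rewrite ge0_integralZl_EFin//=; last 3 first.
  - by move=> x _; rewrite lee_fin.
  - exact/measurable_EFinP.
  - exact: ltW.
  under [X in _ + X]eq_integral do rewrite EFinM.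
  rewrite ge0_integralZl_EFin//=; last 3 first.
  - by move=> x _; rewrite lee_fin mulr_ge0 ?powR_ge0.
  - exact/measurable_EFinP.
  - exact: powR_ge0.
  rewrite wW E -!EFinM -EFinD lee_fin mulrDr lerD2l mulr1.
  rewrite (le_trans (ler_wpM2l (powR_ge0 _ _) aA))//.
  rewrite -powRD; last by rewrite (gt_eqF A0) implybT.
  by rewrite subrK powRr1// ltW.
rewrite -EFinM lee_fin.
move: a0; rewrite le_eqVlt => /predU1P[a0|a0].
  suff -> : r = 0%R by rewrite powR0 ?gt_eqF// mulr_ge0 ?powR_ge0// -a0.
  apply/eqP; rewrite eq_le r0 andbT leNgt; apply/negP => r1.
  (* If the integral of f^p w is 0, any A is allowed, and this one is too small
     for the bound on r. *)
  have A0 : (0 < r / (W + 1) / 2)%R by rewrite !divr_gt0.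
  have := key _ A0; rewrite -a0 powR_ge0 => /(_ isT).
  rewrite mulrAC mulfVK ?gt_eqF//; lra.
have A0 : (0 < a `^ p^-1)%R by rewrite powR_gt0.
have pow_inv : ((a `^ p^-1) `^ p = a)%R.
  by rewrite -powRrM mulVf ?gt_eqF// powRr1// ltW.
have := key _ A0; rewrite pow_inv lexx => /(_ isT) H.
apply: (@le_trans _ _ ((a `^ p^-1 * (W + 1)) `^ p)%R).
  by apply: ge0_ler_powR; rewrite ?nnegrE ?mulr_ge0//; exact: ltW.
by rewrite powRM ?(ltW A0) ?(ltW W1)// pow_inv mulrC.
Qed.

(** |a + b| is at most twice the larger of the two terms. *)
Lemma powR_addr_le (a b : R) : (`|a + b| `^ p <= 2 `^ p * (`|a| `^ p + `|b| `^ p))%R.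
Proof.
have p0 : (0 <= p)%R by apply: le_trans p1.
wlog ab : a b / (`|a| <= `|b|)%R.
  by move=> H; case: (leP `|a| `|b|)%R => [/H//|/ltW /H]; rewrite addrC [X in (_ * X)%R]addrC.
apply: (@le_trans _ _ ((2 * `|b|) `^ p)%R).
  apply: ge0_ler_powR; rewrite ?nnegrE ?mulr_ge0//.
  rewrite (le_trans (ler_normD _ _))//.
  by rewrite mulr_natl mulr2n lerD2r.
by rewrite powRM// ler_wpM2l ?powR_ge0// lerDr powR_ge0.
Qed.

End powR_mean.

Lemma unsweep (R : realType) (lo hi h z : R) : lo <= hi -> 0 < h -> lo - h <= z <= hi ->
  exists s, 0 <= s <= h /\ lo <= z + s <= hi.
Proof.
move=> lohi h0 /andP[z1 z2]; have [zlo|zlo] := leP lo z.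
  by exists 0; split; lra.
by exists (lo - z); split; lra.
Qed.

Section weak_segment.
Context {R : realType} {n : nat} (i : 'I_n) (O : set 'rV[R]_n) (oO : open O).
Context (u v : 'rV[R]_n -> R) (wp : weak_partial O i u v).
Local Notation mu := (lebesgue_rV R n).
Local Notation leb := (@lebesgue_measure R).
Local Notation e_ := (delta_mx ord0 i : 'rV[R]_n).

(** A segment is compact, so a neighbourhood of it lies in O (tube lemma). *)
Lemma open_segment_nbhs (h : R) x : (forall s, 0 <= s <= h -> O (x + (-1 * s) *: e_)) ->
  nbhs x [set y | forall s, 0 <= s <= h -> O (y + (-1 * s) *: e_)].
Proof.
move=> xO.
have := (@compact_near_coveringP _ `[0, h]%classic).1 (@segment_compact R 0 h)
  _ (nbhs x) (fun y s => O (y + (-1 * s) *: e_)) _.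
move=> /(_ _) H; have {}H := H _.
have : \forall y \near x, `[0, h]%classic `<=` (fun s => O (y + (-1 * s) *: e_)).
  apply: H => s /=; rewrite in_itv/= => sh.
  have c : (fun sy : R * 'rV[R]_n => sy.2 + (-1 * sy.1) *: e_) @ (s, x) --> x + (-1 * s) *: e_.
    apply: cvgD; first exact: cvg_snd.
    apply: cvgZr_tmp; apply: cvgM; [exact: cvg_cst|exact: cvg_fst].
  have := c _ (open_nbhs_nbhs (conj oO (xO s sh))).
  by [].
apply: filterS => y yO s sh; apply: yO; by rewrite /= in_itv.
Qed.

(** Around each such x there is a rational cube whose sweep by the segment lies in
    O.  There are countably many of these cubes, and [weak_box_ae] applies to each. *)
Lemma weak_segment_ae (h : R) : 0 < h ->
  {ae mu, forall x, (forall s, 0 <= s <= h -> O (x + (-1 * s) *: e_)) ->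
  (`|u (x - h *: e_) - u x|%:E <= \int[leb]_s (`|v (x + (-1 * s) *: e_)| * seg h s)%:E)%E}.
Proof.
move=> h0.
pose good (ck : 'rV[rat]_n * nat) := forall x, rcube_closed ck.1 ck.2 x ->
  forall s, 0 <= s <= h -> O (x + (-1 * s) *: e_).
pose P (m : nat) x := forall ck, choice.unpickle m = Some ck -> good ck -> rcube ck.1 ck.2 x ->
  (`|u (x - h *: e_) - u x|%:E <= \int[leb]_s (`|v (x + (-1 * s) *: e_)| * seg h s)%:E)%E.
have : {ae mu, forall x, forall m, P m x}.
  apply: ae_foralln => m; rewrite /P.
  case: (choice.unpickle m) => [ck|]; last by apply: aeW.
  have [gck|ngck] := pselect (good ck); last by apply: aeW => x ck' [<-].
  have sub : cbox (fun j => if j == i then ratr (ck.1 ord0 j) - ck.2.+1%:R^-1 - h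
       else ratr (ck.1 ord0 j) - ck.2.+1%:R^-1)
      (fun j => ratr (ck.1 ord0 j) + ck.2.+1%:R^-1) `<=` O.
    move=> z zK.
    have r0 : 0 < ck.2.+1%:R^-1 :> R by rewrite invr_gt0.
    have [] := @unsweep R (ratr (ck.1 ord0 i) - ck.2.+1%:R^-1) (ratr (ck.1 ord0 i) + ck.2.+1%:R^-1) h (z ord0 i) _ h0.
    - by rewrite lerD2l (le_trans _ (ltW r0))// oppr_le0 ltW.
    - by have := zK i; rewrite eqxx in_itv.
    move=> s [sh zs].
    rewrite (_ : z = (z + s *: e_) + (-1 * s) *: e_); last first.
      by rewrite mulN1r scaleNr addrK.
    apply: gck => // j; rewrite !mxE eqxx/= in_itv/=.
    have := zK j; rewrite in_itv/=; case: eqP => [->|_]; last by rewrite mulr0 addr0.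
    by rewrite mulr1.
  have := weak_box_ae h0 wp sub; apply: filterS => x H ck' [<-] _; exact: H.
apply: filterS => x H xO.
have [c [k [cx cO]]] := rcube_in_nbhs (open_segment_nbhs xO).
by apply: (H (choice.pickle (c, k)) (c, k)) => //; rewrite choice.pickleK.
Qed.

End weak_segment.

(** * Differences bounded by the energy *)

Lemma eq_lee (R : realType) (x y : \bar R) : x = y -> (x <= y)%E.
Proof. by move=> ->. Qed.

Section difference_bound.
Context {R : realType} {n : nat} (i : 'I_n) (O : set 'rV[R]_n) (oO : open O).
Context (u v : 'rV[R]_n -> R) (wp : weak_partial O i u v) (p : R) (p1 : 1 <= p).
Local Notation mu := (lebesgue_rV R n).
Local Notation leb := (@lebesgue_measure R).
Local Notation e_ := (delta_mx ord0 i : 'rV[R]_n).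
Local Open Scope ereal_scope.
Implicit Types (A : set 'rV[R]_n) (W : 'rV[R]_n -> R).

Lemma measurable_restrict_fun O' (f : 'rV[R]_n -> R) : measurable O' ->
  measurable_fun O' f -> measurable_fun setT (f \_ O').
Proof.
by move=> mO; have [+ _] := @measurable_restrictT _ _ _ _ O' (f : 'rV[R]_n -> measurableTypeR R) mO.
Qed.

(** Hoelder on each segment, then Tonelli and translation invariance; the
    hypothesis on the weights serves to move W1 from the end point into the
    integral along the segment, as W2. *)
Lemma backward_bound (h K : R) A W1 W2 : (0 < h)%R -> (0 <= K)%R -> measurable A ->
  measurable_fun setT W1 -> measurable_fun setT W2 ->
  (forall x, 0 <= W1 x)%R -> (forall x, 0 <= W2 x)%R ->
  (forall x s, A x -> 0 <= s <= h ->
     O (x + (-1 * s) *: e_) /\ W1 x <= K * W2 (x + (-1 * s) *: e_))%R ->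
  \int[mu]_(x in A) (`|u (x - h *: e_) - u x| `^ p * W1 x)%:E <=
  ((h + 1) `^ p * K * h)%:E * \int[mu]_(x in O) (`|v x| `^ p * W2 x)%:E.
Proof.
move=> h0 K0 mA mW1 mW2 W10 W20 AO.
have [[mu_ _] [mv_ _] _] := wp.
have mO : measurable O := open_rV_measurable oO.
pose uO := u \_ O; pose vO := v \_ O.
have muO : measurable_fun setT uO by exact: measurable_restrict_fun.
have mvO : measurable_fun setT vO by exact: measurable_restrict_fun.
pose V x := (`|vO x| `^ p * W2 x)%R.
have p0 : (0 < p)%R by exact: lt_le_trans p1.
have mpow (f : 'rV[R]_n -> R) : measurable_fun setT f -> measurable_fun setT (fun x => `|f x| `^ p)%R.
  move=> mf; apply: (measurableT_comp (measurable_powR p)).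
  exact: measurableT_comp.
have mV : measurable_fun setT V by apply: measurable_funM => //; exact: mpow.
have V0 x : (0 <= V x)%R by rewrite mulr_ge0 ?powR_ge0.
have h1 := ltW h0.
have uOE x : A x -> (u (x - h *: e_) - u x = uO (x - h *: e_) - uO x)%R.
  move=> Ax; rewrite /uO !patchE !mem_set//.
    by have [] := AO x 0%R Ax; rewrite ?lexx ?h1// mulr0 scale0r addr0.
  by have [] := AO x h Ax; rewrite ?lexx ?h1// mulN1r scaleNr.
rewrite (eq_integral (fun x : 'rV[R]_n => (`|uO (x - h *: e_) - uO x| `^ p * W1 x)%:E)); last first.
  by move=> x; rewrite inE => Ax; rewrite uOE.
apply: (@le_trans _ _ (\int[mu]_(x in A)
    (((h + 1) `^ p * K)%:E * \int[leb]_s (V (x + (-1 * s) *: e_)%R * seg h s)%:E))).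
  have mI : measurable_fun setT (fun x : 'rV[R]_n => \int[leb]_s (V (x + (-1 * s) *: e_)%R * seg h s)%:E).
    exact: (@measurable_seg_int _ _ i h V (-1)%R).
  apply: ae_ge0_le_integral => //.
  - by move=> x _; rewrite lee_fin mulr_ge0 ?powR_ge0.
  - apply: measurable_funTS; apply/measurable_EFinP; apply: measurable_funM => //.
    apply: mpow; apply: measurable_funB => //.
    exact: (measurableT_comp muO (measurable_shift _)).
  - move=> x _; rewrite mule_ge0 ?lee_fin ?mulr_ge0 ?powR_ge0//.
    by apply: integral_ge0 => s _; rewrite lee_fin mulr_ge0 ?seg_ge0.
  - by apply: measurable_funTS; exact: measurable_funeM.
  have := weak_segment_ae oO wp h0; apply: filterS => x /= H Ax.
  have {}H := H (fun s sh => (AO x s Ax sh).1).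
  rewrite uOE// in H.
  have mline (f : 'rV[R]_n -> R) : measurable_fun setT f ->
      measurable_fun setT (fun s : measurableTypeR R => f (x + (-1 * s) *: e_))%R.
    move=> mf.
    exact: (measurableT_comp mf (measurableT_comp (measurable_line i (-1)) (measurable_pair1 x))).
  have {}H : (`|uO (x - h *: e_) - uO x|%:E <=
      \int[leb]_s (`|vO (x + (-1 * s) *: e_)| * seg h s)%:E)%E.
    apply: le_trans H _; apply/eq_lee/eq_integral => s _.
    rewrite /seg indicE; case: (boolP (s \in _)) => sI; last by rewrite !mulr0.
    rewrite /vO patchE mem_set//; apply: (AO x s Ax _).1.
    by move: sI; rewrite inE/= in_itv.
  have {}H := @powR_mean _ _ R leb p p1 (fun s => `|vO (x + (-1 * s) *: e_)|)%R (seg h) h _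
    (measurableT_comp (@normr_measurable _ _) (mline _ mvO)) (measurable_seg h) (fun=> normr_ge0 _)
    (seg_ge0 h) (integral_seg h1) (normr_ge0 _) H.
  rewrite EFinM EFinM -muleA.
  apply: (@le_trans _ _ (((h + 1) `^ p)%:E * \int[leb]_s ((`|vO (x + (-1 * s) *: e_)| `^ p * seg h s)%:E) * (W1 x)%:E)).
    by rewrite lee_wpmul2r// lee_fin.
  rewrite -muleA lee_wpmul2l ?lee_fin ?powR_ge0//.
  rewrite -ge0_integralZr//=; last 3 first.
  - apply/measurable_EFinP; apply: measurable_funM; last exact: measurable_seg.
    exact: (mline _ (mpow _ mvO)).
  - by move=> s _; rewrite lee_fin mulr_ge0 ?powR_ge0 ?seg_ge0.
  - by rewrite lee_fin.
  rewrite -ge0_integralZl_EFin//=; last 2 first.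
  - by move=> s _; rewrite lee_fin mulr_ge0 ?seg_ge0.
  - apply/measurable_EFinP; apply: measurable_funM; last exact: measurable_seg.
    exact: (mline _ mV).
  apply: ge0_le_integral => //.
  - by move=> s _; rewrite lee_fin !mulr_ge0 ?powR_ge0 ?seg_ge0.
  - apply/measurable_EFinP; apply: measurable_funM => //; apply: measurable_funM; last exact: measurable_seg.
    exact: (mline _ (mpow _ mvO)).
  - apply/measurable_EFinP; apply: measurable_funM => //; apply: measurable_funM; last exact: measurable_seg.
    exact: (mline _ mV).
  move=> s _; rewrite -EFinM lee_fin /seg indicE; case: (boolP (s \in _)) => sI; last by rewrite !(mulr0,mul0r).
  rewrite !mulr1 /V mulrCA ler_wpM2l ?powR_ge0//; apply: (AO x s Ax _).2.
  by move: sI; rewrite inE/= in_itv.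
apply: (@le_trans _ _ (\int[mu]_x
    (((h + 1) `^ p * K)%:E * \int[leb]_s (V (x + (-1 * s) *: e_)%R * seg h s)%:E))).
  apply: ge0_subset_integral => //.
  - apply: measurable_funeM.
    exact: (@measurable_seg_int _ _ i h V (-1)%R).
  - move=> x _; rewrite mule_ge0 ?lee_fin ?mulr_ge0 ?powR_ge0//.
    by apply: integral_ge0 => s _; rewrite lee_fin mulr_ge0 ?seg_ge0.
rewrite ge0_integralZl_EFin//; last 3 first.
- by move=> x _; apply: integral_ge0 => s _; rewrite lee_fin mulr_ge0 ?seg_ge0.
- exact: (@measurable_seg_int _ _ i h V (-1)%R).
- by rewrite mulr_ge0 ?powR_ge0.
rewrite [X in _ <= X * _]EFinM -muleA lee_wpmul2l ?lee_fin ?mulr_ge0 ?powR_ge0//.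
have -> : \int[mu]_x \int[leb]_s (V (x + (-1 * s) *: e_)%R * seg h s)%:E =
    \int[mu]_x ((V x)%:E * \int[leb]_s (cst 1%R (x + (1 * s) *: e_)%R * seg h s)%:E).
  rewrite -(@shift_tonelli R n i h V (cst 1%R) mV (@measurable_cst _ _ _ _ _ _) V0 (fun=> ler01)).
  by apply: eq_integral => x _; rewrite /= mule1.
under eq_integral.
  move=> x _; rewrite (_ : integral _ _ _ = h%:E); last first.
    by under eq_integral do rewrite /= mul1r; rewrite integral_seg.
  rewrite muleC; over.
rewrite ge0_integralZl_EFin//; last 2 first.
- by move=> x _; rewrite lee_fin.
- exact/measurable_EFinP.
rewrite lee_wpmul2l ?lee_fin// [leRHS]integral_mkcond.
apply: ge0_le_integral => //.
- by move=> x _; rewrite lee_fin.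
- exact/measurable_EFinP.
- have [+ _] := @measurable_restrictT _ _ _ _ O (fun x => (`|v x| `^ p * W2 x)%:E) mO; apply.
  apply/measurable_EFinP; apply: measurable_funM; last exact: measurable_funTS.
  apply: (measurableT_comp (measurable_powR p)).
  exact: measurableT_comp.
- move=> x _; rewrite /V /vO !patchE; case: ifP => // _.
  by rewrite normr0 powR0 ?mul0r// gt_eqF.
Qed.

(** For t > 0 the end points are translated back, so that in both cases the
    segments run in the direction of - e_i. *)
Lemma coord_difference_bound (t K : R) A W1 W2 : (0 <= K)%R -> measurable A ->
  measurable_fun setT W1 -> measurable_fun setT W2 ->
  (forall x, 0 <= W1 x)%R -> (forall x, 0 <= W2 x)%R ->
  (forall x s, A x -> 0 <= s <= 1 ->
     O (x + (s * t) *: e_) /\ W1 x <= K * W2 (x + (s * t) *: e_))%R ->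
  \int[mu]_(x in A) (`|u (x + t *: e_) - u x| `^ p * W1 x)%:E <=
  ((`|t| + 1) `^ p * K * `|t|)%:E * \int[mu]_(x in O) (`|v x| `^ p * W2 x)%:E.
Proof.
move=> K0 mA mW1 mW2 W10 W20 AO.
have p0 : (0 < p)%R by exact: lt_le_trans p1.
have int0 : 0 <= \int[mu]_(x in O) (`|v x| `^ p * W2 x)%:E.
  by apply: integral_ge0 => x _; rewrite lee_fin mulr_ge0 ?powR_ge0.
have [t0|t0|->] := ltgtP t 0%R; last first.
- under eq_integral do rewrite scale0r addr0 subrr normr0 powR0 ?gt_eqF// mul0r.
  by rewrite integral0 mule_ge0// lee_fin !mulr_ge0 ?powR_ge0.
- pose A' := (fun x => x - t *: e_)%R @^-1` A.
  have mA' : measurable A'.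
    by rewrite -[A']setTI; exact: (measurable_shift (- (t *: e_))).
  have mW' : measurable_fun setT (fun x : 'rV[R]_n => W1 (x - t *: e_))%R.
    exact: (measurableT_comp mW1 (measurable_shift _)).
  have := @backward_bound t K A' (fun x => W1 (x - t *: e_))%R W2 t0 K0 mA' mW' mW2 _ W20.
  rewrite gtr0_norm// => H; apply: le_trans (H _ _) => //.
  - have [[mu_ _] _ _] := wp.
    have mO : measurable O := open_rV_measurable oO.
    have muO : measurable_fun setT (u \_ O) by exact: measurable_restrict_fun.
    pose f x := (`|(u \_ O) x - (u \_ O) (x - t *: e_)| `^ p * W1 (x - t *: e_))%R.
    have mf : measurable_fun setT f.
      apply: measurable_funM => //; apply: (measurableT_comp (measurable_powR p)).
      apply: measurableT_comp => //; apply: measurable_funB => //.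
      exact: (measurableT_comp muO (measurable_shift _)).
    apply/eq_lee; transitivity (\int[mu]_(x in A') (f x)%:E); last first.
      apply: eq_integral => x; rewrite inE => A'x; rewrite /f distrC !patchE !mem_set//.
        by have [] := AO _ 1%R A'x; rewrite ?lexx ?ler01// mul1r subrK.
      by have [] := AO _ 0%R A'x; rewrite ?lexx ?ler01// mul0r scale0r addr0.
    transitivity (\int[mu]_(x in A) (f (x + t *: e_)%R)%:E).
      apply: eq_integral => x; rewrite inE => Ax; rewrite /f addrK !patchE !mem_set//.
        by have [] := AO _ 0%R Ax; rewrite ?lexx ?ler01// mul0r scale0r addr0.
      by have [] := AO _ 1%R Ax; rewrite ?lexx ?ler01// mul1r.
    rewrite [LHS]integral_mkcond [RHS]integral_mkcond.
    rewrite -(@ge0_integral_shift R n (t *: e_) ((EFin \o f) \_ A')).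
    + apply: eq_integral => x _; rewrite !patchE /A' /=; congr (if _ then _ else _).
      by apply/idP/idP; rewrite !inE /= addrK.
    + have [+ _] := @measurable_restrictT _ _ _ _ A' (EFin \o f) mA'; apply.
      by apply: measurable_funTS; exact/measurable_EFinP.
    + by move=> x; rewrite patchE; case: ifP => // _; rewrite lee_fin mulr_ge0 ?powR_ge0.
  - move=> x s A'x /andP[s0 st].
    have := AO _ (1 - s / t)%R A'x.
    rewrite mulrBl mul1r divfK ?gt_eqF// scalerBl addrA subrK mulN1r scaleNr; apply.
    by rewrite subr_ge0 ler_pdivrMr// mul1r st gerBl divr_ge0// ltW.
- have := @backward_bound (- t) K A W1 W2 _ K0 mA mW1 mW2 W10 W20.
  rewrite oppr_gt0 => /(_ t0); rewrite ltr0_norm//.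
  under eq_integral do rewrite scaleNr opprK.
  apply => x s Ax /andP[s0 st].
  have := AO x (s / - t)%R Ax.
  have tn : t != 0%R by rewrite lt_eqF.
  rewrite (_ : (s / - t * t = -1 * s)%R); last by field.
  apply.
  apply/andP; split; last by rewrite ler_pdivrMr ?oppr_gt0// mul1r.
  by rewrite divr_ge0// oppr_ge0 ltW.
Qed.

End difference_bound.

(** * Control of the deviation by the energy *)

Section enorm.
Context {R : realType} {n : nat}.
Implicit Types x y : 'rV[R]_n.

Lemma coord_le_enorm x i : `|x ord0 i| <= enorm x.
Proof.
rewrite -sqrtr_sqr ler_wsqrtr// (bigD1 i)//= lerDl.
by apply: sumr_ge0 => j _; exact: sqr_ge0.
Qed.

Lemma enorm_ge0 x : 0 <= enorm x. Proof. exact: sqrtr_ge0. Qed.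

End enorm.

Section control.
Context {R : realType} {n : nat} (p : R) (p1 : 1 <= p).
Local Notation mu := (lebesgue_rV R n).
Local Open Scope ereal_scope.

(** A weighted Sobolev function together with its weak gradient and the constant
    it is compared with.  Uniformity in all of these is then a statement about a set
    of such data. *)
Record sobolev_datum := SobolevDatum {
  dom : set 'rV[R]_n ;
  wt : 'rV[R]_n -> R ;
  fn : 'rV[R]_n -> R ;
  gr : 'rV[R]_n -> 'rV[R]_n ;
  level : R }.

Definition energy (P : sobolev_datum) : \bar R :=
  \int[mu]_(x in dom P) (enorm (gr P x) `^ p * wt P x)%:E.

Definition admissible (P : sobolev_datum) :=
  [/\ open (dom P), measurable_fun setT (wt P), (forall x, 0 <= wt P x)%R &
    wW1p p (dom P) (wt P) (fn P) (gr P)].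

Definition deviation (P : sobolev_datum) (A : set 'rV[R]_n) : \bar R :=
  \int[mu]_(x in A `&` dom P) (`|fn P x - level P| `^ p * wt P x)%:E.

Let p0 : (0 < p)%R. Proof. exact: lt_le_trans p1. Qed.

Lemma energy_ge0 P : admissible P -> 0 <= energy P.
Proof.
by move=> [_ _ w0 _]; apply: integral_ge0 => x _; rewrite lee_fin mulr_ge0 ?powR_ge0.
Qed.

Lemma measurable_fn P : admissible P -> measurable_fun (dom P) (fn P).
Proof. by move=> [_ _ _ [[]]]. Qed.

Lemma measurable_dom P : admissible P -> measurable (dom P).
Proof. by move=> [oO _ _ _]; exact: open_rV_measurable. Qed.

Lemma measurable_powabs d (T : measurableType d) (D : set T) (f : T -> R) : measurable D -> measurable_fun D f ->
  measurable_fun D (fun x => `|f x| `^ p)%R.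
Proof.
move=> mD mf; apply: (measurableT_comp (measurable_powR p)).
exact: measurableT_comp.
Qed.

Lemma measurable_dev P : admissible P ->
  measurable_fun (dom P) (fun x => (`|fn P x - level P| `^ p * wt P x)%:E).
Proof.
move=> adm; have mO := measurable_dom adm; have mf := measurable_fn adm.
have [_ mw _ _] := adm.
apply/measurable_EFinP; apply: measurable_funM; last exact: measurable_funTS.
by apply: measurable_powabs => //; exact: measurable_funB.
Qed.

Lemma dev_ge0 P x : admissible P -> 0 <= (`|fn P x - level P| `^ p * wt P x)%:E.
Proof. by move=> [_ _ w0 _]; rewrite lee_fin mulr_ge0 ?powR_ge0. Qed.

Lemma coord_energy P i : admissible P ->
  \int[mu]_(x in dom P) (`|gr P x ord0 i| `^ p * wt P x)%:E <= energy P.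
Proof.
move=> adm; have mO := measurable_dom adm; have [_ mw w0 [_ wp]] := adm.
have mg j : measurable_fun (dom P) (fun x => gr P x ord0 j) by have [_ []] := wp j.
apply: ge0_le_integral => //.
- by move=> x _; rewrite lee_fin mulr_ge0 ?powR_ge0.
- apply/measurable_EFinP; apply: measurable_funM; last exact: measurable_funTS.
  exact: measurable_powabs.
- apply/measurable_EFinP; apply: measurable_funM; last exact: measurable_funTS.
  apply: (measurableT_comp (measurable_powR p)).
  apply: (measurableT_comp (continuous_measurable_fun (@sqrt_continuous R))).
  apply: measurable_sum => j.
  by apply: measurable_funX; exact: mg.
- move=> x _; rewrite lee_fin ler_wpM2r//.
  apply: ge0_ler_powR; rewrite ?nnegrE ?enorm_ge0 ?normr_ge0//; first exact: ltW.
  exact: coord_le_enorm.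
Qed.

Definition controlled (F : set sobolev_datum) (A : set 'rV[R]_n) :=
  measurable A /\ exists2 K : R, (0 <= K)%R &
    forall P, F P -> deviation P A <= K%:E * energy P.

Context (F : set sobolev_datum) (admF : forall P, F P -> admissible P).

Lemma controlled_sub (A B : set 'rV[R]_n) : measurable A -> A `<=` B ->
  controlled F B -> controlled F A.
Proof.
move=> mA AB [mB [K K0 HK]]; split=> //; exists K => // P FP.
have adm := admF FP; have mO := measurable_dom adm.
apply: le_trans (HK P FP); apply: ge0_subset_integral.
- exact: measurableI.
- exact: measurableI.
- by apply: measurable_funS (measurable_dev adm) => //; exact: subIsetr.
- by move=> x _; exact: dev_ge0.
- exact: setSI.
Qed.

Lemma controlled0 : controlled F set0.
Proof.
split; first exact: measurable0.
by exists 0%R => // P _; rewrite /deviation set0I integral_set0 mul0e.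
Qed.

(** The part of B outside A is controlled too, and the constants add up. *)
Lemma controlledU (A B : set 'rV[R]_n) : controlled F A -> controlled F B ->
  controlled F (A `|` B).
Proof.
move=> cA cB; have [mA [K K0 HK]] := cA; have [mB _] := cB.
have [mBA [L L0 HL]] : controlled F (B `\` A).
  apply: controlled_sub cB; first exact: measurableD.
  by move=> x [].
split; first exact: measurableU.
exists (K + L)%R; first exact: addr_ge0.
move=> P FP; have adm := admF FP; have mO := measurable_dom adm.
rewrite EFinD ge0_muleDl ?lee_fin//.
apply: le_trans (leeD (HK P FP) (HL P FP)).
have AB : A `|` B = A `|` (B `\` A) by rewrite setUDr setDv setD0.
rewrite /deviation AB setIUl ge0_integral_setU//.
- exact: measurableI.
- exact: measurableI.
- by apply: measurable_funS (measurable_dev adm) => // x [] [].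
- by move=> x _; exact: dev_ge0.
- by apply/disj_set2P; rewrite -subset0 => x /= [[Ax _] [[_ nAx] _]].
Qed.

Lemma controlled_bigcup I (s : seq I) (A : I -> set 'rV[R]_n) :
  (forall i, controlled F (A i)) -> controlled F (\big[setU/set0]_(i <- s) A i).
Proof.
move=> cA; elim: s => [|i s IH]; first by rewrite big_nil; exact: controlled0.
by rewrite big_cons; exact: controlledU.
Qed.

(** Write u(x) - c as the difference of u along the segment plus
    u(x + t e_i) - c.  The first term is bounded by the energy and the second by the
    deviation on B, both after comparison of the weights along the segment. *)
Lemma controlled_translate (A B : set 'rV[R]_n) i (t : R) : measurable A -> controlled F B ->
  (forall P x, F P -> A x -> dom P x -> B (x + t *: delta_mx ord0 i)%R /\
     forall s, (0 <= s <= 1)%R -> dom P (x + (s * t) *: delta_mx ord0 i)%R /\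
       (wt P x <= 2 * wt P (x + (s * t) *: delta_mx ord0 i))%R) ->
  controlled F A.
Proof.
move=> mA [mB [K K0 HK]] AB; split => //.
set C := ((`|t| + 1) `^ p * 2 * `|t|)%R.
have C0 : (0 <= C)%R by rewrite /C !mulr_ge0 ?powR_ge0.
exists (2 `^ p * (C + 2 * K))%R.
  by rewrite mulr_ge0 ?powR_ge0// addr_ge0// mulr_ge0.
move=> P FP; have adm := admF FP; have mO := measurable_dom adm.
have [oO mw w0 [[mf _] wp]] := adm.
set u := fn P; set w := wt P; set c := level P; set O := dom P.
set te : 'rV[R]_n := (t *: delta_mx ord0 i)%R.
pose uO := u \_ O.
have muO : measurable_fun setT uO by exact: measurable_restrict_fun.
have mAO : measurable (A `&` O) by exact: measurableI.
have AO x : A x -> O x -> [/\ B (x + te)%R, O (x + te)%R & (w x <= 2 * w (x + te))%R].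
  move=> Ax Ox; have [Bx /(_ 1%R)] := AB P x FP Ax Ox.
  by rewrite ler01 lexx mul1r => /(_ isT) [].
pose f1 x := (`|uO (x + te)%R - uO x| `^ p * w x)%R.
pose f2 x := (`|uO (x + te)%R - c| `^ p * w (x + te))%R.
have muOt : measurable_fun setT (fun x : 'rV[R]_n => uO (x + te)%R).
  exact: (measurableT_comp muO (measurable_shift _)).
have mf1 : measurable_fun setT f1.
  apply: measurable_funM => //; apply: measurable_powabs => //.
  exact: measurable_funB.
have mf2 : measurable_fun setT f2.
  apply: measurable_funM; last exact: (measurableT_comp mw (measurable_shift _)).
  apply: measurable_powabs => //; exact: measurable_funB.
have f10 x : (0 <= f1 x)%R by rewrite mulr_ge0 ?powR_ge0.
have f20 x : (0 <= f2 x)%R by rewrite mulr_ge0 ?powR_ge0.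
have I1 : \int[mu]_(x in A `&` O) (f1 x)%:E <= C%:E * energy P.
  have := @coord_difference_bound R n i O oO u _ (wp i).1 p p1 t 2 (A `&` O) w w
     (ler0n _ 2) mAO mw mw w0 w0 _.
  move=> /(_ _) H; apply: (@le_trans _ _ (\int[mu]_(x in A `&` O) (`|u (x + te)%R - u x| `^ p * w x)%:E)).
    apply/eq_lee/eq_integral => x; rewrite inE => -[Ax Ox].
    have [_ Oxt _] := AO x Ax Ox.
    by rewrite /f1 /uO !patchE !mem_set.
  apply: le_trans (H _) _.
    by move=> x s [Ax Ox] s01; have [_ /(_ s s01)] := AB P x FP Ax Ox.
  by apply: lee_wpmul2l; [rewrite lee_fin|exact: coord_energy].
have I2 : \int[mu]_(x in A `&` O) (f2 x)%:E <= K%:E * energy P.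
  apply: le_trans (HK P FP); rewrite /deviation.
  pose g := (fun x => (`|uO x - c| `^ p * w x)%:E) \_ (B `&` O).
  have mg : measurable_fun setT g.
    have [+ _] := @measurable_restrictT _ _ _ _ (B `&` O) (fun x => (`|uO x - c| `^ p * w x)%:E) (measurableI _ _ mB mO).
    apply; apply: measurable_funTS; apply/measurable_EFinP; apply: measurable_funM => //.
    by apply: measurable_powabs => //; exact: measurable_funB.
  have g0 x : 0 <= g x.
    by rewrite /g patchE; case: ifP => // _; rewrite lee_fin mulr_ge0 ?powR_ge0.
  apply: (@le_trans _ _ (\int[mu]_x g (x + te)%R)); last first.
    rewrite ge0_integral_shift// [leRHS]integral_mkcond; apply/eq_lee/eq_integral => x _.
    by rewrite /g /uO !patchE; case: ifPn => //; rewrite inE => -[Bx Ox]; rewrite mem_set.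
  rewrite integral_mkcond; apply: ge0_le_integral => //.
  - by move=> x _; rewrite patchE; case: ifP => // _; rewrite lee_fin.
  - have [+ _] := @measurable_restrictT _ _ _ _ (A `&` O) (EFin \o f2) mAO.
    by apply; apply: measurable_funTS; exact/measurable_EFinP.
  - exact: (measurableT_comp mg (measurable_shift _)).
  - move=> x _; rewrite patchE; case: ifPn => // /[1!inE] -[Ax Ox].
    have [Bx Oxt _] := AO x Ax Ox.
    by rewrite /g patchE mem_set.
apply: (@le_trans _ _ (\int[mu]_(x in A `&` O) ((2 `^ p)%:E * ((f1 x)%:E + 2%:E * (f2 x)%:E)))).
  apply: ge0_le_integral => //.
  - by move=> x _; exact: dev_ge0.
  - by apply: measurable_funS (measurable_dev adm) => //; exact: subIsetr.
  - apply: measurable_funTS; apply: measurable_funeM; apply: emeasurable_funD; first exact/measurable_EFinP.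
    by apply: measurable_funeM; exact/measurable_EFinP.
  - move=> x [Ax Ox]; have [Bx Oxt wx] := AO x Ax Ox.
    rewrite -(EFinM 2) -EFinD -EFinM lee_fin /f1 /f2 /uO !patchE !mem_set// -/u -/w -/c.
    rewrite [X in (_ <= 2 `^ p * (_ + X))%R]mulrCA.
    have := @powR_addr_le R p p1 (- (u (x + te)%R - u x)) (u (x + te)%R - c).
    rewrite normrN (_ : - _ + _ = u x - c)%R; last by ring.
    move=> /(ler_wpM2r (w0 x))/le_trans; apply.
    rewrite -mulrA ler_wpM2l ?powR_ge0// mulrDl lerD2l.
    by rewrite ler_wpM2l ?powR_ge0.
rewrite ge0_integralZl_EFin ?powR_ge0//; last 2 first.
- by move=> x _; rewrite adde_ge0 ?mule_ge0 ?lee_fin.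
- apply: measurable_funTS; apply: emeasurable_funD; first exact/measurable_EFinP.
  by apply: measurable_funeM; exact/measurable_EFinP.
rewrite EFinM -muleA lee_wpmul2l ?lee_fin ?powR_ge0// ge0_integralD//; last 4 first.
- by move=> x _; rewrite lee_fin.
- by apply: measurable_funTS; exact/measurable_EFinP.
- by move=> x _; rewrite mule_ge0 ?lee_fin.
- by apply: measurable_funTS; apply: measurable_funeM; exact/measurable_EFinP.
rewrite ge0_integralZl_EFin//; last 2 first.
- by move=> x _; rewrite lee_fin.
- by apply: measurable_funTS; exact/measurable_EFinP.
rewrite (EFinD C) ge0_muleDl ?lee_fin ?mulr_ge0//; apply: leeD => //.
by rewrite EFinM -muleA lee_wpmul2l ?lee_fin.
Qed.

End control.

(** * The base cube *)

Section ball_measure.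
Context {R : realType} {n : nat}.
Local Notation mu := (lebesgue_rV R n).

Lemma ball_rV_coord (y x : 'rV[R]_n) r : 0 < r ->
  ball y r x <-> forall j, `|y ord0 j - x ord0 j| < r.
Proof.
move=> r0; rewrite ball_rVE norm_rV_lt//.
by split=> H j; have := H j; rewrite !mxE.
Qed.

Lemma ball_obox (y : 'rV[R]_n) r : 0 < r ->
  ball y r = obox (fun j => y ord0 j - r) (fun j => y ord0 j + r).
Proof.
move=> r0; apply/seteqP; split => x.
  move=> /(ball_rV_coord _ _ r0) H j; have := H j.
  by rewrite in_itv/= distrC ltr_norml; lra.
move=> H; apply/ball_rV_coord => // j; have := H j.
by rewrite in_itv/= distrC ltr_norml; lra.
Qed.

Lemma lebesgue_ball (y : 'rV[R]_n) r : 0 < r -> mu (ball y r) = ((2 * r) ^+ n)%:E.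
Proof.
move=> r0; rewrite ball_obox// lebesgue_obox.
rewrite (eq_bigr (fun=> (2 * r)%:E)) => [|j _].
  rewrite -[X in (_ ^+ X)%:E]card_ord -prodr_const.
  by elim/big_ind2 : _ => // a b c d -> ->; rewrite EFinM.
rewrite lebesgue_measure_itv/= lte_fin ifT; last lra.
by rewrite -EFinB; congr (_%:E); lra.
Qed.

Lemma measurable_ball_rV (y : 'rV[R]_n) r : measurable (ball y r : set 'rV[R]_n).
Proof. by apply: open_rV_measurable; exact: ball_open. Qed.

End ball_measure.

Lemma convex_norm_lt (R : realType) (s a b r : R) : 0 <= s -> s <= 1 ->
  `|a| < r -> `|b| < r -> `|(1 - s) * a + s * b| < r.
Proof.
move=> s0 s1 ar br; have M : Num.max `|a| `|b| < r by rewrite gt_max ar br.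
apply: le_lt_trans M; apply: le_trans (ler_normD _ _) _.
rewrite !normrM (ger0_norm s0) ger0_norm ?subr_ge0//.
apply: (@le_trans _ _ ((1 - s) * Num.max `|a| `|b| + s * Num.max `|a| `|b|)).
  by rewrite lerD// ler_wpM2l ?subr_ge0// le_max lexx ?orbT.
by rewrite -mulrDl subrK mul1r.
Qed.

Section base_cube.
Context {R : realType} {n : nat} (p : R) (p1 : 1 <= p).
Local Notation mu := (lebesgue_rV R n).
Local Open Scope ereal_scope.
Context (y : 'rV[R]_n) (r : R) (r0 : (0 < r)%R).
Local Notation B := (ball y r : set 'rV[R]_n).
Local Notation e_ k := (delta_mx ord0 k : 'rV[R]_n).

Let p0 : (0 < p)%R. Proof. exact: lt_le_trans p1. Qed.

(** The partial sums of h = sum_j h_j e_j: the corners of the path from 0 to h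
    that runs parallel to the axes. *)
Definition ctrunc (h : 'rV[R]_n) (k : nat) : 'rV[R]_n :=
  \row_j (if (j < k)%N then h ord0 j else 0%R).

Lemma ctrunc0 h : ctrunc h 0 = 0%R.
Proof. by apply/rowP => j; rewrite !mxE. Qed.

Lemma ctruncn h : ctrunc h n = h.
Proof. by apply/rowP => j; rewrite mxE ltn_ord. Qed.

Lemma ctruncS h (k : 'I_n) : ctrunc h k.+1 = (ctrunc h k + h ord0 k *: e_ k)%R.
Proof.
apply/rowP => j; rewrite !mxE ltnS eqxx/=.
have [->|jk] := eqVneq j k; first by rewrite leqnn ltnn mulr1 add0r.
by rewrite mulr0 addr0 leq_eqVlt -val_eqE/= in jk *; rewrite (negbTE jk).
Qed.

(** A ball for the sup norm is a cube, so a path between two of its points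
    that changes the coordinates one at a time stays inside. *)
Lemma ball_ctrunc h (k : 'I_n) x s : B x -> B (x + h)%R -> (0 <= s <= 1)%R ->
  B (x + ctrunc h k + (s * h ord0 k) *: e_ k)%R.
Proof.
move=> /(ball_rV_coord _ _ r0) Bx /(ball_rV_coord _ _ r0) Bxh /andP[s0 s1].
apply/ball_rV_coord => // j; have := Bx j; have := Bxh j; rewrite !mxE eqxx/=.
have [->|jk] := eqVneq j k; last by rewrite mulr0 addr0; case: ifP => _ //; rewrite addr0.
rewrite ltnn addr0 mulr1 => b_r a_r.
by rewrite (_ : (_ - _)%R = ((1 - s) * (y ord0 k - x ord0 k) + s * (y ord0 k - (x ord0 k + h ord0 k)))%R);
  [exact: convex_norm_lt|ring].
Qed.

Let step_cst := ((2 * r + 1) `^ p * 2 * (2 * r))%R.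

Fixpoint chain_cst (k : nat) : R := if k is m.+1 then (2 `^ p * (step_cst + chain_cst m))%R else 0%R.

Lemma step_cst_ge0 : (0 <= step_cst)%R.
Proof. by rewrite /step_cst !mulr_ge0 ?powR_ge0// ltW. Qed.

Lemma chain_cst_ge0 k : (0 <= chain_cst k)%R.
Proof. by elim: k => //= k IH; rewrite mulr_ge0 ?powR_ge0// addr_ge0// step_cst_ge0. Qed.

Context (P : sobolev_datum) (adm : admissible p P) (BP : B `<=` dom P)
  (wB : forall x, B x -> (2^-1 <= wt P x <= 1)%R).
Let uO := fn P \_ (dom P).

Let mB : measurable B. Proof. exact: measurable_ball_rV. Qed.

Let muO : measurable_fun setT uO.
Proof. by apply: measurable_restrict_fun; [exact: measurable_dom adm|exact: measurable_fn adm]. Qed.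

Let uOB x : B x -> uO x = fn P x.
Proof. by move=> Bx; rewrite /uO patchE mem_set//; exact: BP. Qed.

Let meas_diff (a b : 'rV[R]_n) : measurable_fun setT (fun x : 'rV[R]_n => `|uO (x + a)%R - uO (x + b)%R| `^ p)%R.
Proof.
apply: measurable_powabs => //; apply: measurable_funB.
  exact: (measurableT_comp muO (measurable_shift a)).
exact: (measurableT_comp muO (measurable_shift b)).
Qed.

Let meas_diff0 (a : 'rV[R]_n) : measurable_fun setT (fun x : 'rV[R]_n => `|uO (x + a)%R - uO x| `^ p)%R.
Proof.
rewrite (_ : (fun x : 'rV[R]_n => _) = (fun x => `|uO (x + a)%R - uO (x + 0)%R| `^ p)%R); first exact: meas_diff.
by apply/funext => x; rewrite addr0.
Qed.

Let overlap (h : 'rV[R]_n) := B `&` (fun x => x + h)%R @^-1` B.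

Let moverlap h : measurable (overlap h).
Proof.
by apply: measurableI => //; rewrite -[X in measurable X]setTI; exact: measurable_shift.
Qed.

(** The path from x to x + h along the axes stays in the cube, and each of its
    steps is bounded by [coord_difference_bound]. *)
Lemma chain_bound h k : (k <= n)%N ->
  \int[mu]_(x in overlap h) (`|uO (x + ctrunc h k)%R - uO x| `^ p)%:E <= (chain_cst k)%:E * energy p P.
Proof.
elim: k => [_|k IH kn].
  rewrite mul0e; under eq_integral do rewrite ctrunc0 addr0 subrr normr0 powR0 ?gt_eqF//.
  by rewrite integral0.
have [->|/set0P[z [Bz Bzh]]] := eqVneq (overlap h) set0.
  by rewrite integral_set0 mule_ge0 ?energy_ge0// lee_fin (chain_cst_ge0 k.+1).
have mS := moverlap h; pose k' : 'I_n := Ordinal kn.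
have hk : (`|h ord0 k'| <= 2 * r)%R.
  have := (ball_rV_coord _ _ r0).1 Bz k'; have := (ball_rV_coord _ _ r0).1 Bzh k'.
  rewrite !mxE !ltr_norml ler_norml => /andP[? ?] /andP[? ?]; apply/andP; split; lra.
have {}IH := IH (ltnW kn).
have tS : ctrunc h k.+1 = (ctrunc h k + h ord0 k' *: e_ k')%R by exact: (ctruncS h k').
pose f1 x := (`|uO (x + ctrunc h k.+1)%R - uO (x + ctrunc h k)%R| `^ p)%R.
pose f2 x := (`|uO (x + ctrunc h k)%R - uO x| `^ p)%R.
have mf1 : measurable_fun setT f1 by exact: meas_diff.
have mf2 : measurable_fun setT f2.
  exact: (meas_diff0 (ctrunc h k)).
have f10 x : (0 <= f1 x)%R by exact: powR_ge0.
have f20 x : (0 <= f2 x)%R by exact: powR_ge0.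
have I1 : \int[mu]_(x in overlap h) (f1 x)%:E <= step_cst%:E * energy p P.
  (* The corners reached after k steps. *)
  pose A := [set z | overlap h (z - ctrunc h k)%R].
  have mA : measurable A.
    by rewrite -[A]setTI; exact: (measurable_shift (- ctrunc h k)%R).
  have [oO mw w0 [[mf _] wp]] := adm.
  have AB z1 s : A z1 -> (0 <= s <= 1)%R -> B (z1 + (s * h ord0 k') *: e_ k')%R.
    move=> [Bz1 Bz2] s01; have := @ball_ctrunc h k' _ s Bz1 Bz2 s01.
    by rewrite subrK.
  have H := @coord_difference_bound R n k' (dom P) oO (fn P) _ (wp k').1 p p1
    (h ord0 k') 2 A (cst 1%R) (wt P) (ler0n _ 2) mA (@measurable_cst _ _ _ _ _ _) mw (fun=> ler01) w0.
  apply: (@le_trans _ _ (\int[mu]_(x in A) (`|fn P (x + h ord0 k' *: e_ k') - fn P x| `^ p * cst 1 x)%:E)).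
    pose g x := (`|uO (x + h ord0 k' *: e_ k')%R - uO x| `^ p)%R.
    have mg : measurable_fun setT g.
      exact: (meas_diff0 (h ord0 k' *: e_ k')%R).
    apply/eq_lee; transitivity (\int[mu]_(x in A) (g x)%:E); last first.
      apply: eq_integral => x; rewrite inE => Ax; rewrite /g /= mulr1 !uOB//.
        by have := AB x 0%R Ax; rewrite mul0r scale0r addr0 lexx ler01; exact.
      by have := AB x 1%R Ax; rewrite mul1r lexx ler01; exact.
    rewrite integral_mkcond [RHS]integral_mkcond.
    rewrite -(@ge0_integral_shift R n (ctrunc h k) ((EFin \o g) \_ A)).
    + apply: eq_integral => x _; rewrite !patchE.
      have -> : ((x + ctrunc h k)%R \in A) = (x \in overlap h).
        by apply/idP/idP; rewrite !inE /A /= addrK.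
      by rewrite /f1 /g /= tS addrA.
    + have [+ _] := @measurable_restrictT _ _ _ _ A (EFin \o g) mA; apply.
      by apply: measurable_funTS; exact/measurable_EFinP.
    + by move=> x; rewrite patchE; case: ifP => // _; rewrite lee_fin powR_ge0.
  apply: le_trans (H _) _.
    move=> x s Ax s01; have Bs := AB x s Ax s01; split; first exact: BP.
    by have /andP[w1 _] := wB Bs; rewrite /=; lra.
  apply: lee_pmul.
  - by rewrite lee_fin !mulr_ge0 ?powR_ge0.
  - by apply: integral_ge0 => x _; rewrite lee_fin mulr_ge0 ?powR_ge0.
  - rewrite lee_fin /step_cst ler_pM ?mulr_ge0 ?powR_ge0// ler_wpM2r//.
    apply: ge0_ler_powR; rewrite ?nnegrE ?addr_ge0 ?mulr_ge0//; [exact: ltW|exact: ltW|].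
    by rewrite lerD2r.
  - exact: coord_energy.
apply: (@le_trans _ _ (\int[mu]_(x in overlap h) ((2 `^ p)%:E * ((f1 x)%:E + (f2 x)%:E)))).
  apply: ge0_le_integral => //.
  - apply: measurable_funTS; apply/measurable_EFinP.
    exact: (meas_diff0 (ctrunc h k.+1)).
  - apply: measurable_funTS; apply: measurable_funeM; apply: emeasurable_funD; exact/measurable_EFinP.
  - move=> x _; rewrite -EFinD -EFinM lee_fin /f1 /f2.
    apply: le_trans (powR_addr_le p1 _ _).
    by rewrite (_ : (_ + _)%R = uO (x + ctrunc h k.+1) - uO x)%R//; ring.
rewrite ge0_integralZl_EFin ?powR_ge0//; last 2 first.
- by move=> x _; rewrite adde_ge0 ?lee_fin.
- by apply: measurable_funTS; apply: emeasurable_funD; exact/measurable_EFinP.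
rewrite [chain_cst k.+1]/= EFinM -muleA lee_wpmul2l ?lee_fin ?powR_ge0// ge0_integralD//; last 4 first.
- by move=> x _; rewrite lee_fin.
- by apply: measurable_funTS; exact/measurable_EFinP.
- by move=> x _; rewrite lee_fin.
- by apply: measurable_funTS; exact/measurable_EFinP.
rewrite (EFinD step_cst) ge0_muleDl ?lee_fin ?step_cst_ge0 ?chain_cst_ge0//; exact: leeD.
Qed.

(** Put z = x + h: for fixed h the inner integral is that of [chain_bound], and
    it vanishes unless |h| < 2 r. *)
Lemma double_integral_bound :
  \int[mu]_(x in B) \int[mu]_(z in B) (`|uO z - uO x| `^ p)%:E <=
  (chain_cst n * (2 * (2 * r)) ^+ n)%:E * energy p P.
Proof.
pose f (xh : 'rV[R]_n * 'rV[R]_n) := (`|uO (xh.1 + xh.2)%R - uO xh.1| `^ p *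
  (\1_B xh.1 * \1_B (xh.1 + xh.2)%R))%R.
have madd : measurable_fun setT (fun xh : 'rV[R]_n * 'rV[R]_n => xh.1 + xh.2)%R.
  exact: measurable_fun_add.
have f0 xh : (0 <= f xh)%R by rewrite mulr_ge0 ?powR_ge0// mulr_ge0.
have mind : measurable_fun setT (\1_B : 'rV[R]_n -> R) by exact: measurable_indic.
have mf : measurable_fun setT f.
  apply: measurable_funM.
    apply: measurable_powabs => //; apply: measurable_funB.
      exact: (measurableT_comp muO madd).
    exact: (measurableT_comp muO measurable_fst).
  apply: measurable_funM; first exact: (measurableT_comp mind measurable_fst).
  exact: (measurableT_comp mind madd).
have -> : \int[mu]_(x in B) \int[mu]_(z in B) (`|uO z - uO x| `^ p)%:E =
    \int[mu]_x \int[mu]_h (f (x, h))%:E.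
  rewrite [LHS]integral_mkcond; apply: eq_integral => x _; rewrite patchE.
  case: ifPn => xB; last first.
    apply/esym/integral0_eq => h _.
    by rewrite /f /= indicE (negbTE xB) mul0r mulr0.
  pose g := (fun z => (`|uO z - uO x| `^ p)%:E) \_ B.
  have mg : measurable_fun setT g.
    have [+ _] := @measurable_restrictT _ _ _ _ B (fun z => (`|uO z - uO x| `^ p)%:E) mB; apply.
    apply: measurable_funTS; apply/measurable_EFinP; apply: measurable_powabs => //.
    exact: measurable_funB.
  have g0 z : 0 <= g z by rewrite /g patchE; case: ifP => // _; rewrite lee_fin powR_ge0.
  rewrite integral_mkcond -(@ge0_integral_shift R n x g)//.
  apply: eq_integral => h _; rewrite /g /f patchE /= !indicE xB addrC.
  by case: ifP => _; rewrite ?mulr1 ?mulr0.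
rewrite (@tonelli_rV R n _ _ (@slebesgue R n) (EFin \o f)); last 2 first.
- exact/measurable_EFinP.
- by move=> x; rewrite lee_fin.
have D h : \int[mu]_x (f (x, h))%:E <= (chain_cst n)%:E * energy p P * (\1_(ball (0%R : 'rV[R]_n) (2 * r)) h)%:E.
  have -> : \int[mu]_x (f (x, h))%:E = \int[mu]_(x in overlap h) (`|uO (x + ctrunc h n)%R - uO x| `^ p)%:E.
    rewrite [RHS]integral_mkcond; apply: eq_integral => x _; rewrite patchE /f /= ctruncn !indicE.
    have -> : (x \in overlap h) = (x \in B) && ((x + h)%R \in B).
      by apply/idP/andP; rewrite !inE.
    by case: (x \in B); case: (_ \in B); rewrite /= ?mulr1 ?mulr0 ?mul0r ?mulr0.
  have [->|/set0P[z [Bz Bzh]]] := eqVneq (overlap h) set0.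
    by rewrite integral_set0 !mule_ge0 ?energy_ge0// lee_fin chain_cst_ge0.
  rewrite indicE mem_set ?mule1; first exact: chain_bound.
  apply/ball_rV_coord; first by rewrite mulr_gt0.
  move=> j; have := (ball_rV_coord _ _ r0).1 Bz j; have := (ball_rV_coord _ _ r0).1 Bzh j.
  rewrite !mxE !ltr_norml => /andP[? ?] /andP[? ?]; apply/andP; split; lra.
have r2 : (0 < 2 * r)%R by rewrite mulr_gt0.
apply: (@le_trans _ _ (\int[mu]_h ((chain_cst n)%:E * energy p P * (\1_(ball (0%R : 'rV[R]_n) (2 * r)) h)%:E))).
  apply: ge0_le_integral => //.
  - by move=> h _; apply: integral_ge0 => x _; rewrite lee_fin.
  - apply: (@measurable_fun_fubini_tonelli_G _ _ 'rV[R]_n 'rV[R]_n R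
      (@slebesgue R n : {sigma_finite_measure set 'rV[R]_n -> \bar R}) (EFin \o f)).
      exact/measurable_EFinP.
    by move=> x; rewrite lee_fin.
  - apply: measurable_funeM; apply/measurable_EFinP; apply: measurable_indic.
    exact: measurable_ball_rV.
  - by move=> h _; exact: D.
set D2 := ball (0%R : 'rV[R]_n) (2 * r).
have mD2 : measurable D2 by exact: measurable_ball_rV.
have mi : measurable_fun setT (fun h => (\1_D2 h)%:E : \bar R).
  by apply/measurable_EFinP; exact: measurable_indic.
have cE0 : 0 <= (chain_cst n)%:E * energy p P.
  by rewrite mule_ge0 ?energy_ge0// lee_fin chain_cst_ge0.
have i0 h : setT h -> 0 <= (\1_D2 h)%:E :> \bar R by rewrite lee_fin.
rewrite (@ge0_integralZl _ 'rV[R]_n R mu setT measurableT (fun h => (\1_D2 h)%:E) mi _ i0 cE0).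
rewrite integral_indic// setIT (_ : _ D2 = ((2 * (2 * r)) ^+ n)%:E).
  by rewrite EFinM muleAC.
by rewrite -(lebesgue_ball 0%R).
Qed.

Let K0 := (chain_cst n * (2 * (2 * r)) ^+ n / (2 * r) ^+ n + 1)%R.

(** If every x0 failed, integrating over B would contradict
    [double_integral_bound]. *)
Lemma good_center : exists2 x0, B x0 &
  \int[mu]_(z in B) (`|uO z - uO x0| `^ p)%:E <= K0%:E * energy p P.
Proof.
have r2 : (0 < 2 * r)%R by rewrite mulr_gt0.
have b0 : (0 < (2 * r) ^+ n)%R by rewrite exprn_gt0.
have M0 : (0 <= chain_cst n * (2 * (2 * r)) ^+ n)%R.
  by rewrite mulr_ge0 ?chain_cst_ge0// exprn_ge0// mulr_ge0// ltW.
have K00 : (0 < K0)%R by rewrite /K0 ltr_wpDl// divr_ge0// ltW.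
pose phi x := \int[mu]_(z in B) (`|uO z - uO x| `^ p)%:E.
have phi0 x : 0 <= phi x by apply: integral_ge0 => z _; rewrite lee_fin powR_ge0.
have mphi : measurable_fun setT phi.
  pose f2 (xz : 'rV[R]_n * 'rV[R]_n) := (`|uO xz.2 - uO xz.1| `^ p * \1_B xz.2)%R.
  rewrite (_ : phi = fun x => \int[mu]_z (f2 (x, z))%:E); last first.
    apply/funext => x; rewrite /phi integral_mkcond; apply: eq_integral => z _.
    by rewrite patchE /f2 /= indicE; case: ifP => _; rewrite ?mulr1 ?mulr0.
  apply: (@measurable_int_rV _ _ _ _ (EFin \o f2)).
    apply/measurable_EFinP; apply: measurable_funM.
      apply: measurable_powabs => //; apply: measurable_funB.
        exact: (measurableT_comp muO measurable_snd).
      exact: (measurableT_comp muO measurable_fst).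
    have mi : measurable_fun setT (\1_B : 'rV[R]_n -> R) by exact: measurable_indic.
    exact: (measurableT_comp mi measurable_snd).
  by move=> x; rewrite lee_fin mulr_ge0 ?powR_ge0.
have := double_integral_bound; have := energy_ge0 adm.
rewrite -/(energy p P); case: (energy p P) => [e| |]// e0 I; last first.
  by exists y; [exact: ballxx|rewrite gt0_muley ?leey ?lte_fin].
rewrite lee_fin in e0.
apply: contrapT => H; have {}H x : B x -> (K0 * e)%:E < phi x.
  move=> Bx; rewrite ltNge; apply/negP => le; apply: H; exists x => //.
(* With zero energy there is no strict inequality to integrate: the inner
   integral vanishes almost everywhere, yet is positive on B. *)
move: e0; rewrite le_eqVlt => /predU1P[e0|e0].
  have Z : \int[mu]_(x in B) `|phi x| = 0.
    apply/eqP; rewrite eq_le integral_ge0 ?andbT//.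
    under eq_integral do rewrite gee0_abs//.
    by move: I; rewrite -e0 mule0.
  have /(ae_eq_integral_abs mu mB (measurable_funTS mphi)) [N [mN N0 HN]] := Z.
  have : mu B <= mu N.
    apply: le_measure; rewrite ?inE// => x Bx; apply: HN => /= /(_ Bx) phix.
    by have := H x Bx; rewrite phix -e0 mulr0 ltxx.
  by rewrite N0 lebesgue_ball// lee_fin leNgt b0.
have : \int[mu]_(x in B) (K0 * e)%:E <= \int[mu]_(x in B) phi x.
  apply: ge0_le_integral => //.
  - by move=> x _; rewrite lee_fin mulr_ge0// ltW.
  - exact: measurable_funTS.
  - by move=> x Bx; exact: ltW (H x Bx).
rewrite integral_cst// => /le_trans/(_ I).
rewrite (_ : lebesgue_rV R n _ = ((2 * r) ^+ n)%:E); last by rewrite -(lebesgue_ball y).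
rewrite -!EFinM lee_fin mulrAC ler_pM2r// /K0 mulrDl divfK ?gt_eqF// mul1r.
by rewrite gerDl leNgt b0.
Qed.

Lemma good_center_deviation : exists2 x0, B x0 &
  \int[mu]_(x in B `&` dom P) (`|fn P x - fn P x0| `^ p * wt P x)%:E <= K0%:E * energy p P.
Proof.
have [x0 Bx0 H] := good_center; exists x0 => //; apply: le_trans H.
have [_ mw w0 _] := adm.
rewrite setIidl//; apply: ge0_le_integral => //.
- by move=> x _; rewrite lee_fin mulr_ge0 ?powR_ge0.
- apply/measurable_EFinP; apply: measurable_funM; last exact: measurable_funTS.
  apply: measurable_powabs => //; apply: measurable_funB => //.
  apply: measurable_funS (measurable_fn adm) => //; exact: measurable_dom adm.
- apply: measurable_funTS; apply/measurable_EFinP; apply: measurable_powabs => //.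
  exact: measurable_funB.
- move=> x Bx; rewrite !uOB// lee_fin ler_piMr ?powR_ge0//.
  by have /andP[] := wB Bx.
Qed.

End base_cube.

(** The constant c is the value of u at the point of [good_center]; the upper
    bound 1 on the weight brings the weight back into the integral. *)
Lemma base_cube (R : realType) (n : nat) (p : R) (y : 'rV[R]_n) (r : R) : 1 <= p -> 0 < r ->
  exists2 K : R, 0 <= K & forall P, admissible p P -> ball y r `<=` dom P ->
    (forall x, ball y r x -> 2^-1 <= wt P x <= 1) ->
    exists c, (deviation p (SobolevDatum (dom P) (wt P) (fn P) (gr P) c) (ball y r) <= K%:E * energy p P)%E.
Proof.
move=> p1 r0; exists (chain_cst p r n * (2 * (2 * r)) ^+ n / (2 * r) ^+ n + 1).
  have c0 : 0 <= chain_cst p r n by apply: chain_cst_ge0.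
  have rr : 0 <= 2 * r by rewrite mulr_ge0// ltW.
  by rewrite addr_ge0// divr_ge0 ?exprn_ge0// mulr_ge0// exprn_ge0// mulr_ge0.
move=> P adm BP wB.
by have [x0 Bx0 H] := good_center_deviation p1 r0 adm BP wB; exists (fn P x0).
Qed.

(** * The signed distance *)

Section enorm_theory.
Context {R : realType} {n : nat}.
Implicit Types x y : 'rV[R]_n.

Lemma enorm_sqr x : enorm x ^+ 2 = \sum_(i < n) x ord0 i ^+ 2.
Proof. by rewrite sqr_sqrtr// sumr_ge0// => i _; exact: sqr_ge0. Qed.

Lemma enorm_eq0 x : enorm x = 0 -> x = 0.
Proof.
move=> x0; apply/rowP => i; rewrite mxE; apply/eqP; rewrite -normr_le0.
by rewrite -x0 coord_le_enorm.
Qed.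

Lemma cauchy_schwarz x y : \sum_(i < n) x ord0 i * y ord0 i <= enorm x * enorm y.
Proof.
have [x0|x0] := eqVneq (enorm x) 0.
  rewrite x0 mul0r (enorm_eq0 x0) big1// => i _; by rewrite mxE mul0r.
have [y0|y0] := eqVneq (enorm y) 0.
  rewrite y0 mulr0 (enorm_eq0 y0) big1// => i _; by rewrite mxE mulr0.
have px : 0 < enorm x by rewrite lt0r x0 enorm_ge0.
have py : 0 < enorm y by rewrite lt0r y0 enorm_ge0.
set a := enorm x in px x0 *; set b := enorm y in py y0 *.
have key i : x ord0 i * y ord0 i <= a * b * ((x ord0 i ^+ 2 / a ^+ 2 + y ord0 i ^+ 2 / b ^+ 2) / 2).
  rewrite -subr_ge0.
  rewrite (_ : _ - _ = (x ord0 i * b - y ord0 i * a) ^+ 2 / (2 * a * b)); last by field; apply/andP.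
  by rewrite divr_ge0 ?sqr_ge0// !mulr_ge0// ltW.
apply: le_trans (ler_sum _ (fun i _ => key i)) _.
rewrite -mulr_sumr -mulr_suml big_split/= -!mulr_suml -!enorm_sqr -/a -/b.
rewrite (_ : a * b * _ = a * b)//; field; exact/andP.
Qed.

Lemma enorm_triangle x y : enorm (x + y) <= enorm x + enorm y.
Proof.
rewrite -[leRHS]ger0_norm ?addr_ge0 ?enorm_ge0// -sqrtr_sqr ler_wsqrtr//.
under eq_bigr do rewrite mxE sqrrD.
rewrite !big_split/= sqrrD -!enorm_sqr lerD2r lerD2l.
by rewrite mulr2n lerD// cauchy_schwarz.
Qed.

Lemma enormZ (t : R) x : enorm (t *: x) = `|t| * enorm x.
Proof.
rewrite /enorm -sqrtr_sqr -sqrtrM ?sqr_ge0//; congr Num.sqrt.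
by rewrite mulr_sumr; apply: eq_bigr => i _; rewrite mxE exprMn.
Qed.

Lemma enormN x : enorm (- x) = enorm x.
Proof. by rewrite -scaleN1r enormZ normrN1 mul1r. Qed.

Lemma enormB x y : enorm (x - y) = enorm (y - x).
Proof. by rewrite -enormN opprB. Qed.

Lemma norm_le_enorm x : `|x| <= enorm x.
Proof. by apply/norm_rV_le; [exact: enorm_ge0|exact: coord_le_enorm]. Qed.

Lemma enorm_le_norm x : enorm x <= n%:R * `|x|.
Proof.
rewrite -[leRHS]ger0_norm ?mulr_ge0// -sqrtr_sqr ler_wsqrtr//.
apply: (@le_trans _ _ (\sum_(i < n) `|x| ^+ 2)).
  apply: ler_sum => i _; rewrite -(real_normK (num_real (x ord0 i))).
  by rewrite lerXn2r ?nnegrE// coord_le_norm.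
rewrite sumr_const card_ord -[leLHS]mulr_natl exprMn ler_wpM2r ?sqr_ge0//.
by rewrite -natrX ler_nat; case: (n) => // m; rewrite expnS expn1 leq_pmulr.
Qed.

End enorm_theory.

Local Notation edist := Defs.edist.

Section edist_theory.
Context {R : realType} {n : nat}.
Implicit Types (x y : 'rV[R]_n) (A : set 'rV[R]_n).

Lemma edist_le A x y : A y -> edist x A <= enorm (x - y).
Proof.
move=> Ay; apply: ge_inf; last by exists y.
by exists 0 => _ [z _ <-]; exact: enorm_ge0.
Qed.

Lemma edist_ge A x (t : R) : A !=set0 -> (forall y, A y -> t <= enorm (x - y)) -> t <= edist x A.
Proof.
move=> [a Aa] H; apply: lb_le_inf; first by exists (enorm (x - a)); exists a.
by move=> _ [y Ay <-]; exact: H.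
Qed.

Lemma edist_ge0 A x : A !=set0 -> 0 <= edist x A.
Proof. by move=> A0; apply: edist_ge => // y _; exact: enorm_ge0. Qed.

Lemma edist_in A x : A x -> edist x A = 0.
Proof.
move=> Ax; apply/eqP; rewrite eq_le edist_ge0 ?andbT; last by exists x.
apply: le_trans (edist_le x Ax) _; rewrite subrr.
by rewrite -[0 : 'rV__](scale0r (0 : 'rV[R]_n)) enormZ normr0 mul0r.
Qed.

Lemma edist_approx A x (eps : R) : A !=set0 -> 0 < eps ->
  exists2 y, A y & enorm (x - y) < edist x A + eps.
Proof.
move=> [a Aa] e0.
have [] := @inf_adherent R [set enorm (x - y) | y in A] eps e0.
  split; first by exists (enorm (x - a)); exists a.
  by exists 0 => _ [z _ <-]; exact: enorm_ge0.
by move=> _ [y Ay <-] H; exists y.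
Qed.

Lemma edist_lip A x y : A !=set0 -> edist x A <= edist y A + enorm (x - y).
Proof.
move=> A0; rewrite -lerBlDr; apply: edist_ge => // z Az.
rewrite lerBlDr (le_trans (edist_le x Az))//.
by rewrite [leRHS]addrC (_ : x - z = (x - y) + (y - z)) ?enorm_triangle// addrA subrK.
Qed.

(** Move along the segment to a point that almost realizes the distance; the
    factor 1/2 absorbs the error. *)
Lemma edist_approach A x (s : R) : A !=set0 -> 0 < s -> s <= edist x A ->
  exists2 x', enorm (x' - x) = s & edist x' A <= edist x A - s / 2.
Proof.
move=> A0 s0 sx; have s2 : 0 < s / 2 by rewrite divr_gt0.
have [y Ay xy] := edist_approx x A0 s2.
set l := enorm (x - y) in xy.
have sl : s <= l := le_trans sx (edist_le x Ay).
have l0 : 0 < l := lt_le_trans s0 sl.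
exists (x + (s / l) *: (y - x)).
  rewrite addrC addKr enormZ enormB -/l ger0_norm ?divfK ?gt_eqF//.
  by rewrite divr_ge0// ltW.
apply: le_trans (edist_le _ Ay) _.
rewrite (_ : _ - y = (1 - s / l) *: (x - y)); last first.
  by apply/rowP => j; rewrite !mxE; ring.
rewrite enormZ -/l ger0_norm ?subr_ge0 ?ler_pdivrMr ?mul1r//.
rewrite mulrBl mul1r divfK ?gt_eqF//; move: xy; lra.
Qed.

End edist_theory.

Section sdist_theory.
Context {R : realType} {n : nat} (D : set 'rV[R]_n).
Context (D0 : D !=set0) (Dc0 : ~` D !=set0) (oD : open D).
Implicit Types x y : 'rV[R]_n.
Local Notation d := (sdist D).

Lemma sdist_lip x y : `|d x - d y| <= 2 * enorm (x - y).
Proof.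
have := edist_lip x y D0; have := edist_lip y x D0.
have := edist_lip x y Dc0; have := edist_lip y x Dc0.
rewrite (enormB y x) /sdist ler_norml => ? ? ? ?; apply/andP; split; lra.
Qed.

Lemma sdist_continuous : continuous d.
Proof.
move=> x; have FF : Filter (nbhs x) by exact: nbhs_filter.
apply/(@cvgrPdist_lt _ _ _ (nbhs x) FF) => e e0.
have c0 : 0 < (2 * n%:R + 1 : R) by rewrite ltr_wpDl// mulr_ge0.
rewrite -near_nbhs; apply/nbhs_ballP; exists (e / (2 * n%:R + 1)).
  by rewrite /= divr_gt0.
move=> y /ball_rVE; rewrite ltr_pdivlMr// => xy.
apply: le_lt_trans (sdist_lip x y) (le_lt_trans _ xy).
apply: (@le_trans _ _ (2 * (n%:R * `|x - y|))); first by rewrite ler_wpM2l// enorm_le_norm.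
by rewrite -subr_ge0 (_ : _ - _ = `|x - y|)//; ring.
Qed.

Lemma sdist_in x : D x -> d x = - edist x (~` D).
Proof. by move=> Dx; rewrite /sdist edist_in// sub0r. Qed.

Lemma sdist_out x : ~ D x -> d x = edist x D.
Proof. by move=> Dx; rewrite /sdist (@edist_in _ _ (~` D))// subr0. Qed.

Lemma sdist_lt0 x : (d x < 0) <-> D x.
Proof.
split=> [|Dx].
  by apply: contraPP => Dx; rewrite sdist_out// => /lt_geF; rewrite edist_ge0.
rewrite sdist_in// oppr_lt0.
have /nbhs_ballP[e /= e0 eD] := open_nbhs_nbhs (conj oD Dx).
apply: lt_le_trans e0 _; apply: edist_ge => // y Dy.
rewrite leNgt; apply/negP => xy; apply: Dy; apply: eD; apply/ball_rVE.
exact: le_lt_trans (norm_le_enorm _) xy.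
Qed.

Lemma offset0 : offset D 0 = D.
Proof. by apply/seteqP; split => x /sdist_lt0. Qed.

(** Moving toward the other side of the boundary changes d at a speed of at
    least 1/2.  This replaces the eikonal equation |grad d| = 1. *)
Lemma sdist_speed x (s : R) : 0 < s -> s <= `|d x| ->
  exists2 x', enorm (x' - x) = s & s / 2 <= `|d x' - d x|.
Proof.
move=> s0 sx; have [Dx|Dx] := pselect (D x).
  have dx0 := (sdist_lt0 x).2 Dx.
  rewrite ltr0_norm// sdist_in// opprK in sx.
  have [x' x'x H] := edist_approach Dc0 s0 sx; exists x' => //.
  rewrite ler_normr; apply/orP; left; rewrite (sdist_in Dx) /sdist.
  have := edist_ge0 x' D0; lra.
have dx0 : 0 <= d x by rewrite sdist_out// edist_ge0.
rewrite ger0_norm// sdist_out// in sx.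
have [x' x'x H] := edist_approach D0 s0 sx; exists x' => //.
rewrite ler_normr; apply/orP; right; rewrite (sdist_out Dx) /sdist.
have := edist_ge0 x' Dc0; lra.
Qed.

Lemma offset_open (t : R) : open (offset D t).
Proof.
rewrite (_ : offset D t = d @^-1` [set r | r < t])//.
by apply: open_comp => [x _|]; [exact: sdist_continuous|exact: open_lt].
Qed.

Lemma sub_tube (e : R) x : `|d x| < e -> tube D e x.
Proof.
rewrite ltr_norml => /andP[xl xr]; split => // clx.
have : [set y | d y <= - e] x.
  have cl : closed [set y | d y <= - e].
    rewrite (_ : [set y | _] = d @^-1` [set r | r <= - e])//.
    by apply: closed_comp => [y _|]; [exact: sdist_continuous|exact: closed_le].
  rewrite ((closure_id _).1 cl); apply: closure_subset clx => y /=.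
  exact: ltW.
by rewrite /= leNgt xl.
Qed.

(** [sdist_speed] says nothing at a zero of d.  Such a point is outside D but at
    distance 0 from D, where d is negative. *)
Lemma near_nonzero x (eps : R) : 0 < eps -> exists2 y, `|x - y| < eps & d y != 0.
Proof.
move=> e0; have [dx|dx] := eqVneq (d x) 0; last by exists x; rewrite ?subrr ?normr0.
have nDx : ~ D x by move/sdist_lt0; rewrite dx ltxx.
have [y Dy xy] := edist_approx x D0 e0.
rewrite -(sdist_out nDx) dx add0r in xy.
exists y; first exact: le_lt_trans (norm_le_enorm _) xy.
by rewrite lt_eqF//; exact/sdist_lt0.
Qed.

End sdist_theory.

(** * Descent directions of the signed distance *)

Section line_derivative.
Context {R : realType} {n : nat} (f : 'rV[R]_n -> R) (i : 'I_n).
Implicit Types (x : 'rV[R]_n) (a t : R).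
Local Notation e_ := (delta_mx ord0 i : 'rV[R]_n).

Lemma is_derive_line x a t : differentiable f (x + (t * a) *: e_) ->
  is_derive t 1 (fun t => f (x + (t * a) *: e_)) (a * partial i f (x + (t * a) *: e_)).
Proof.
move=> df; set y := x + (t * a) *: e_ in df *.
have dy : is_derive y (a *: e_) f (a * partial i f y).
  apply: DeriveDef; first exact: diff_derivable.
  by rewrite /partial !deriveE// linearZ.
have E : (fun h => h^-1 *: ((f \o shift y) (h *: (a *: e_)) - f y)) =
  (fun h => h^-1 *: (((fun t => f (x + (t * a) *: e_)) \o shift t) (h *: 1) - f y)).
  apply/funext => h /=; congr (_ *: (f _ - _)).
  by apply/rowP => j; rewrite [h *: 1]mulr1 !mxE; ring.
case: dy => dy1 dy2; apply: DeriveDef.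
  by move: dy1; rewrite /derivable E.
by move: dy2; rewrite /derive E.
Qed.

Lemma line_mean_value x a (s : R) : 0 <= s ->
  (forall t, 0 <= t <= s -> differentiable f (x + (t * a) *: e_)) ->
  exists2 t, 0 <= t <= s &
    f (x + (s * a) *: e_) - f x = a * partial i f (x + (t * a) *: e_) * s.
Proof.
move=> s0 df.
pose F t := f (x + (t * a) *: e_).
pose F' t := a * partial i f (x + (t * a) *: e_).
have dF (t : R) : t \in `[0, s] -> is_derive t 1 F (F' t).
  by rewrite in_itv/= => ts; apply: is_derive_line; exact: df.
have dF0 (t : R) : t \in `]0, s[ -> is_derive t 1 F (F' t).
  by move=> ts; apply: dF; exact: subset_itv_oo_cc ts.
have cF : {within `[0, s], continuous F}.
  by apply: derivable_within_continuous => t ts; have [] := dF t ts.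
have [t] := @MVT_segment R F F' 0 s s0 dF0 cF.
rewrite in_itv/= subr0 /F /F' mul0r scale0r addr0 => ts H.
by exists t.
Qed.

End line_derivative.

Section descent.
Context {R : realType} {n : nat} (D : set 'rV[R]_n) (e0 : R) (e00 : 0 < e0).
Context (D0 : D !=set0) (Dc0 : ~` D !=set0) (oD : open D).
Local Notation d := (sdist D).
Context (C11 : C11_on (tube D (2 * e0)) d).

Lemma partial_lip : exists2 L : R, 0 < L & forall x y i, tube D (2 * e0) x -> tube D (2 * e0) y ->
  `|partial i d x - partial i d y| <= L * `|x - y|.
Proof.
have [_ lip] := C11.
have [L L0 HL] := pinfty_ex_gt0 lip.
exists L => // x y i tx ty.
have := HL (x, y) (conj tx ty); apply: le_trans.
have := coord_le_norm (grad d x - grad d y) i.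
by rewrite !mxE.
Qed.

(** Were all partial derivatives small at z, they would be small near z by the
    Lipschitz bound on the gradient, and d would vary more slowly than [sdist_speed]
    allows.  So some partial derivative is bounded away from 0 at z, hence with the
    same sign near z. *)
Lemma descent_direction z : `|d z| < 2 * e0 -> exists rho kappa sigma i,
  [/\ 0 < rho, 0 < kappa, `|sigma| <= 1 &
   forall x s, ball z rho x -> 0 <= s <= rho ->
     d (x + (s * sigma) *: delta_mx ord0 i) <= d x - kappa * s].
Proof.
move=> dz; have [L L0 HL] := partial_lip.
have dc := sdist_continuous D0 Dc0.
have /nbhs_ballP[rho0 /= rho00 Hrho0] : nbhs z [set x | `|d x| < 2 * e0].
  have : open [set x | `|d x| < 2 * e0].
    rewrite (_ : mkset _ = (fun x => `|d x|) @^-1` [set r | r < 2 * e0])//.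
    apply: open_comp => [x _|]; last exact: open_lt.
    by apply: continuous_comp; [exact: dc|exact: norm_continuous].
  by move=> oU; apply: open_nbhs_nbhs.
(* Small enough that n steps of slope 2 c stay below the speed 1/2. *)
pose c : R := (8 * n.+1%:R)^-1.
have c0 : 0 < c by rewrite invr_gt0 mulr_gt0.
pose rho := Num.min rho0 (c / 2 / L).
have rho_gt0 : 0 < rho by rewrite lt_min rho00/= !divr_gt0.
have tubeP x : ball z rho x -> tube D (2 * e0) x.
  move=> zx; apply: sub_tube => //; apply: Hrho0.
  by apply: le_ball zx; rewrite ge_min lexx.
have partial_close x i : ball z rho x -> `|partial i d x - partial i d z| <= c / 2.
  move=> zx; apply: le_trans (HL x z i (tubeP x zx) (tubeP z (ballxx _ rho_gt0))) _.
  rewrite mulrC -ler_pdivlMr//; move/ball_rVE : zx; rewrite distrC => /ltW/le_trans; apply.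
  by rewrite ge_min lexx orbT.
have dd x : ball z rho x -> differentiable d x.
  by move=> zx; have [df _] := C11; apply/df/tubeP.
have [[i ci]|/forallNP small] := pselect (exists i, c <= `|partial i d z|).
  exists (rho / 2), (c / 2), (- Num.sg (partial i d z)), i; split.
  - by rewrite divr_gt0.
  - by rewrite divr_gt0.
  - by rewrite normrN normr_sg; case: (_ == _).
  move=> x s zx /andP[s0 srho]; set sigma := - Num.sg _.
  have s1 : `|sigma| <= 1 by rewrite /sigma normrN normr_sg; case: (_ == _).
  have inball t : 0 <= t <= s -> ball z rho (x + (t * sigma) *: delta_mx ord0 i).
    move=> /andP[t0 ts]; apply/ball_rV_coord => // j.
    have := (ball_rV_coord z x (divr_gt0 rho_gt0 (ltr0n R 2))).1 zx j.
    rewrite !mxE eqxx/= => zxj.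
    rewrite opprD addrA (le_lt_trans (ler_normB _ _))//.
    have tsig : `|t * sigma * (j == i)%:R| <= rho / 2.
      rewrite !normrM (ger0_norm t0) -mulrA (le_trans _ (le_trans ts srho))//.
      by rewrite ler_piMr// mulr_ile1//; case: (_ == _); rewrite ?normr1 ?normr0.
    lra.
  have [t ts ->] : exists2 t, 0 <= t <= s & d (x + (s * sigma) *: delta_mx ord0 i) = d x + sigma * partial i d (x + (t * sigma) *: delta_mx ord0 i) * s.
    have [t ts H] := @line_mean_value R n d i x sigma s s0 (fun t ts => dd _ (inball t ts)).
    by exists t => //; rewrite -H subrKC.
  rewrite lerD2l -mulNr ler_wpM2r//.
  have := partial_close _ i (inball t ts).
  set b := partial i d (x + _); rewrite /sigma mulNr lerN2.
  move: ci; case: (sgrP (partial i d z)) => [->|pz|pz].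
  - by rewrite leNgt c0.
  - by rewrite mul1r ler_norml => ? /andP[? ?]; lra.
  - by rewrite mulN1r ler_norml => ? /andP[? ?]; lra.
exfalso.
have small2 x i : ball z rho x -> `|partial i d x| <= 2 * c.
  move=> zx; have := partial_close x i zx; have /negP := small i; rewrite -ltNge.
  move: (partial i d x) (partial i d z) => a b.
  rewrite ltr_norml !ler_norml => /andP[? ?] /andP[? ?]; apply/andP; split; lra.
have lipd x h k : ball z rho x -> ball z rho (x + h) -> (k <= n)%N ->
    `|d (x + ctrunc h k) - d x| <= k%:R * (2 * c * `|h|).
  move=> zx zxh; elim: k => [_|k IH kn]; first by rewrite ctrunc0 addr0 subrr normr0 mul0r.
  pose k' := Ordinal kn.
  have [|t t01 H] := @line_mean_value R n d k' (x + ctrunc h k) (h ord0 k') 1 ler01.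
    by move=> t t01; apply: dd; exact: (@ball_ctrunc _ _ _ _ rho_gt0 h k' x t zx zxh t01).
  rewrite (ctruncS h k') addrA -[d _ - _](subrKA (d (x + ctrunc h k))).
  apply: le_trans (ler_normD _ _) _.
  rewrite -natr1 mulrDl mul1r [leRHS]addrC lerD ?IH ?(ltnW kn)//.
  move: H; rewrite mul1r mulr1 => ->; rewrite normrM mulrC ler_pM ?normr_ge0//.
    by apply: small2; exact: (@ball_ctrunc _ _ _ _ rho_gt0 h k' x t zx zxh t01).
  exact: coord_le_norm.
have [y zy dy] := near_nonzero D0 Dc0 oD z (divr_gt0 rho_gt0 (ltr0n R 2)).
pose s := Num.min `|d y| (rho / 4).
have s0 : 0 < s by rewrite lt_min normr_gt0 dy divr_gt0.
have [x' x'y Hs] : exists2 x', enorm (x' - y) = s & s / 2 <= `|d x' - d y|.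
  by apply: sdist_speed => //; rewrite ge_min lexx.
have nx' : `|x' - y| <= s by rewrite -x'y norm_le_enorm.
have s4 : s <= rho / 4 by rewrite ge_min lexx orbT.
have zy' : ball z rho y by apply/ball_rVE; lra.
have zx' : ball z rho (y + (x' - y)).
  apply/ball_rVE; rewrite subrKC.
  rewrite (_ : z - x' = (z - y) - (x' - y)); last by rewrite opprB addrA subrK.
  by apply: le_lt_trans (ler_normB _ _) _; lra.
have := lipd y (x' - y) n zy' zx' (leqnn n); rewrite ctruncn [y + _]addrC subrK => H.
have : s / 2 <= n%:R * (2 * c * s).
  apply: le_trans Hs (le_trans H _).
  by rewrite ler_wpM2l// ler_wpM2l// mulr_ge0// ltW.
rewrite (_ : n%:R * (2 * c * s) = (2 * c * n%:R) * s); last by ring.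
rewrite [s / 2]mulrC ler_pM2r// leNgt => /negP; apply.
have n1 : 0 < n.+1%:R :> R by rewrite ltr0n.
have nn : n%:R < n.+1%:R :> R by rewrite ltr_nat.
rewrite (_ : 2 * c * n%:R = n%:R / n.+1%:R / 4); last by rewrite /c; field; rewrite ?gt_eqF.
have : n%:R / n.+1%:R < 1 :> R by rewrite ltr_pdivrMr// mul1r.
by move: (n%:R / n.+1%:R : R) => q q1; lra.
Qed.

End descent.

(** * From a cube to the interior *)

Section interior.
Context {R : realType} {n : nat} (p : R) (p1 : 1 <= p) (D : set 'rV[R]_n).
Context (oD : open D) (cD : connected D).
Context (F : set (@sobolev_datum R n)) (admF : forall P, F P -> admissible p P).
Context (DF : forall P, F P -> D `<=` dom P).
Context (wF : forall P x, F P -> D x -> 2^-1 <= wt P x <= 1).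

(** Both balls lie in D, where the weights are comparable.  The translation from
    one to the other is done one coordinate at a time. *)
Lemma controlled_move x r y rho : 0 < r -> ball x r `<=` D -> ball x (r / 2) y ->
  0 < rho -> rho <= r / 2 -> controlled p F (ball y rho) -> controlled p F (ball x rho).
Proof.
move=> r0 xD xy rho0 rhor cy.
have r2 : 0 < r / 2 by rewrite divr_gt0.
pose h := x - y.
suff H k : (k <= n)%N -> controlled p F (ball (y + ctrunc h k) rho).
  by have := H n (leqnn n); rewrite ctruncn /h subrKC.
elim: k => [_|k IH kn]; first by rewrite ctrunc0 addr0.
pose k' := Ordinal kn.
apply: (@controlled_translate _ _ p p1 F admF _ (ball (y + ctrunc h k) rho) k' (- h ord0 k')).
- exact: measurable_ball_rV.
- exact: IH (ltnW kn).
move=> P w FP; rewrite (ctruncS h k') => /ball_rVE yw Ow.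
have path s : 0 <= s <= 1 -> D (w + (s * - h ord0 k') *: delta_mx ord0 k').
  move=> /andP[s0 s1]; apply: xD; apply/ball_rVE.
  have : ball x (r / 2) (y + ctrunc h k + ((1 - s) * h ord0 k') *: delta_mx ord0 k').
    apply: (@ball_ctrunc _ _ _ _ r2 h k' y (1 - s) xy).
      by rewrite /h subrKC; exact: ballxx.
    by rewrite subr_ge0 s1 gerBl.
  move/ball_rVE; set c := (y + ctrunc h k + _ *: _) => xc.
  rewrite (_ : x - _ = (x - c) + (y + (ctrunc h k' + h ord0 k' *: delta_mx ord0 k') - w)); last first.
    by rewrite /c /=; apply/rowP => j; rewrite !mxE; ring.
  apply: le_lt_trans (ler_normD _ _) _; move: xc yw rhor.
  by move: (`|x - c|) (`|_ - w|) => a b; lra.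
split.
  apply/ball_rVE; rewrite (_ : _ - _ = y + (ctrunc h k' + h ord0 k' *: delta_mx ord0 k') - w)//.
  by apply/rowP => j; rewrite !mxE /=; ring.
move=> s s01; have Dp := path s s01; split; first exact: DF Dp.
have D0 : D w by have := path 0; rewrite lexx ler01 mul0r scale0r addr0; exact.
have /andP[_ w1] := wF FP D0; have /andP[w2 _] := wF FP Dp.
by move: w1 w2; move: (wt P w) (wt P _) => a b; lra.
Qed.

(** The points of D with a controlled ball around them form an open and relatively
    closed subset of D. *)
Lemma controlled_everywhere y0 rho0 : D y0 -> 0 < rho0 -> controlled p F (ball y0 rho0) ->
  forall x, D x -> exists2 rho, 0 < rho & controlled p F (ball x rho).
Proof.
move=> Dy0 rho00 c0.
pose G := [set x | D x /\ exists2 rho, 0 < rho & controlled p F (ball x rho)].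
have GD : G `<=` D by move=> x [].
suff GE : G = D by move=> x; rewrite -GE => -[].
have shrink x rho rho' : rho' <= rho -> controlled p F (ball x rho) -> controlled p F (ball x rho').
  move=> le; apply: controlled_sub => //; first exact: measurable_ball_rV.
  exact: le_ball.
apply: cD.
- by exists y0; split => //; exists rho0.
- exists G; last by apply/seteqP; split => x; [move=> Gx; split => //; exact: GD|case].
  rewrite openE => x [Dx [rho r0 crho]]; rewrite /interior.
  have /nbhs_ballP[e /= e0 eD] := open_nbhs_nbhs (conj oD Dx).
  apply/nbhs_ballP; exists (Num.min (rho / 2) e); first by rewrite /= lt_min divr_gt0.
  move=> y xy; split; first by apply: eD; apply: le_ball xy; rewrite ge_min lexx orbT.
  exists (rho / 2); first by rewrite divr_gt0.
  apply: controlled_sub crho => //; first exact: measurable_ball_rV.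
  move=> z /ball_rVE yz; move/ball_rVE : xy; rewrite lt_min => /andP[xy _].
  apply/ball_rVE; rewrite -(subrKA y); apply: le_lt_trans (ler_normD _ _) _.
  by move: yz xy; move: (`|_|) (`|_|) => a b; lra.
- exists (closure G); first exact: closed_closure.
  apply/seteqP; split => x; first by move=> Gx; split; [exact: GD|exact: subset_closure].
  move=> [Dx clx]; split => //.
  have /nbhs_ballP[r /= r0 rD] := open_nbhs_nbhs (conj oD Dx).
  have r2 : 0 < r / 2 by rewrite divr_gt0.
  have [y [[Dy [rho rho1 crho]] xy]] := clx _ (nbhsx_ballx x _ r2).
  exists (Num.min rho (r / 2)); first by rewrite lt_min rho1.
  apply: (@controlled_move x r y) => //.
  + by rewrite lt_min rho1.
  + by rewrite ge_min lexx orbT.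
  + by apply: shrink crho; rewrite ge_min lexx.
Qed.

Lemma controlled_compact y0 rho0 (K : set 'rV[R]_n) : D y0 -> 0 < rho0 -> controlled p F (ball y0 rho0) ->
  compact K -> measurable K -> K `<=` D -> controlled p F K.
Proof.
move=> Dy0 rho00 c0 cK mK KD.
have /choice[rho rhoP] x : exists rho, D x -> 0 < rho /\ controlled p F (ball x rho).
  have [Dx|nDx] := pselect (D x); last by exists 0.
  by have [rho r0 cr] := controlled_everywhere Dy0 rho00 c0 Dx; exists rho.
move: cK; rewrite compact_cover => /(_ _ K (fun x => ball x (rho x))) [].
- by move=> x _; exact: ball_open.
- by move=> x Kx; exists x => //; apply: ballxx; exact: (rhoP x (KD x Kx)).1.
move=> s sK; rewrite /cover bigcup_fset => Ks.
apply: controlled_sub Ks _ => //.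
pose A x := if x \in s then ball x (rho x) else set0.
rewrite (_ : \big[setU/set0]_(x <- s) _ = \big[setU/set0]_(x <- s) A x).
  apply: controlled_bigcup => // x; rewrite /A; case: ifP => [/sK/set_mem Kx|_]; last exact: controlled0.
  by have [] := rhoP x (KD x Kx).
by rewrite big_seq [RHS]big_seq; apply: eq_bigr => x xs; rewrite /A xs.
Qed.

End interior.

(** * From the interior to the collar *)

Section collar.
Context {R : realType} {n : nat} (p : R) (p1 : 1 <= p) (D : set 'rV[R]_n.+1).
Context (e0 : R) (e00 : 0 < e0) (D0 : D !=set0) (Dc0 : ~` D !=set0) (oD : open D).
Context (bD : bounded_set D).
Local Notation d := (sdist D).
Context (C11 : C11_on (tube D (2 * e0)) d).
Context (F : set (@sobolev_datum R n.+1)) (admF : forall P, F P -> admissible p P).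
Context (domF : forall P, F P -> exists e, dom P = offset D e).
Context (wF : forall P x y, F P -> dom P x -> dom P y -> d y <= d x -> wt P x <= wt P y).

Lemma bounded_sublevel (t : R) : bounded_set [set x | d x <= t].
Proof.
have [M [_ HM]] := bD.
have DM y : D y -> `|y| <= Num.max M 0 + 1.
  by move=> Dy; apply: (HM (Num.max M 0 + 1)) => //; rewrite ltr_pwDr// le_max lexx.
exists (Num.max M 0 + 1 + (Num.max t 0 + 1)); split; first exact: num_real.
move=> B MB x /= xt; apply: le_trans (ltW MB).
have [Dx|nDx] := pselect (D x).
  by rewrite (le_trans (DM x Dx))// lerDl addr_ge0// le_max lexx orbT.
have [y Dy xy] := edist_approx x D0 ltr01.
rewrite -(subrK y x) addrC; apply: le_trans (ler_normD _ _) _.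
rewrite lerD ?DM//; apply: le_trans (norm_le_enorm _) _; apply: le_trans (ltW xy) _.
by rewrite lerD2r -(sdist_out nDx) le_max xt.
Qed.

Lemma closed_sublevel (t : R) : closed [set x | d x <= t].
Proof.
rewrite (_ : mkset _ = d @^-1` [set r | r <= t])//.
by apply: closed_comp => [y _|]; [exact: sdist_continuous|exact: closed_le].
Qed.

Lemma compact_sublevel (t : R) : compact [set x | d x <= t].
Proof. by apply: bounded_closed_compact; [exact: bounded_sublevel|exact: closed_sublevel]. Qed.

Lemma measurable_sublevel (t : R) : measurable [set x | d x <= t].
Proof.
rewrite -[X in measurable X]setCK; apply: measurableC; apply: open_rV_measurable.
by apply: closed_openC; exact: closed_sublevel.
Qed.

(** Induction on the level t, in steps of a fixed height delta: a finite cover of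
    the collar gives one delta, and each piece of {t < d <= t + delta} descends into
    {d <= t} by a translation.  The data live on sublevels of d and their weights
    increase downwards, so the conditions along the segments hold by themselves. *)
Lemma controlled_collar : controlled p F [set x | d x <= - e0] ->
  controlled p F [set x | d x <= e0].
Proof.
move=> c0.
have /choice[data dataP] (z : 'rV[R]_n.+1) : exists dt : (R * R) * (R * 'I_n.+1), `|d z| < 2 * e0 ->
   [/\ 0 < dt.1.1, 0 < dt.1.2, `|dt.2.1| <= 1 & forall x s, ball z dt.1.1 x -> 0 <= s <= dt.1.1 ->
     d (x + (s * dt.2.1) *: delta_mx ord0 dt.2.2) <= d x - dt.1.2 * s].
  have [zd|zd] := pselect (`|d z| < 2 * e0); last by exists ((0, 0), (0, ord0)).
  have [rho [kappa [sigma [i H]]]] := descent_direction D0 Dc0 oD C11 zd.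
  by exists ((rho, kappa), (sigma, i)).
pose Z := [set x | `|d x| <= e0].
have Z2 z : Z z -> `|d z| < 2 * e0.
  by move=> Zz; apply: le_lt_trans Zz _; rewrite ltr_pMl// ltr1n.
have cZ : compact Z.
  apply: (subclosed_compact _ (@compact_sublevel e0)).
    rewrite (_ : Z = (fun x => `|d x|) @^-1` [set r | r <= e0])//.
    apply: closed_comp => [y _|]; last exact: closed_le.
    by apply: continuous_comp; [exact: sdist_continuous|exact: norm_continuous].
  by move=> x; rewrite /Z /= ler_norml => /andP[].
move: cZ; rewrite compact_cover => /(_ _ Z (fun x => ball x (data x).1.1)) [].
- by move=> x _; exact: ball_open.
- by move=> x Zx; exists x => //; apply: ballxx; have [] := dataP x (Z2 x Zx).
move=> s sZ; rewrite /cover bigcup_fset => Zs.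
pose delta := \big[Num.min/1]_(z <- s) ((data z).1.2 * (data z).1.1).
have delta0 : 0 < delta.
  rewrite /delta big_seq; elim/big_ind : _ => //; first by move=> a b a0 b0; rewrite lt_min a0.
  move=> z /sZ/set_mem Zz; have [? ? _ _] := dataP z (Z2 z Zz).
  exact: mulr_gt0.
have delta_le z : z \in s -> delta <= (data z).1.2 * (data z).1.1.
  move=> zs; rewrite /delta; have : z \in (s : seq _) by [].
  elim: (s : seq _) => // y s' IH; rewrite inE big_cons => /predU1P[->|zs'].
    by rewrite ge_min lexx.
  by rewrite ge_min IH ?orbT.
have H m : controlled p F [set x | d x <= Num.min e0 (- e0 + m%:R * delta)].
  elim: m => [|m IH].
    by rewrite mul0r addr0 min_r// (le_trans _ (ltW e00))// oppr_le0 ltW.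
  set t := - e0 + m%:R * delta in IH.
  have te0 : - e0 <= t by rewrite /t lerDl mulr_ge0// ltW.
  have -> : - e0 + m.+1%:R * delta = t + delta by rewrite /t -natr1 mulrDl mul1r addrA.
  pose piece z := if z \in s then ball z (data z).1.1 `&` [set x | d x <= Num.min e0 (t + delta)] else set0.
  apply: (@controlled_sub _ _ p F admF _ ([set x | d x <= Num.min e0 t] `|` \big[setU/set0]_(z <- s) piece z)).
  - exact: measurable_sublevel.
  - move=> x /=; rewrite le_min => /andP[xe0 xt].
    have [xt'|tx] := leP (d x) t; first by left; rewrite /= le_min xe0.
    right; have Zx : Z x by rewrite /Z /= ler_norml xe0 andbT; lra.
    have := Zs x Zx; rewrite -!bigcup_seq => -[z /= zs zx]; exists z => //.
    by rewrite /piece zs; split => //=; rewrite le_min xe0.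
  apply: controlledU => //; apply: controlled_bigcup => // z.
  rewrite /piece; case: ifPn => zs; last exact: controlled0.
  have Zz : Z z by apply/set_mem/sZ.
  have [rho0 kappa0 sig1 Hd] := dataP z (Z2 z Zz).
  have dle := delta_le z zs.
  set rho := (data z).1.1 in rho0 Hd dle *; set kappa := (data z).1.2 in kappa0 Hd dle.
  set sigma := (data z).2.1 in sig1 Hd; set i := (data z).2.2 in Hd.
  apply: (@controlled_translate _ _ p p1 F admF _ [set x | d x <= Num.min e0 t] i (rho * sigma)).
  - by apply: measurableI; [exact: measurable_ball_rV|exact: measurable_sublevel].
  - exact: IH.
  move=> P x FP [zx /= xt] Ox; split.
    have := Hd x rho zx; rewrite lexx (ltW rho0) => /(_ isT).
    move: xt; rewrite /= !le_min; move: (d (_ + _)) (d x) => a b.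
    by move=> /andP[? ?] ?; apply/andP; split; lra.
  move=> u /andP[u0 u1]; rewrite mulrA.
  have dx : d (x + (u * rho * sigma) *: delta_mx ord0 i) <= d x.
    have urho : 0 <= u * rho <= rho.
      by rewrite mulr_ge0//= ?ler_piMl// ltW.
    apply: le_trans (Hd x _ zx urho) _; rewrite gerBl mulr_ge0//; first exact: ltW.
    by case/andP: urho.
  have Op : dom P (x + (u * rho * sigma) *: delta_mx ord0 i).
    have [e De] := domF FP; move: Ox; rewrite De /offset /=; exact: le_lt_trans.
  split => //; apply: le_trans (wF FP Ox Op dx) _.
  by rewrite ler_peMl// ?ler1n//; have [_ _ w0 _] := admF FP.
have [m Hm] : exists m : nat, e0 + e0 <= m%:R * delta.
  exists (Num.bound ((e0 + e0) / delta)); rewrite -ler_pdivrMr//.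
  by apply/ltW/archi_boundP; rewrite divr_ge0 ?addr_ge0// ltW.
by have := H m; rewrite min_l//; lra.
Qed.

End collar.

(** * The weight *)

Section cutoff.
Context {R : realType} (S : R -> R) (hS : S1 S).

Lemma S1_continuous : continuous S.
Proof.
have [lip _ _ _] := hS.
have [L L0 HL] := pinfty_ex_gt0 lip.
move=> x; apply/cvgrPdist_lt => e e0; near=> y.
apply: le_lt_trans (HL (x, y) (conj I I)) _ => /=.
rewrite mulrC -ltr_pdivlMr//; near: y.
by apply: cvgr_dist_lt => //; rewrite divr_gt0.
Unshelve. all: by end_near. Qed.

Lemma S1_ge1 t : 1 <= t -> S t = 1.
Proof.
move=> t1; have t0 : 0 < t by apply: lt_le_trans t1.
have [_ -> //] := hS; first by rewrite gtr0_norm// divff// gt_eqF.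
by rewrite gtr0_norm.
Qed.

Lemma S1_odd t : S (- t) = - S t. Proof. by have [] := hS. Qed.

Lemma S1_le1 t : t <= -1 -> S t = -1.
Proof. by move=> t1; rewrite -[t]opprK S1_odd S1_ge1// lerNr. Qed.

(** S is constant outside [-1, 1], so it factors through the projection onto this
    interval, where the derivative is positive. *)
Lemma S1_nondecreasing : {homo S : x y / x <= y}.
Proof.
pose clamp (t : R) := Num.max (-1) (Num.min t 1).
have SE t : S t = S (clamp t).
  rewrite /clamp; have [t1|t1] := leP t 1.
    have [tm|tm] := leP (-1) t; first by [].
    by rewrite (S1_le1 (ltW tm)) S1_le1.
  by rewrite max_r ?(S1_ge1 (ltW t1)) ?S1_ge1//; lra.
have clamp_homo x y : x <= y -> clamp x <= clamp y.
  by move=> xy; rewrite /clamp ge_max le_max lexx/= le_max le_min !ge_min lexx xy !orbT.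
have clamp_ge t : -1 <= clamp t by rewrite /clamp le_max lexx.
have clamp_le t : clamp t <= 1 by rewrite /clamp ge_max ge_min lexx orbT andbT; lra.
move=> x y xy; rewrite (SE x) (SE y).
have := clamp_homo x y xy; have := clamp_ge x; have := clamp_le y.
move: (clamp x) (clamp y) => a b b1 a1; rewrite le_eqVlt => /predU1P[->//|ab].
have [_ _ dS _] := hS.
have dd t : t \in `]a, b[ -> is_derive t 1 S ('D_1 S t).
  rewrite in_itv/= => /andP[ta tb].
  have [|? _] := dS t; first by rewrite ltr_norml; apply/andP; split; lra.
  exact: DeriveDef.
have [t tab H] := @MVT R S (fun t => 'D_1 S t) a b ab dd (continuous_subspaceT S1_continuous).
rewrite -subr_ge0 H mulr_ge0 ?subr_ge0 ?(ltW ab)//.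
move: tab; rewrite in_itv/= => /andP[ta tb].
have [|_ /ltW //] := dS t; rewrite ltr_norml; apply/andP; split; lra.
Qed.

Lemma S1_bound t : -1 <= S t <= 1.
Proof.
apply/andP; split.
  have -> : -1 = S (Num.min t (-1)) by rewrite S1_le1// ge_min lexx orbT.
  by apply: S1_nondecreasing; rewrite ge_min lexx.
have -> : 1 = S (Num.max t 1) by rewrite S1_ge1// le_max lexx orbT.
by apply: S1_nondecreasing; rewrite le_max lexx.
Qed.

Lemma S1_ge0 t : 0 <= t -> 0 <= S t.
Proof.
have S0 : S 0 = 0 by have := S1_odd 0; rewrite oppr0; lra.
by move=> t0; rewrite -S0; exact: S1_nondecreasing.
Qed.

End cutoff.

Section weight.
Context {R : realType} {n : nat} (D : set 'rV[R]_n) (S : R -> R) (hS : S1 S).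
Context (D0 : D !=set0) (Dc0 : ~` D !=set0) (oD : open D).
Local Notation d := (sdist D).
Local Notation w := (omega D S).

Lemma omega_measurable e : measurable_fun setT (w e).
Proof.
rewrite /omega; case: (e == 0); first by apply: measurable_indic; exact: open_rV_measurable.
apply: continuous_rV_measurable => x.
apply: (@continuousM _ _ (fun x => 1 + S (- d x / e)) (fun=> 2^-1)); last exact: cst_continuous.
apply: (@continuousD R R 'rV[R]_n (fun=> 1) (fun x => S (- d x / e)) x); first exact: cst_continuous.
apply: (@continuous_comp _ _ _ (fun x => - d x / e) S); last exact: S1_continuous.
apply: (@continuousM _ _ (fun x => - d x) (fun=> e^-1)); last exact: cst_continuous.
by apply: continuousN; exact: sdist_continuous.
Qed.

Lemma omega_ge0_le1 e x : 0 <= w e x <= 1.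
Proof.
rewrite /omega; case: ifP => _; first by rewrite indicE; case: (_ \in _); rewrite lexx ler01.
by have /andP[? ?] := S1_bound hS (- d x / e); apply/andP; split; lra.
Qed.

Lemma omega_ge_half e x : 0 <= e -> D x -> 2^-1 <= w e x <= 1.
Proof.
move=> e0 Dx; have /andP[_ ->] := omega_ge0_le1 e x; rewrite andbT /omega.
case: ifP => _; first by rewrite indicE (mem_set Dx) invf_le1 ?ler1n.
have : 0 <= S (- d x / e).
  have dx : d x < 0 by apply/sdist_lt0.
  by apply: S1_ge0 => //; rewrite divr_ge0// oppr_ge0 ltW.
by move: (S _) => s; lra.
Qed.

Lemma omega_mono e x y : 0 <= e -> offset D e x -> offset D e y -> d y <= d x -> w e x <= w e y.
Proof.
move=> e0 Ox Oy yx; rewrite /omega; case: ifPn => [/eqP e00|en].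
  by move: Ox Oy; rewrite e00 offset0// => Dx Dy; rewrite !indicE !mem_set.
rewrite ler_wpM2r// lerD2l; apply: S1_nondecreasing => //.
by rewrite ler_wpM2r ?invr_ge0// lerN2.
Qed.

End weight.

(** * The weighted mean *)

Section mean.
Context {R : realType} {n : nat} (p : R) (p1 : 1 <= p).
Local Notation mu := (lebesgue_rV R n).
Context (O : set 'rV[R]_n) (mO : measurable O) (w u : 'rV[R]_n -> R).
Context (mw : measurable_fun setT w) (w0 : forall x, 0 <= w x) (mu_ : measurable_fun O u).
Context (W : R) (W0 : 0 < W) (intW : (\int[mu]_(x in O) (w x)%:E = W%:E)%E).
Context (up : (\int[mu]_(x in O) (`|u x| `^ p * w x)%:E < +oo)%E).
Local Open Scope ereal_scope.

Let p0 : (0 < p)%R. Proof. exact: lt_le_trans p1. Qed.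

Let integrable_w : mu.-integrable O (EFin \o w).
Proof.
apply/integrableP; split; first by apply/measurable_EFinP; exact: measurable_funTS.
under eq_integral do rewrite /= ger0_norm//.
by rewrite intW ltry.
Qed.

Let integrable_uw : mu.-integrable O (fun x => (u x * w x)%:E).
Proof.
apply/integrableP; split.
  by apply/measurable_EFinP; apply: measurable_funM => //; exact: measurable_funTS.
apply: (@le_lt_trans _ _ (\int[mu]_(x in O) ((w x)%:E + (`|u x| `^ p * w x)%:E))).
  apply: ge0_le_integral => //.
  - apply: measurableT_comp => //; apply/measurable_EFinP.
    by apply: measurable_funM => //; exact: measurable_funTS.
  - apply: emeasurable_funD; apply/measurable_EFinP; first exact: measurable_funTS.
    by apply: measurable_funM; [exact: measurable_powabs|exact: measurable_funTS].
  - move=> x _; rewrite -EFinD lee_fin normrM (ger0_norm (w0 x)).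
    rewrite -[X in (X + _)%R]mul1r -mulrDl ler_wpM2r//.
    have := @le_add_powR R p p1 `|u x|%R 1 (normr_ge0 _) ltr01.
    by rewrite powR1 mulr1.
rewrite ge0_integralD//.
- by rewrite intW lte_add_pinfty ?ltry.
- by move=> x _; rewrite lee_fin.
- by apply/measurable_EFinP; exact: measurable_funTS.
- by move=> x _; rewrite lee_fin mulr_ge0 ?powR_ge0.
- apply/measurable_EFinP; apply: measurable_funM; [exact: measurable_powabs|exact: measurable_funTS].
Qed.

(** The mean of u differs from c by the mean of u - c, to which [powR_mean]
    applies. *)
Lemma mean_dev (c : R) : (`|wmean O w u - c| `^ p * W)%:E <=
  (2 `^ p)%:E * \int[mu]_(x in O) (`|u x - c| `^ p * w x)%:E.
Proof.
have wE : (\int[mu]_(x in O) w x)%R = W by rewrite /Rintegral intW.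
have mcw : mu.-integrable O (fun x => (c * w x)%:E).
  by have := integrableZl mO c integrable_w; apply: eq_integrable.
have E : (wmean O w u - c = (\int[mu]_(x in O) ((u x - c) * w x)) / W)%R.
  rewrite /wmean wE; apply: (mulIf (lt0r_neq0 W0)); rewrite mulrBl !divfK ?gt_eqF//.
  under [in RHS]eq_Rintegral do rewrite mulrBl.
  by rewrite RintegralB// RintegralZl// wE.
have iucw : mu.-integrable O (fun x => ((u x - c) * w x)%:E).
  have := integrableB mO integrable_uw mcw.
  by apply: eq_integrable => // x _; rewrite -EFinB mulrBl.
pose f := (fun x => `|u x - c|)%R \_ O.
pose v := (fun x => w x / W)%R \_ O.
have mf : measurable_fun setT f.
  apply: measurable_restrict_fun => //; apply: measurableT_comp => //.
  exact: measurable_funB.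
have mv : measurable_fun setT v.
  by apply: measurable_restrict_fun => //; apply: measurable_funM => //; exact: measurable_funTS.
have f0 x : (0 <= f x)%R by rewrite /f patchE; case: ifP.
have v0 x : (0 <= v x)%R by rewrite /v patchE; case: ifP => // _; rewrite divr_ge0// ltW.
have W'0 : (0 <= W^-1)%R by rewrite invr_ge0 ltW.
have intv : \int[mu]_x (v x)%:E = 1%:E.
  transitivity (\int[mu]_(x in O) ((W^-1)%:E * (w x)%:E)).
    rewrite [RHS]integral_mkcond; apply: eq_integral => x _; rewrite /v !patchE.
    by case: ifP => // _; rewrite -EFinM mulrC.
  rewrite ge0_integralZl_EFin//.
  - by rewrite intW -EFinM mulVf// gt_eqF.
  - by move=> x _; rewrite lee_fin.
  - by apply/measurable_EFinP; exact: measurable_funTS.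
have rle : `|wmean O w u - c|%:E <= \int[mu]_x (f x * v x)%:E.
  have -> : \int[mu]_x (f x * v x)%:E = (W^-1)%:E * \int[mu]_(x in O) `|((u x - c) * w x)%:E|.
    rewrite -ge0_integralZl_EFin//; last first.
      by apply: measurableT_comp => //; exact: measurable_int iucw.
    rewrite [RHS]integral_mkcond; apply: eq_integral => x _; rewrite /f /v !patchE.
    case: ifP => _; last by rewrite mul0r.
    by rewrite -EFinM normrM (ger0_norm (w0 x)); congr (_%:E); ring.
  rewrite E normrM [(`|W^-1|)%R]ger0_norm// EFinM muleC lee_wpmul2l ?lee_fin//.
  rewrite /Rintegral -fine_abse; last exact: integrable_fin_num.
  rewrite fineK; last by rewrite abse_fin_num; exact: integrable_fin_num.
  by apply: le_abse_integral => //; exact: measurable_int iucw.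
have := @powR_mean _ _ R mu p p1 f v 1 _ mf mv f0 v0 intv (normr_ge0 _) rle.
rewrite EFinM => H; apply: le_trans (lee_wpmul2r _ H) _; first by rewrite lee_fin ltW.
rewrite -muleA lee_wpmul2l ?lee_fin ?powR_ge0// muleC -ge0_integralZl_EFin//=; last 3 first.
- by move=> x _; rewrite lee_fin mulr_ge0 ?powR_ge0.
- apply/measurable_EFinP; apply: measurable_funM => //.
  exact: (measurableT_comp (measurable_powR p) mf).
- exact: ltW.
apply: eq_lee; rewrite [RHS]integral_mkcond; apply: eq_integral => x _; rewrite /f /v !patchE.
case: ifP => _; last by rewrite mulr0 mule0.
by rewrite -EFinM; congr (_%:E); rewrite mulrCA; congr (_ * _)%R; rewrite mulrC divfK// gt_eqF.
Qed.

(** |u - m| <= |u - c| + |m - c|, and [mean_dev] bounds the constant |m - c|. *)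
Lemma mean_minimizes (c : R) : \int[mu]_(x in O) (`|u x - wmean O w u| `^ p * w x)%:E <=
  (2 `^ p * (1 + 2 `^ p))%:E * \int[mu]_(x in O) (`|u x - c| `^ p * w x)%:E.
Proof.
set m := wmean O w u.
have mpow a : measurable_fun O (fun x => (`|u x - a| `^ p * w x)%:E).
  apply/measurable_EFinP; apply: measurable_funM; last exact: measurable_funTS.
  by apply: measurable_powabs => //; exact: measurable_funB.
have mw' : measurable_fun O (fun x => (w x)%:E).
  by apply/measurable_EFinP; exact: measurable_funTS.
apply: (@le_trans _ _ (\int[mu]_(x in O) ((2 `^ p)%:E * ((`|u x - c| `^ p * w x)%:E + (`|m - c| `^ p)%:E * (w x)%:E)))).
  apply: ge0_le_integral => //.
  - by move=> x _; rewrite lee_fin mulr_ge0 ?powR_ge0.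
  - by apply: measurable_funeM; apply: emeasurable_funD => //; exact: measurable_funeM.
  - move=> x _; rewrite -(EFinM (`|m - c| `^ p)%R) -EFinD -EFinM lee_fin -mulrDl mulrA ler_wpM2r//.
    have := @powR_addr_le R p p1 (u x - c) (- (m - c)).
    by rewrite normrN (_ : _ + _ = u x - m)%R//; ring.
rewrite ge0_integralZl_EFin ?powR_ge0//; last 2 first.
- by move=> x _; rewrite adde_ge0 ?mule_ge0 ?lee_fin ?mulr_ge0 ?powR_ge0.
- by apply: emeasurable_funD => //; exact: measurable_funeM.
rewrite EFinM -muleA lee_wpmul2l ?lee_fin ?powR_ge0//.
rewrite ge0_integralD//; last 3 first.
- by move=> x _; rewrite lee_fin mulr_ge0 ?powR_ge0.
- by move=> x _; rewrite mule_ge0 ?lee_fin ?powR_ge0.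
- exact: measurable_funeM.
rewrite ge0_integralZl_EFin ?powR_ge0//; last by move=> x _; rewrite lee_fin.
rewrite intW -EFinM EFinD ge0_muleDl ?lee_fin ?powR_ge0// mul1e leeD2l//.
exact: mean_dev.
Qed.

End mean.

(** * The Poincare inequality *)

Lemma bounded_setC_nonempty (R : realType) (n : nat) (D : set 'rV[R]_n.+1) :
  bounded_set D -> ~` D !=set0.
Proof.
move=> [M [_ HM]]; have MM : M < `|M| + 1 by rewrite ltr_pwDr// ler_norm.
exists (const_mx (`|M| + 2)) => Dx.
have := le_trans (coord_le_norm _ ord0) (HM _ MM _ Dx).
by rewrite mxE ger0_norm ?addr_ge0// lerD2l; lra.
Qed.

Lemma bounded_lebesgue_lty (R : realType) (n : nat) (A B : set 'rV[R]_n) :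
  measurable A -> bounded_set B -> A `<=` B -> (lebesgue_rV R n A < +oo)%E.
Proof.
move=> mA [M [_ HM]] AB; have MM : M < `|M| + 1 by rewrite ltr_pwDr// ler_norm.
apply: le_lt_trans (lebesgue_obox_lty (fun=> - (`|M| + 2)) (fun=> `|M| + 2)).
apply: le_measure; [exact: mem_set|apply: mem_set; exact: measurable_obox|].
move=> x /AB /(HM _ MM) xM i; rewrite in_itv/= -ltr_norml.
by rewrite (le_lt_trans (coord_le_norm x i))// (le_lt_trans xM)// ltrD2l; lra.
Qed.

(** The mean value makes sense: the weight is bounded, and bounded below on a
    ball. *)
Lemma weight_mass (R : realType) (n : nat) (O : set 'rV[R]_n) (w : 'rV[R]_n -> R)
    (y : 'rV[R]_n) (r : R) :
  measurable O -> (lebesgue_rV R n O < +oo)%E -> measurable_fun setT w ->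
  (forall x, 0 <= w x <= 1) -> 0 < r -> ball y r `<=` O ->
  (forall x, ball y r x -> 2^-1 <= w x) ->
  exists2 W : R, 0 < W & (\int[lebesgue_rV R n]_(x in O) (w x)%:E = W%:E)%E.
Proof.
move=> mO Olty mw w01 r0 yO wy.
have w0 x : 0 <= w x by case/andP: (w01 x).
have mwO A : measurable_fun A (fun x => (w x)%:E).
  by apply/measurable_EFinP; exact: measurable_funTS.
set I := (\int[_]_(x in O) _)%E.
have I0 : (0 < I)%E.
  apply: (@lt_le_trans _ _ (\int[lebesgue_rV R n]_(x in ball y r) (2^-1)%:E)%E).
    rewrite integral_cst ?lebesgue_ball//; last exact: measurable_ball_rV.
    by rewrite -EFinM lte_fin mulr_gt0 ?exprn_gt0 ?mulr_gt0 ?invr_gt0.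
  apply: (@le_trans _ _ (\int[lebesgue_rV R n]_(x in ball y r) (w x)%:E)%E).
    apply: ge0_le_integral => //; first exact: measurable_ball_rV.
  apply: ge0_subset_integral => //; first exact: measurable_ball_rV.
  by move=> x _; rewrite lee_fin.
have Ifin : (I < +oo)%E.
  apply: le_lt_trans Olty; rewrite -[leRHS]mul1e -integral_cst//.
  apply: ge0_le_integral => //; first by move=> x _; rewrite lee_fin.
  by move=> x _; rewrite lee_fin; case/andP: (w01 x).
have If : I \is a fin_num by rewrite ge0_fin_numE// ltW.
by exists (fine I); rewrite ?fineK// fine_gt0// I0.
Qed.

Theorem corollary4p10 (R : realType) (n : nat) (D : set 'rV[R]_n.+1)
    (e0 : R) (S : R -> R) (p : R) :
  open D -> connected D -> D !=set0 -> bounded_set D -> C11_boundary D ->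
  0 < e0 -> C11_on (tube D (2 * e0)) (sdist D) ->
  unique_projection_on (bdry D) (tube D (2 * e0)) ->
  S1 S -> S2 S -> 1 <= p ->
  exists C : R, forall e : R, 0 <= e <= e0 -> connected (offset D e) ->
  forall (u : 'rV[R]_n.+1 -> R) (g : 'rV[R]_n.+1 -> 'rV[R]_n.+1),
    wW1p p (offset D e) (omega D S e) u g ->
    (wLnorm p (offset D e) (omega D S e)
       (fun x => (u x - wmean (offset D e) (omega D S e) u)%R)
     <= C%:E * wLnorm p (offset D e) (omega D S e) (fun x => enorm (g x)))%E.
Proof.
move=> oD cD D0 bD _ e00 C11 _ hS _ p1.
have Dc0 := bounded_setC_nonempty bD.
have p0 : 0 < p := lt_le_trans ltr01 p1.
have [y Dy] := D0.
have /nbhs_ballP[r /= r0 rD] := open_nbhs_nbhs (conj oD Dy).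
have [K0 K00 HK0] := base_cube y p1 r0.
have D_offset e : 0 <= e -> D `<=` offset D e.
  by move=> e_ge0 x Dx; apply: lt_le_trans e_ge0; exact/sdist_lt0.
pose F := [set P : @sobolev_datum R n.+1 | exists e u g c, [/\ 0 <= e,
  P = SobolevDatum (offset D e) (omega D S e) u g c, admissible p P &
  (deviation p P (ball y r) <= K0%:E * energy p P)%E]].
have admF P : F P -> admissible p P by case=> e [u [g [c []]]].
have cball : controlled p F (ball y r).
  split; first exact: measurable_ball_rV.
  by exists K0 => // P [e [u [g [c []]]]].
have [mK [K Kge0 HK]] : controlled p F [set x | sdist D x <= e0].
  apply: (controlled_collar p1 e00 D0 Dc0 oD bD C11 admF).
  - by move=> P [e [u [g [c [_ -> _ _]]]]]; exists e.
  - by move=> P x x' [e [u [g [c [e_ge0 -> _ _]]]]] /=; exact: omega_mono.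
  apply: (@controlled_compact _ _ p p1 D oD cD F admF _ _ y r) => //.
  - by move=> P [e [u [g [c [e_ge0 -> _ _]]]]]; exact: D_offset.
  - by move=> P x [e [u [g [c [e_ge0 -> _ _]]]]]; exact: omega_ge_half.
  - exact: compact_sublevel.
  - exact: measurable_sublevel.
  - move=> x /= xe; apply/sdist_lt0 => //; apply: le_lt_trans xe _.
    by rewrite oppr_lt0.
exists ((2 `^ p * (1 + 2 `^ p) * K) `^ p^-1) => e /andP[e_ge0 ee0] _ u g ug.
set O := offset D e; set w := omega D S e.
have oO : open O by exact: offset_open.
have mO := open_rV_measurable oO.
have mw : measurable_fun setT w by exact: omega_measurable.
have w01 x : 0 <= w x <= 1 by exact: omega_ge0_le1.
have w0 x : 0 <= w x by case/andP: (w01 x).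
have wy x : ball y r x -> 2^-1 <= w x <= 1 by move=> /rD; exact: omega_ge_half.
have yO : ball y r `<=` O by move=> x /rD; exact: D_offset.
have adm c : admissible p (SobolevDatum O w u g c) by [].
have [c Hc] := HK0 _ (adm 0) yO wy.
have FP : F (SobolevDatum O w u g c) by exists e, u, g, c.
have Oe0 : O `<=` [set x | sdist D x <= e0].
  by move=> x /= xe; exact: le_trans (ltW xe) ee0.
have := HK _ FP; rewrite /deviation /energy /= setIidr// => dev.
have [W W0 intW] : exists2 W : R, 0 < W & (\int[lebesgue_rV R n.+1]_(x in O) (w x)%:E = W%:E)%E.
  apply: (weight_mass mO _ mw w01 r0 yO); last by move=> x /wy /andP[].
  apply: bounded_lebesgue_lty Oe0 => //; exact: bounded_sublevel.
have [[mu_ ulty] _] := ug.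
have pV0 : p^-1 != 0 by rewrite invr_eq0 gt_eqF.
have := mean_minimizes p1 mO mw w0 mu_ W0 intW (lty_poweRy pV0 ulty) c.
have A0 : 0 <= 2 `^ p * (1 + 2 `^ p) :> R.
  by rewrite mulr_ge0 ?addr_ge0 ?powR_ge0.
move=> /le_trans /(_ (lee_wpmul2l _ dev)); rewrite lee_fin => /(_ A0).
rewrite muleA -EFinM => main.
have int0 (f : 'rV[R]_n.+1 -> R) : (0 <= \int[lebesgue_rV R n.+1]_(x in O) (`|f x| `^ p * w x)%:E)%E.
  by apply: integral_ge0 => x _; rewrite lee_fin mulr_ge0 ?powR_ge0.
have AK0 : (0 <= (2 `^ p * (1 + 2 `^ p) * K)%:E)%E by rewrite lee_fin mulr_ge0.
have in0 (z : \bar R) : (0 <= z)%E -> z \in `[0%E, +oo%E] by move=> z0; rewrite in_itv/= z0 leey.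
rewrite /wLnorm -poweR_EFin -poweRM//.
apply: gt0_ler_poweR; [by rewrite invr_ge0 ltW|exact: in0|by apply: in0; rewrite mule_ge0|].
apply: le_trans main _; apply: eq_lee; congr (_ * _)%E.
by apply: eq_integral => x _ /=; rewrite (ger0_norm (enorm_ge0 (g x))).
Qed.
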